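(* Let $x \in \mathbb{C}\setminus(\mathbb{R}^-\cup\{1\})$ and let $\nu\in\mathbb{C}$ with $\mathrm{Re}(\nu)<0$. Let $\mathscr{H}_0$ and the operator $\mathfrak{L}:\mathscr{H}_0\to\mathscr{H}_0$ be as defined in the context. Then: (a) $\mathfrak{L}:\mathscr{H}_0\to\mathscr{H}_0$ is a bijection; (b) given $K\in\mathscr{H}_0$, the solution $E^*=\mathfrak{L}^{-1}K\in\mathscr{H}_0$ of the equation $\mathfrak{L}E^*=K$ has the integral representation $$E^*(z) = \mathfrak{L}^{-1}K(z) = \frac{1-x}{2i\pi x}\, e^{z}\int_{1}^{(0+)} \frac{e^{-xtz}}{t(t-1)}\, K\left(x\,z\,(-t)^{\nu}(1-t)^{1-\nu}\right)\mathrm{d}t, \qquad z\in\mathbb{C},$$ where the contour in the variable $t$ is a loop starting and ending at the point $t=1$ and encircling the origin $t=0$ once in the positive (counterclockwise) sense.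
   Context: $\mathbb{R}^-=\,]-\infty,0]$. $\mathscr{H}_0$ is the linear space of entire functions on $\mathbb{C}$ vanishing at $0$. With $\mathfrak{R}(\zeta) = (1-\zeta)^{-\nu}(1-(1-x)\zeta)^{\nu-1}$ for $\zeta\in[0,1]$ (principal branches) and $c=\frac{1-\nu x}{1-x}$, the operator $\mathfrak{L}$ is $$\mathfrak{L}f(z)=\int_0^1\Big[(1+z\,\mathfrak{R}(\zeta))\,f(\zeta\,\mathfrak{R}(\zeta)\,z)-c\,z\,\mathfrak{R}(\zeta)\,f'(\zeta\,\mathfrak{R}(\zeta)\,z)\Big]e^{-\mathfrak{R}(\zeta)z}\,\mathrm{d}\zeta,\qquad z\in\mathbb{C},\ f\in\mathscr{H}_0;$$ it maps $\mathscr{H}_0$ into $\mathscr{H}_0$. The loop is a piecewise $C^1$ path lying in $\mathbb{C}\setminus[0,+\infty[$ except for its two endpoints $t=1$; powers on it are $w^a=\exp(a\log w)$ with the principal logarithm (so $\arg(-t)$ goes from $-\pi$ at the start to $+\pi$ at the end of the loop). *)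

(* Defs.v *)
From Stdlib Require Import Reals.
From Coquelicot Require Import Coquelicot.

Open Scope R_scope.
Open Scope C_scope.

Definition Cexp (z : C) : C :=
  (exp (Re z) * cos (Im z), exp (Re z) * sin (Im z))%R.

(** Principal argument, with values in ]-PI, PI] for [w <> 0]. *)
Definition Carg (w : C) : R :=
  if Rle_dec 0 (Im w) then acos (Re w / Cmod w)
  else (- acos (Re w / Cmod w))%R.

Definition Clog (w : C) : C := (ln (Cmod w), Carg w).

(** The value [0] at [w = 0] is the limit of [w^a] when [0 < Re a]; it only
    matters at endpoints of the intervals of integration below, and hence has no
    effect on the integrals. *)
Definition Cpower (w a : C) : C :=
  if Ceq_dec w 0 then 0 else Cexp (a * Clog w).

(** Riemann integral over a real interval of a complex-valued function. *)
Notation CRInt := (@RInt C_R_CompleteNormedModule).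
Notation ex_CRInt := (@ex_RInt C_R_NormedModule).

Definition entire (f : C -> C) : Prop :=
  forall z : C, @ex_derive C_AbsRing C_NormedModule f z.

(** The space of entire functions vanishing at 0. *)
Definition entire0 (f : C -> C) : Prop := entire f /\ f 0 = 0.

Definition kerR (x nu : C) (zeta : R) : C :=
  Cpower (1 - zeta) (- nu) * Cpower (1 - (1 - x) * zeta) (nu - 1).

Definition opL_integrand (x nu : C) (f : C -> C) (z : C) (zeta : R) : C :=
  let r := kerR x nu zeta in
  let c := (1 - nu * x) / (1 - x) in
  ((1 + z * r) * f (zeta * r * z) - c * z * r * C_derive f (zeta * r * z))
    * Cexp (- (r * z)).

Definition opL (x nu : C) (f : C -> C) (z : C) : C :=
  CRInt (opL_integrand x nu f z) 0 1.

(** [L] is a bijection of [D] onto itself; equality of functions is taken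
    pointwise. *)
Definition bijective_on (D : (C -> C) -> Prop)
    (L : (C -> C) -> (C -> C)) : Prop :=
  (forall f, D f -> D (L f)) /\
  (forall f g, D f -> D g ->
     (forall z, L f z = L g z) -> forall z, f z = g z) /\
  (forall k, D k -> exists f, D f /\ forall z, L f z = k z).

(** [C^1] on the closed interval: the derivative in the open interval extends
    continuously to the endpoints. *)
Definition C1_on (g : R -> C) (a b : R) : Prop :=
  exists dg : R -> C,
    continuous_on (fun s : R => (a <= s <= b)%R) dg /\
    forall s : R, (a < s < b)%R ->
      @is_derive R_AbsRing C_R_NormedModule g s (dg s).

(** Paths are parametrized by [0, 1]. *)
Definition piecewise_C1 (g : R -> C) : Prop :=
  continuous_on (fun s : R => (0 <= s <= 1)%R) g /\
  exists (n : nat) (sigma : nat -> R),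
    sigma O = 0%R /\ sigma n = 1%R /\
    forall i : nat, (i < n)%nat ->
      (sigma i < sigma (S i))%R /\ C1_on g (sigma i) (sigma (S i)).

(** Componentwise derivative of a path; its arbitrary values at the finitely
    many corners have no effect on path integrals. *)
Definition path_derive (g : R -> C) (s : R) : C :=
  (Derive (fun u => Re (g u)) s, Derive (fun u => Im (g u)) s).

Definition path_integrand (h : C -> C) (g : R -> C) (s : R) : C :=
  h (g s) * path_derive g s.

Definition path_int (h : C -> C) (g : R -> C) : C :=
  CRInt (path_integrand h g) 0 1.

(** A loop from 1 to 1, off the half-line [0, +oo[ except for its endpoints,
    with winding number +1 around the origin. *)
Definition loop_1_0plus (g : R -> C) : Prop :=
  piecewise_C1 g /\
  g 0%R = 1 /\ g 1%R = 1 /\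
  (forall s : R, (0 < s < 1)%R -> ~ (Im (g s) = 0%R /\ (0 <= Re (g s))%R)) /\
  path_int (fun t => / t) g / (2 * Ci * PI) = 1.

Definition inv_integrand (x nu : C) (K : C -> C) (z t : C) : C :=
  Cexp (- (x * t * z)) / (t * (t - 1))
    * K (x * z * Cpower (- t) nu * Cpower (1 - t) (1 - nu)).

(* Main.v *)
Require Import Defs.
From Stdlib Require Import Reals Lra Lia ClassicalEpsilon FunctionalExtensionality.
From Coquelicot Require Import Coquelicot.

(** On Taylor coefficients the operator is a lower triangular matrix [matL], and
    the loop integral (times [exp z]) is a lower triangular matrix [matM]; the
    theorem amounts to [matL] and [matM] being inverse to each other up to the
    constant in front of the integral, together with estimates that let the
    series be integrated termwise.

    With [D = 1 - (1 - x) s] and [u = x s / D], the product of the two matrices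
    is, after a binomial change of basis, a finite sum of products of Beta
    integrals of [(1 - u)^(- b nu) u^(p-1)] with loop moments of
    [(1 - t)^(p-1) (1 - 1/t)^(- k nu) / t].  Each factor satisfies a first order
    recurrence in [p], obtained by integrating an exact derivative, and these
    recurrences make the sum telescope.  The first moment is computed by sliding
    the branch point: the integral of [(1 - l/t)^e / t] does not depend on [l]
    in [0, 1], and for [l = 0] it is the winding number times [2 i pi].

    That entire functions have Taylor expansions is proved from Goursat's lemma
    for polar rectangles: circular means of
    [z (f z - f a) / (z - a)] do not depend on the radius. *)

Open Scope R_scope.
Open Scope C_scope.

(** * Limits and derivatives of complex-valued functions *)

(** Two simplifications shape the computation. On the loop (-t)^nu (1-t)^(1-nu) equals (1-t)
    (1-1/t)^(-nu); since Re(-nu) is positive, all the loop integrands that occur extend continuously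
    to the endpoints t = 1. And e^z e^(-xtz) = e^((1-xt)z), so the sum over the intermediate Taylor
    index is a binomial expansion of s (1-xt) - 1 = x s (1-t) - D; regrouped in powers of 1-t and D,
    it separates s from t and leaves single integrals only. The entries on the s side are values of
    the operator (1-b) + (s-c) d/ds on monomials, and c has exactly the value for which R^b times
    this operator applied to s^p D^m reduces, modulo an exact derivative, to one Beta integral. Only
    the product of [matL] by [matM], in this order, is computed. It makes the loop integral a
    solution, hence gives surjectivity; its diagonal shows that the diagonal of [matL] does not
    vanish, hence injectivity by forward substitution when constant terms are zero. Statement (b)
    for a given solution and an arbitrary loop then follows from uniqueness. *)

Notation locallyC := (@locally C_UniformSpace).

Ltac tc := typeclasses eauto.

(** Distances are measured with [Cmod], which is multiplicative; a general filter covers sequences,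
    paths, segments and complex neighbourhoods at once. *)
Definition Clim {T : Type} (F : (T -> Prop) -> Prop) (f : T -> C) (l : C) : Prop :=
  forall eps : R, (0 < eps)%R -> F (fun t => (Cmod (f t - l) < eps)%R).

(* Caratheodory's form of the derivative of [f] at [t0] with respect to [i]: for
   paths [i] is [RtoC], for functions of a complex variable it is the identity. *)
Definition Cdiff {T : Type} (F : (T -> Prop) -> Prop) (i : T -> C) (t0 : T)
    (f : T -> C) (l : C) : Prop :=
  exists phi : T -> C,
    F (fun t => f t = f t0 + phi t * (i t - i t0)) /\ Clim F phi l.

Lemma im_le_Cmod (c : C) : (Rabs (Im c) <= Cmod c)%R.
Proof.
  eapply Rle_trans; [apply Rmax_r | apply Rmax_Cmod].
Qed.

Lemma Cmod_le_re_im (c : C) : (Cmod c <= Rabs (Re c) + Rabs (Im c))%R.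
Proof.
  replace c with (RtoC (Re c) + Ci * RtoC (Im c)) at 1.
  - eapply Rle_trans; [apply Cmod_triangle|].
    rewrite Cmod_mult, Cmod_Ci, !Cmod_R. lra.
  - destruct c as [u v]. unfold RtoC, Ci, Cplus, Cmult. simpl. f_equal; ring.
Qed.

Lemma Cmod_triangle' (a b : C) : (Cmod a - Cmod b <= Cmod (a - b))%R.
Proof.
  replace a with ((a - b) + b) at 1 by ring.
  generalize (Cmod_triangle (a - b) b). lra.
Qed.

Lemma Cmod_minus_sym (a b : C) : Cmod (a - b) = Cmod (b - a).
Proof. replace (a - b) with (- (b - a)) by ring. apply Cmod_opp. Qed.

Section ClimRules.
Context {T : Type} (F : (T -> Prop) -> Prop) {FF : Filter F}.

Lemma Clim_const (c : C) : Clim F (fun _ => c) c.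
Proof.
  intros eps Heps. apply filter_forall. intros t.
  replace (c - c) with (RtoC 0) by ring. now rewrite Cmod_0.
Qed.

Lemma Clim_plus f g a b :
  Clim F f a -> Clim F g b -> Clim F (fun t => f t + g t) (a + b).
Proof.
  intros Hf Hg eps Heps.
  assert (H2 : (0 < eps / 2)%R) by lra.
  generalize (filter_and _ _ (Hf _ H2) (Hg _ H2)).
  apply filter_imp. intros t [H1 H3].
  replace (f t + g t - (a + b)) with ((f t - a) + (g t - b)) by ring.
  eapply Rle_lt_trans; [apply Cmod_triangle|]. lra.
Qed.

Lemma Clim_bounded f a :
  Clim F f a -> F (fun t => (Cmod (f t) < Cmod a + 1)%R).
Proof.
  intros Hf. generalize (Hf 1%R Rlt_0_1). apply filter_imp. intros t Ht.
  generalize (Cmod_triangle' (f t) a). lra.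
Qed.

Lemma Clim_mult f g a b :
  Clim F f a -> Clim F g b -> Clim F (fun t => f t * g t) (a * b).
Proof.
  intros Hf Hg eps Heps.
  set (A := (Cmod a + 1)%R). set (B := (Cmod b + 1)%R).
  assert (HA : (0 < A)%R) by (unfold A; generalize (Cmod_ge_0 a); lra).
  assert (HB : (0 < B)%R) by (unfold B; generalize (Cmod_ge_0 b); lra).
  assert (H1 : (0 < eps / (2 * A))%R) by (apply Rdiv_lt_0_compat; lra).
  assert (H2 : (0 < eps / (2 * B))%R) by (apply Rdiv_lt_0_compat; lra).
  generalize (filter_and _ _ (Clim_bounded f a Hf)
                (filter_and _ _ (Hf _ H2) (Hg _ H1))).
  apply filter_imp. intros t (Hb & H3 & H4). fold A in Hb.
  replace (f t * g t - a * b) with (f t * (g t - b) + (f t - a) * b) by ring.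
  eapply Rle_lt_trans; [apply Cmod_triangle|]. rewrite !Cmod_mult.
  assert (E1 : (Cmod (f t) * Cmod (g t - b) <= A * (eps / (2 * A)))%R).
  { apply Rmult_le_compat; try apply Cmod_ge_0; lra. }
  assert (E2 : (Cmod (f t - a) * Cmod b < eps / (2 * B) * B)%R).
  { apply Rle_lt_trans with (eps / (2 * B) * Cmod b)%R.
    - apply Rmult_le_compat_r; [apply Cmod_ge_0 | lra].
    - apply Rmult_lt_compat_l; [exact H2 | unfold B; lra]. }
  replace (A * (eps / (2 * A)))%R with (eps / 2)%R in E1 by (field; lra).
  replace (eps / (2 * B) * B)%R with (eps / 2)%R in E2 by (field; lra).
  lra.
Qed.

Lemma Clim_ext_loc f g a : F (fun t => f t = g t) -> Clim F f a -> Clim F g a.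
Proof.
  intros He Hf eps Heps. generalize (filter_and _ _ He (Hf eps Heps)).
  apply filter_imp. intros t [E H]. now rewrite <- E.
Qed.

Lemma Clim_ext f g a : (forall t, f t = g t) -> Clim F f a -> Clim F g a.
Proof.
  intros He. apply Clim_ext_loc. now apply filter_forall.
Qed.

Lemma Clim_eq f a b : a = b -> Clim F f a -> Clim F f b.
Proof. now intros ->. Qed.

Lemma Clim_scal c f a : Clim F f a -> Clim F (fun t => c * f t) (c * a).
Proof. intros Hf. apply Clim_mult; [apply Clim_const | exact Hf]. Qed.

Lemma Clim_opp f a : Clim F f a -> Clim F (fun t => - f t) (- a).
Proof.
  intros Hf. apply Clim_ext with (fun t => (- (1)) * f t); [intros; ring|].
  replace (- a) with (- (1) * a) by ring. now apply Clim_scal.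
Qed.

Lemma Clim_minus f g a b :
  Clim F f a -> Clim F g b -> Clim F (fun t => f t - g t) (a - b).
Proof. intros. apply Clim_plus; [assumption | now apply Clim_opp]. Qed.

Lemma Clim_inv (f : T -> C) (a : C) : a <> 0 -> Clim F f a -> Clim F (fun t => / f t) (/ a).
Proof.
  intros Ha Hf eps Heps.
  assert (Hp : (0 < Cmod a)%R) by (apply Cmod_gt_0; assumption).
  assert (H1 : (0 < Cmod a / 2)%R) by lra.
  assert (H2 : (0 < eps * (Cmod a * (Cmod a / 2)))%R)
    by (repeat apply Rmult_lt_0_compat; lra).
  generalize (filter_and _ _ (Hf _ H1) (Hf _ H2)).
  apply filter_imp. intros t [H3 H4].
  assert (H5 : (Cmod a / 2 < Cmod (f t))%R).
  { generalize (Cmod_triangle' a (f t)). rewrite Cmod_minus_sym. lra. }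
  assert (Hn : f t <> 0).
  { intros E. rewrite E, Cmod_0 in H5. lra. }
  replace (/ f t - / a) with ((a - f t) * (/ f t * / a)) by (field; auto).
  rewrite !Cmod_mult, !Cmod_inv by auto. rewrite Cmod_minus_sym.
  apply Rlt_le_trans with
    (eps * (Cmod a * (Cmod a / 2)) * (/ Cmod (f t) * / Cmod a))%R.
  - apply Rmult_lt_compat_r; [|exact H4].
    apply Rmult_lt_0_compat; apply Rinv_0_lt_compat; lra.
  - replace (eps * (Cmod a * (Cmod a / 2)) * (/ Cmod (f t) * / Cmod a))%R
      with (eps * ((Cmod a / 2) / Cmod (f t)))%R by (field; lra).
    rewrite <- (Rmult_1_r eps) at 2. apply Rmult_le_compat_l; [lra|].
    apply Rle_div_l; lra.
Qed.

Lemma Clim_pow f a n : Clim F f a -> Clim F (fun t => f t ^ n) (a ^ n).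
Proof.
  intros Hf. induction n as [|n IH]; simpl.
  - apply Clim_const.
  - now apply Clim_mult.
Qed.

Lemma Clim_Cmod f a :
  Clim F f a -> forall eps, (0 < eps)%R -> F (fun t => (Rabs (Cmod (f t) - Cmod a) < eps)%R).
Proof.
  intros Hf eps Heps. generalize (Hf eps Heps). apply filter_imp.
  intros t Ht. apply Rle_lt_trans with (2 := Ht).
  apply Rabs_le. split.
  - generalize (Cmod_triangle' a (f t)). rewrite (Cmod_minus_sym a). lra.
  - apply Cmod_triangle'.
Qed.

Lemma Clim_unique {PF : ProperFilter F} f a b :
  Clim F f a -> Clim F f b -> a = b.
Proof.
  intros Ha Hb. apply Ceq_minus. apply Cmod_eq_0.
  destruct (Req_dec (Cmod (a - b)) 0) as [E|N]; [exact E|exfalso].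
  assert (H : (0 < Cmod (a - b) / 2)%R) by (generalize (Cmod_ge_0 (a - b)); lra).
  destruct (filter_ex _ (filter_and _ _ (Ha _ H) (Hb _ H))) as [t [H1 H2]].
  rewrite Cmod_minus_sym in H1.
  generalize (Cmod_triangle (a - f t) (f t - b)).
  replace (a - f t + (f t - b)) with (a - b) by ring. lra.
Qed.

(** The slope is the difference quotient, completed by [l] where [i t = i t0]; the injectivity
    assumption makes [t0] the only such point. *)
Lemma Cdiff_intro (i : T -> C) (t0 : T) (f : T -> C) (l : C) :
  (forall t, i t = i t0 -> t = t0) ->
  (forall eps, (0 < eps)%R ->
    F (fun t => (Cmod (f t - f t0 - l * (i t - i t0)) <= eps * Cmod (i t - i t0))%R)) ->
  Cdiff F i t0 f l.
Proof.
  intros Hi H.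
  exists (fun t => if Ceq_dec (i t) (i t0) then l else (f t - f t0) / (i t - i t0)).
  split.
  - apply filter_forall. intros t. destruct (Ceq_dec (i t) (i t0)) as [E|N].
    + rewrite (Hi t E). ring.
    + field. now apply Cminus_eq_contra.
  - intros eps Heps. assert (He : (0 < eps / 2)%R) by lra.
    generalize (H _ He). apply filter_imp. intros t Ht.
    destruct (Ceq_dec (i t) (i t0)) as [E|N].
    { replace (l - l) with (RtoC 0) by ring. rewrite Cmod_0. exact Heps. }
    assert (N' : i t - i t0 <> 0) by now apply Cminus_eq_contra.
    replace ((f t - f t0) / (i t - i t0) - l)
      with ((f t - f t0 - l * (i t - i t0)) / (i t - i t0)) by (field; exact N').
    rewrite Cmod_div by exact N'.
    assert (Hpos : (0 < Cmod (i t - i t0))%R) by (now apply Cmod_gt_0).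
    apply Rle_lt_trans with (eps / 2)%R; [|lra].
    apply Rle_div_l; [exact Hpos | exact Ht].
Qed.

Lemma Cdiff_const i t0 c : Cdiff F i t0 (fun _ => c) 0.
Proof.
  exists (fun _ => 0). split; [|apply Clim_const].
  apply filter_forall. intros; ring.
Qed.

Lemma Cdiff_id i t0 : Cdiff F i t0 i 1.
Proof.
  exists (fun _ => 1). split; [|apply Clim_const].
  apply filter_forall. intros; ring.
Qed.

Lemma Cdiff_plus i t0 f g a b :
  Cdiff F i t0 f a -> Cdiff F i t0 g b -> Cdiff F i t0 (fun t => f t + g t) (a + b).
Proof.
  intros (p & Hp & Lp) (q & Hq & Lq). exists (fun t => p t + q t). split.
  - generalize (filter_and _ _ Hp Hq). apply filter_imp.
    intros t [E1 E2]. rewrite E1, E2. ring.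
  - now apply Clim_plus.
Qed.

Lemma Cdiff_continuous i t0 f a :
  Clim F i (i t0) -> Cdiff F i t0 f a -> Clim F f (f t0).
Proof.
  intros Hi (p & Hp & Lp).
  apply Clim_ext_loc with (fun t => f t0 + p t * (i t - i t0)).
  { generalize Hp. apply filter_imp. intros t Ht. now symmetry. }
  apply Clim_eq with (f t0 + a * (i t0 - i t0)); [ring|].
  apply Clim_plus; [apply Clim_const|]. apply Clim_mult; [exact Lp|].
  apply Clim_minus; [exact Hi | apply Clim_const].
Qed.

Lemma Cdiff_mult i t0 f g a b :
  Clim F i (i t0) -> Cdiff F i t0 f a -> Cdiff F i t0 g b ->
  Cdiff F i t0 (fun t => f t * g t) (a * g t0 + f t0 * b).
Proof.
  intros Hi Hf Hg. generalize (Cdiff_continuous _ _ _ _ Hi Hg). intros Cg.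
  destruct Hf as (p & Hp & Lp). destruct Hg as (q & Hq & Lq).
  exists (fun t => p t * g t + f t0 * q t). split.
  - generalize (filter_and _ _ Hp Hq). apply filter_imp.
    intros t [E1 E2]. rewrite E1, E2. ring.
  - apply Clim_plus; apply Clim_mult; auto using Clim_const.
Qed.

Lemma Cdiff_ext_loc i t0 f g a :
  f t0 = g t0 -> F (fun t => f t = g t) -> Cdiff F i t0 f a -> Cdiff F i t0 g a.
Proof.
  intros E0 E (p & Hp & Lp). exists p. split; [|exact Lp].
  generalize (filter_and _ _ E Hp). apply filter_imp. intros t [<- H].
  now rewrite <- E0.
Qed.

Lemma Cdiff_ext i t0 f g a :
  (forall t, f t = g t) -> Cdiff F i t0 f a -> Cdiff F i t0 g a.
Proof.
  intros E. apply Cdiff_ext_loc; [apply E | now apply filter_forall].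
Qed.

Lemma Cdiff_eq i t0 f a b : a = b -> Cdiff F i t0 f a -> Cdiff F i t0 f b.
Proof. now intros ->. Qed.

Lemma Cdiff_inv i t0 (f : T -> C) (a : C) :
  Clim F i (i t0) -> f t0 <> 0 -> Cdiff F i t0 f a ->
  Cdiff F i t0 (fun t => / f t) (- a / (f t0 * f t0)).
Proof.
  intros Hi Hn Hf. generalize (Cdiff_continuous _ _ _ _ Hi Hf). intros Cf.
  destruct Hf as (p & Hp & Lp).
  exists (fun t => - p t * / (f t * f t0)). split.
  - assert (H1 : (0 < Cmod (f t0))%R) by (apply Cmod_gt_0; assumption).
    generalize (filter_and _ _ Hp (Cf _ H1)). apply filter_imp.
    intros t [E H2].
    assert (Hn' : f t <> 0).
    { intros E'. rewrite E' in H2. replace (0 - f t0) with (- f t0) in H2 by ring.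
      rewrite Cmod_opp in H2. lra. }
    replace (- p t * / (f t * f t0) * (i t - i t0))
      with (- (p t * (i t - i t0)) * / (f t * f t0)) by ring.
    replace (p t * (i t - i t0)) with (f t - f t0) by (rewrite E; ring).
    field. split; assumption.
  - apply Clim_mult; [now apply Clim_opp|]. apply Clim_inv.
    + apply Cmult_neq_0; apply Hn.
    + apply Clim_mult; [exact Cf | apply Clim_const].
Qed.

Lemma Cdiff_scal i t0 c f a :
  Cdiff F i t0 f a -> Cdiff F i t0 (fun t => c * f t) (c * a).
Proof.
  intros (p & Hp & Lp). exists (fun t => c * p t). split.
  - generalize Hp. apply filter_imp. intros t ->. ring.
  - now apply Clim_scal.
Qed.

Lemma Cdiff_opp i t0 f a :
  Cdiff F i t0 f a -> Cdiff F i t0 (fun t => - f t) (- a).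
Proof.
  intros Hf. apply Cdiff_ext with (fun t => (- (1)) * f t); [intros; ring|].
  replace (- a) with (- (1) * a) by ring. now apply Cdiff_scal.
Qed.

Lemma Cdiff_minus i t0 f g a b :
  Cdiff F i t0 f a -> Cdiff F i t0 g b -> Cdiff F i t0 (fun t => f t - g t) (a - b).
Proof. intros. apply Cdiff_plus; [assumption | now apply Cdiff_opp]. Qed.

Lemma Cdiff_pow i t0 f a n :
  Clim F i (i t0) -> Cdiff F i t0 f a ->
  Cdiff F i t0 (fun t => f t ^ n) (INR n * f t0 ^ pred n * a).
Proof.
  intros Hi Hf. induction n as [|n IH].
  - simpl. eapply Cdiff_eq; [|apply Cdiff_const]. ring.
  - apply Cdiff_ext with (fun t => f t * f t ^ n); [intros; now rewrite Cpow_S|].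
    eapply Cdiff_eq; [|apply Cdiff_mult; [exact Hi|exact Hf|exact IH]].
    rewrite S_INR, RtoC_plus. simpl pred. destruct n as [|n].
    + simpl. ring.
    + simpl pred. rewrite (Cpow_S (f t0) n). ring.
Qed.

(** With slope functions no division by [g t - g t0] occurs, so points where [g] returns to its
    value at [t0] need no separate case. *)
Lemma Cdiff_comp i t0 (g : T -> C) a (h : C -> C) b :
  Clim F i (i t0) -> Cdiff F i t0 g a ->
  Cdiff (locallyC (g t0)) (fun z => z) (g t0) h b ->
  Cdiff F i t0 (fun t => h (g t)) (b * a).
Proof.
  intros Hi Hg (q & Hq & Lq). generalize (Cdiff_continuous _ _ _ _ Hi Hg). intros Cg.
  destruct Hg as (p & Hp & Lp).
  exists (fun t => q (g t) * p t). split.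
  - destruct Hq as [d Hd].
    generalize (filter_and _ _ Hp (Cg d (cond_pos d))). apply filter_imp.
    intros t [E H]. rewrite (Hd (g t)) by now apply C_NormedModule_mixin_compat1.
    rewrite E at 2. ring.
  - apply Clim_mult; [|exact Lp]. intros eps Heps.
    destruct (Lq eps Heps) as [d Hd].
    generalize (Cg d (cond_pos d)). apply filter_imp. intros t Ht. apply Hd.
    apply C_NormedModule_mixin_compat1. exact Ht.
Qed.

End ClimRules.

Notation Rdiff f s l := (Cdiff (locally s) RtoC s f l).
Notation Zdiff f z l := (Cdiff (locallyC z) (fun w : C => w) z f l).

Ltac creim := unfold Re, Im, Cminus, Cplus, Copp, Cmult, RtoC; simpl; ring.

Lemma Clim_RtoC (s : R) : Clim (locally s) RtoC (RtoC s).
Proof.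
  intros eps Heps. exists (mkposreal eps Heps). intros u Hu.
  rewrite <- RtoC_minus, Cmod_R. exact Hu.
Qed.

(** The factor sqrt 2 compares the uniform structure of C, that of a product, with the modulus. *)
Lemma locally_Cmod (z : C) (r : R) :
  (0 < r)%R -> locallyC z (fun w => (Cmod (w - z) < r)%R).
Proof.
  intros Hr. assert (H : (0 < r / sqrt 2)%R).
  { apply Rdiv_lt_0_compat; [exact Hr | apply Rlt_sqrt2_0]. }
  exists (mkposreal _ H). intros w Hw.
  eapply Rlt_le_trans.
  - apply C_NormedModule_mixin_compat2. exact Hw.
  - simpl. right. field. apply sqrt2_neq_0.
Qed.

Lemma locally_Cmod_iff (z : C) (P : C -> Prop) :
  locallyC z P <->
  exists d : R, (0 < d)%R /\ forall w, (Cmod (w - z) < d)%R -> P w.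
Proof.
  split.
  - intros [d Hd]. exists d. split; [apply cond_pos|]. intros w Hw. apply Hd.
    now apply C_NormedModule_mixin_compat1.
  - intros (d & Hd & H). generalize (locally_Cmod z d Hd). now apply filter_imp.
Qed.

Lemma Clim_idC (z : C) : Clim (locallyC z) (fun w => w) z.
Proof. intros eps Heps. now apply locally_Cmod. Qed.

Lemma Zdiff_continuous (f : C -> C) (z l : C) :
  Zdiff f z l -> Clim (locallyC z) f (f z).
Proof. apply (Cdiff_continuous _ (fun v : C => v) z f l (Clim_idC z)). Qed.

Lemma Clim_filterlim {T} (F : (T -> Prop) -> Prop) {FF : Filter F} (f : T -> C) (l : C) :
  Clim F f l <-> filterlim f F (locallyC l).
Proof.
  split.
  - intros H P HP. apply locally_Cmod_iff in HP. destruct HP as (d & Hd & HP).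
    unfold filtermap. generalize (H d Hd). apply filter_imp. intros t. apply HP.
  - intros H eps Heps. apply (H (fun w => (Cmod (w - l) < eps)%R)).
    now apply locally_Cmod.
Qed.

Lemma C_R_norm_le (w : C) (r : R) :
  (norm (V := C_R_NormedModule) w <= r <-> Cmod w <= r)%R.
Proof. now rewrite Cmod_norm. Qed.

Lemma Rdiff_is_derive (f : R -> C) (s : R) (l : C) :
  Rdiff f s l <-> @is_derive R_AbsRing C_R_NormedModule f s l.
Proof.
  split.
  - intros (p & Hp & Lp). split; [apply is_linear_scal_l|].
    intros x Hx. apply (is_filter_lim_locally_unique (V := AbsRing_NormedModule R_AbsRing)) in Hx. subst x.
    intros eps. generalize (filter_and _ _ Hp (Lp eps (cond_pos eps))).
    apply filter_imp. intros t [E H].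
    apply (C_R_norm_le (f t - f s - scal (V := C_R_NormedModule) (t - s)%R l) (eps * Rabs (t - s))).
    rewrite scal_R_Cmult, E, RtoC_minus.
    replace (f s + p t * (t - s) - f s - (t - s) * l) with ((p t - l) * (t - s)) by ring.
    rewrite Cmod_mult, <- RtoC_minus, Cmod_R.
    apply Rmult_le_compat_r; [apply Rabs_pos | lra].
  - intros [_ H]. specialize (H s (fun P HP => HP)).
    apply Cdiff_intro; [tc | intros t; apply RtoC_inj|].
    intros eps Heps. generalize (H (mkposreal _ Heps)). apply filter_imp. intros t Ht.
    apply (C_R_norm_le (f t - f s - scal (V := C_R_NormedModule) (t - s)%R l)
      (eps * Rabs (t - s))) in Ht.
    rewrite scal_R_Cmult in Ht.
    rewrite <- RtoC_minus, Cmod_R, (Cmult_comm l). exact Ht.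
Qed.

(** C carries two uniform structures, one from its absolute value and one from the product;
    [locally_C] passes between their neighbourhoods. *)
Lemma Zdiff_is_derive (f : C -> C) (z l : C) :
  Zdiff f z l <-> @is_derive C_AbsRing C_NormedModule f z l.
Proof.
  split.
  - intros (p & Hp & Lp). split; [apply is_linear_scal_l|].
    intros x Hx. apply (is_filter_lim_locally_unique (V := AbsRing_NormedModule C_AbsRing)) in Hx. subst x.
    intros eps. apply -> locally_C.
    generalize (filter_and _ _ Hp (Lp eps (cond_pos eps))).
    apply filter_imp. intros t [E H].
    change (Cmod (f t - f z - (t - z) * l) <= eps * Cmod (t - z))%R.
    rewrite E.
    replace (f z + p t * (t - z) - f z - (t - z) * l) with ((p t - l) * (t - z)) by ring.
    rewrite Cmod_mult. apply Rmult_le_compat_r; [apply Cmod_ge_0 | lra].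
  - intros [_ H]. specialize (H z (fun P HP => HP)).
    apply Cdiff_intro; [tc | auto|].
    intros eps Heps. generalize (H (mkposreal _ Heps)). intros H'.
    apply (locally_C z) in H'. revert H'. apply filter_imp. intros t Ht.
    change (Cmod (f t - f z - (t - z) * l) <= eps * Cmod (t - z))%R in Ht.
    rewrite (Cmult_comm l). exact Ht.
Qed.

Lemma Rdiff_re (f : R -> C) (s : R) (l : C) :
  Rdiff f s l -> is_derive (fun t => Re (f t)) s (Re l).
Proof.
  intros (p & Hp & Lp). split; [apply is_linear_scal_l|].
  intros x Hx. apply (is_filter_lim_locally_unique (V := AbsRing_NormedModule R_AbsRing)) in Hx. subst x.
  intros eps. generalize (filter_and _ _ Hp (Lp eps (cond_pos eps))).
  apply filter_imp. intros t [E H].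
  change (Rabs (Re (f t) - Re (f s) - (t - s) * Re l) <= eps * Rabs (t - s))%R.
  rewrite E. replace (Re (f s + p t * (t - s)) - Re (f s) - (t - s) * Re l)%R
    with (Re (p t - l) * (t - s))%R.
  - rewrite Rabs_mult. apply Rmult_le_compat_r; [apply Rabs_pos|].
    eapply Rle_trans; [apply re_le_Cmod | lra].
  - creim.
Qed.

Lemma Rdiff_im (f : R -> C) (s : R) (l : C) :
  Rdiff f s l -> is_derive (fun t => Im (f t)) s (Im l).
Proof.
  intros (p & Hp & Lp). split; [apply is_linear_scal_l|].
  intros x Hx. apply (is_filter_lim_locally_unique (V := AbsRing_NormedModule R_AbsRing)) in Hx. subst x.
  intros eps. generalize (filter_and _ _ Hp (Lp eps (cond_pos eps))).
  apply filter_imp. intros t [E H].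
  change (Rabs (Im (f t) - Im (f s) - (t - s) * Im l) <= eps * Rabs (t - s))%R.
  rewrite E. replace (Im (f s + p t * (t - s)) - Im (f s) - (t - s) * Im l)%R
    with (Im (p t - l) * (t - s))%R.
  - rewrite Rabs_mult. apply Rmult_le_compat_r; [apply Rabs_pos|].
    eapply Rle_trans; [apply im_le_Cmod | lra].
  - creim.
Qed.

Lemma Rdiff_pair (f : R -> C) (s : R) (l : C) :
  is_derive (fun t => Re (f t)) s (Re l) -> is_derive (fun t => Im (f t)) s (Im l) ->
  Rdiff f s l.
Proof.
  intros [_ Hr] [_ Hi]. apply Rdiff_is_derive. split; [apply is_linear_scal_l|].
  intros x Hx. apply (is_filter_lim_locally_unique (V := AbsRing_NormedModule R_AbsRing)) in Hx. subst x.
  specialize (Hr s (fun P HP => HP)). specialize (Hi s (fun P HP => HP)).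
  intros eps. assert (He : (0 < eps / 2)%R) by (generalize (cond_pos eps); lra).
  generalize (filter_and _ _ (Hr (mkposreal _ He)) (Hi (mkposreal _ He))).
  apply filter_imp. intros t [H1 H2].
  change (Rabs (Re (f t) - Re (f s) - (t - s) * Re l) <= eps / 2 * Rabs (t - s))%R in H1.
  change (Rabs (Im (f t) - Im (f s) - (t - s) * Im l) <= eps / 2 * Rabs (t - s))%R in H2.
  apply (C_R_norm_le (f t - f s - scal (V := C_R_NormedModule) (t - s)%R l) (eps * Rabs (t - s))).
  rewrite scal_R_Cmult.
  eapply Rle_trans; [apply Cmod_le_re_im|].
  replace (Re (f t - f s - RtoC (t - s) * l)) with (Re (f t) - Re (f s) - (t - s) * Re l)%R
    by creim.
  replace (Im (f t - f s - RtoC (t - s) * l)) with (Im (f t) - Im (f s) - (t - s) * Im l)%R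
    by creim.
  lra.
Qed.

Lemma Rdiff_unique (f : R -> C) (s : R) (a b : C) : Rdiff f s a -> Rdiff f s b -> a = b.
Proof.
  intros Ha Hb.
  assert (E1 := is_derive_unique _ _ _ (Rdiff_re _ _ _ Ha)).
  assert (E2 := is_derive_unique _ _ _ (Rdiff_im _ _ _ Ha)).
  rewrite (is_derive_unique _ _ _ (Rdiff_re _ _ _ Hb)) in E1.
  rewrite (is_derive_unique _ _ _ (Rdiff_im _ _ _ Hb)) in E2.
  destruct a, b. simpl in *. now subst.
Qed.

(** * Continuity on a segment, mean value inequality, fundamental theorem of calculus *)

Definition clamp (a b s : R) : R := Rmax a (Rmin s b).

Lemma clamp_in a b s : (a <= b)%R -> (a <= clamp a b s <= b)%R.
Proof.
  intros H. unfold clamp. split; [apply Rmax_l|].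
  apply Rmax_lub; [exact H | apply Rmin_r].
Qed.

Lemma clamp_id a b s : (a <= s <= b)%R -> clamp a b s = s.
Proof.
  intros [H1 H2]. unfold clamp. rewrite Rmin_left by exact H2. now apply Rmax_right.
Qed.

Lemma clamp_lip a b s t : (Rabs (clamp a b s - clamp a b t) <= Rabs (s - t))%R.
Proof.
  unfold clamp, Rmax, Rmin.
  repeat destruct Rle_dec; unfold Rabs; repeat destruct Rcase_abs; lra.
Qed.

Definition Ccont_on (a b : R) (f : R -> C) : Prop :=
  forall s, (a <= s <= b)%R ->
    Clim (within (fun u : R => (a <= u <= b)%R) (locally s)) f (f s).

(** Precomposition with [clamp] extends a function from the segment to the line without losing
    continuity, so that results stated for two-sided continuity apply at the endpoints too. *)
Lemma Ccont_on_clamp a b f : (a <= b)%R -> Ccont_on a b f ->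
  forall s, Clim (locally s) (fun u => f (clamp a b u)) (f (clamp a b s)).
Proof.
  intros Hab Hf s eps Heps.
  destruct (Hf _ (clamp_in a b s Hab) eps Heps) as [d Hd].
  exists d. intros u Hu. apply Hd; [|now apply clamp_in].
  eapply Rle_lt_trans; [apply clamp_lip | exact Hu].
Qed.

Lemma Ccont_on_iff a b f :
  continuous_on (U := C_UniformSpace) (fun s : R => (a <= s <= b)%R) f <-> Ccont_on a b f.
Proof.
  split; intros H s Hs; apply Clim_filterlim; try apply H; auto; tc.
Qed.

Lemma Ccont_on_sub a b a' b' f :
  (a <= a')%R -> (b' <= b)%R -> Ccont_on a b f -> Ccont_on a' b' f.
Proof.
  intros Ha Hb Hf s Hs eps Heps.
  destruct (Hf s ltac:(lra) eps Heps) as [d Hd]. exists d.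
  intros u Hu Hu'. apply Hd; [exact Hu | lra].
Qed.

Lemma Ccont_on_locally a b f :
  (forall s, (a <= s <= b)%R -> Clim (locally s) f (f s)) -> Ccont_on a b f.
Proof.
  intros H s Hs eps Heps. destruct (H s Hs eps Heps) as [d Hd].
  exists d. intros u Hu _. now apply Hd.
Qed.

Lemma Clim_continuous (f : R -> C) (s : R) :
  Clim (locally s) f (f s) <-> continuous (U := C_UniformSpace) f s.
Proof. apply Clim_filterlim. tc. Qed.

Lemma Ccont_on_ex_RInt a b f : (a <= b)%R -> Ccont_on a b f -> ex_CRInt f a b.
Proof.
  intros Hab Hf.
  apply (ex_RInt_ext (V := C_R_NormedModule)) with (fun s => f (clamp a b s)).
  { rewrite Rmin_left, Rmax_right by exact Hab. intros s Hs.
    rewrite clamp_id by lra. reflexivity. }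
  apply (ex_RInt_continuous (V := C_R_CompleteNormedModule)).
  intros s _. apply (Clim_continuous (fun u => f (clamp a b u))).
  now apply Ccont_on_clamp.
Qed.

Lemma Ccont_on_bounded a b f : (a <= b)%R -> Ccont_on a b f ->
  exists M : R, (0 < M)%R /\ forall s, (a <= s <= b)%R -> (Cmod (f s) <= M)%R.
Proof.
  intros Hab Hf.
  destruct (continuity_ab_maj (fun s => Cmod (f (clamp a b s))) a b Hab) as (m & Hm & _).
  - intros s _. intros eps Heps.
    destruct (Clim_Cmod (locally s) _ _ (Ccont_on_clamp a b f Hab Hf s) eps Heps) as [d Hd].
    exists d. split; [apply cond_pos|]. intros u [_ Hu]. apply Hd. exact Hu.
  - exists (Cmod (f (clamp a b m)) + 1)%R. split.
    + generalize (Cmod_ge_0 (f (clamp a b m))). lra.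
    + intros s Hs. generalize (Hm s Hs). rewrite (clamp_id a b s) by exact Hs. lra.
Qed.

(** The real mean value theorem is applied to the component of [f] along [f b - f a], scaled so that
    its increment is the square of the modulus of [f b - f a]. *)
Lemma Rdiff_lipschitz a b f df M : (a <= b)%R -> Ccont_on a b f ->
  (forall s, (a < s < b)%R -> Rdiff f s (df s)) ->
  (forall s, (a < s < b)%R -> (Cmod (df s) <= M)%R) ->
  (Cmod (f b - f a) <= M * (b - a))%R.
Proof.
  intros Hab Hf Hd HM. destruct (Req_dec a b) as [<-|Nab].
  { replace (f a - f a) with (RtoC 0) by ring. rewrite Cmod_0. lra. }
  assert (HM0 : (0 <= M)%R).
  { eapply Rle_trans; [apply Cmod_ge_0 | apply (HM ((a + b) / 2)%R); lra]. }
  set (u := Cconj (f b - f a)).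
  set (g := fun s => u * f (clamp a b s)).
  (* The intermediate point may be an endpoint, where [df] is not known to be the derivative; the
     value 0 put there obeys the bound as well, since [M] is nonnegative. *)
  destruct (MVT_gen (fun s => Re (g s)) a b
    (fun s => if Rlt_dec a s then if Rlt_dec s b then Re (u * df s) else 0%R else 0%R))
    as (c & Hc & E).
  - rewrite Rmin_left, Rmax_right by exact Hab. intros s Hs.
    destruct Rlt_dec; [|lra]. destruct Rlt_dec; [|lra].
    apply (Rdiff_re g s). unfold g. apply Cdiff_scal; [tc|].
    apply Cdiff_ext_loc with f; [tc| | |now apply Hd].
    + rewrite clamp_id by lra. reflexivity.
    + assert (H1 : (0 < Rmin (s - a) (b - s))%R) by (apply Rmin_glb_lt; lra).
      exists (mkposreal _ H1). intros t Ht.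
      change (Rabs (t - s) < Rmin (s - a) (b - s))%R in Ht.
      rewrite clamp_id; [reflexivity|].
      generalize (Rmin_l (s - a) (b - s)) (Rmin_r (s - a) (b - s)).
      apply Rabs_def2 in Ht. lra.
  - intros s _ eps Heps.
    assert (H1 : Clim (locally s) g (g s)).
    { unfold g. apply Clim_scal; [tc|]. now apply Ccont_on_clamp. }
    destruct (H1 eps Heps) as [d H2]. exists d. split; [apply cond_pos|].
    intros t [_ Ht]. eapply Rle_lt_trans; [|apply (H2 t Ht)].
    eapply Rle_trans; [|apply re_le_Cmod]. right. reflexivity.
  - unfold g in E. rewrite (clamp_id a b b), (clamp_id a b a) in E by lra.
    assert (E1 : (Re (u * f b) - Re (u * f a) = Cmod (f b - f a) * Cmod (f b - f a))%R).
    { transitivity (Re ((f b - f a) * u)).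
      - creim.
      - unfold u. rewrite <- Cmod2_conj, re_RtoC. ring. }
    rewrite E1 in E.
    destruct (Req_dec (Cmod (f b - f a)) 0) as [Z|NZ].
    { rewrite Z. apply Rmult_le_pos; lra. }
    assert (P : (0 < Cmod (f b - f a))%R) by (generalize (Cmod_ge_0 (f b - f a)); lra).
    apply Rmult_le_reg_l with (1 := P). rewrite E, <- Rmult_assoc.
    apply Rmult_le_compat_r; [lra|].
    assert (P' : (0 <= Cmod (f b - f a) * M)%R) by (apply Rmult_le_pos; lra).
    destruct Rlt_dec as [H1|_]; [|exact P'].
    destruct Rlt_dec as [H2|_]; [|exact P'].
    eapply Rle_trans; [apply Rle_abs|]. eapply Rle_trans; [apply re_le_Cmod|].
    rewrite Cmod_mult. unfold u. rewrite Cmod_conj.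
    apply Rmult_le_compat_l; [lra | now apply HM].
Qed.

Lemma Ccont_on_plus a b f g :
  Ccont_on a b f -> Ccont_on a b g -> Ccont_on a b (fun s => f s + g s).
Proof. intros Hf Hg s Hs. apply Clim_plus; auto. tc. Qed.

Lemma Ccont_on_minus a b f g :
  Ccont_on a b f -> Ccont_on a b g -> Ccont_on a b (fun s => f s - g s).
Proof. intros Hf Hg s Hs. apply Clim_minus; auto; tc. Qed.

Lemma Ccont_on_mult a b f g :
  Ccont_on a b f -> Ccont_on a b g -> Ccont_on a b (fun s => f s * g s).
Proof. intros Hf Hg s Hs. apply Clim_mult; auto. tc. Qed.

Lemma Ccont_on_const a b c : Ccont_on a b (fun _ => c).
Proof. intros s Hs. apply Clim_const. tc. Qed.

Lemma Ccont_on_pow a b f n : Ccont_on a b f -> Ccont_on a b (fun s => f s ^ n).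
Proof. intros Hf s Hs. apply Clim_pow; auto. tc. Qed.

Lemma Ccont_on_inv a b f : (forall s, (a <= s <= b)%R -> f s <> RtoC 0) ->
  Ccont_on a b f -> Ccont_on a b (fun s => / f s).
Proof. intros Hn Hf s Hs. apply Clim_inv; auto. tc. Qed.

Lemma Ccont_on_RtoC a b : Ccont_on a b RtoC.
Proof. apply Ccont_on_locally. intros. apply Clim_RtoC. Qed.

Lemma Ccont_on_ext a b f g : (forall s, (a <= s <= b)%R -> f s = g s) ->
  Ccont_on a b f -> Ccont_on a b g.
Proof.
  intros E Hf s Hs eps Heps. destruct (Hf s Hs eps Heps) as [d Hd].
  exists d. intros u Hu Hu'. rewrite <- !E by assumption. now apply Hd.
Qed.

Lemma RInt_to_C (f : R -> C) (a b : R) (l : C) :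
  @is_RInt C_R_NormedModule f a b l -> CRInt f a b = l.
Proof. apply (is_RInt_unique (V := C_R_CompleteNormedModule)). Qed.

(** Differentiability is asked only inside the segment, as branch points at its ends require. The
    difference between [f] and an indefinite integral of the clamped [df] has zero derivative, hence
    is constant. *)
Lemma CFTC a b f df : (a <= b)%R -> Ccont_on a b f -> Ccont_on a b df ->
  (forall s, (a < s < b)%R -> Rdiff f s (df s)) ->
  @is_RInt C_R_NormedModule df a b (f b - f a).
Proof.
  intros Hab Hf Hdf Hd.
  set (dc := fun s => df (clamp a b s)).
  assert (Hc : forall s, continuous (U := C_UniformSpace) dc s).
  { intros s. apply Clim_continuous. now apply Ccont_on_clamp. }
  pose (G := (fun s => CRInt dc a s) : R -> C).
  assert (HI : forall s, @is_RInt C_R_NormedModule dc a s (G s)).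
  { intros s. apply (RInt_correct (V := C_R_CompleteNormedModule)).
    apply (ex_RInt_continuous (V := C_R_CompleteNormedModule)). intros; apply Hc. }
  assert (HG : forall s, Rdiff G s (dc s)).
  { intros s. apply Rdiff_is_derive.
    apply (is_derive_RInt (V := C_R_NormedModule)) with a; [|apply Hc].
    apply filter_forall. exact HI. }
  assert (E : f b - G b = f a - G a).
  { apply Ceq_minus. apply Cmod_eq_0. apply Rle_antisym; [|apply Cmod_ge_0].
    apply Rle_trans with (0 * (b - a))%R; [|right; ring].
    apply (Rdiff_lipschitz a b (fun s => f s - G s) (fun s => df s - dc s)); [exact Hab| | |].
    - apply Ccont_on_minus; [exact Hf|]. apply Ccont_on_locally. intros s _.
      eapply Cdiff_continuous; [tc | apply Clim_RtoC | apply HG].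
    - intros s Hs. apply Cdiff_minus; [tc | now apply Hd | apply HG].
    - intros s Hs. unfold dc. rewrite clamp_id by lra.
      replace (df s - df s) with (RtoC 0) by ring. rewrite Cmod_0. lra. }
  assert (EG : G a = RtoC 0).
  { unfold G. apply RInt_to_C. apply (is_RInt_point (V := C_R_NormedModule)). }
  replace (f b - f a) with (G b).
  2:{ replace (f b) with ((f b - G b) + G b) by ring. rewrite E, EG. ring. }
  apply (is_RInt_ext (V := C_R_NormedModule)) with dc; [|apply HI].
  rewrite Rmin_left, Rmax_right by exact Hab. intros s Hs. unfold dc.
  rewrite clamp_id by lra. reflexivity.
Qed.

(** * Complex series and power series *)

Fixpoint csum (a : nat -> C) (n : nat) : C :=
  match n with O => 0 | S m => csum a m + a m end.

Fixpoint rsum (b : nat -> R) (n : nat) : R :=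
  match n with O => 0%R | S m => (rsum b m + b m)%R end.

Lemma csum_ext a b n : (forall k, (k < n)%nat -> a k = b k) -> csum a n = csum b n.
Proof.
  induction n as [|n IH]; intros H; simpl; [reflexivity|].
  rewrite IH, H by (intros; auto with arith || apply H; lia). reflexivity.
Qed.

Lemma rsum_ext a b n : (forall k, (k < n)%nat -> a k = b k) -> rsum a n = rsum b n.
Proof.
  induction n as [|n IH]; intros H; simpl; [reflexivity|].
  rewrite IH, H; auto with arith.
Qed.

Lemma csum_plus a b n : csum (fun k => a k + b k) n = csum a n + csum b n.
Proof. induction n as [|n IH]; simpl; [|rewrite IH]; ring. Qed.

Lemma csum_scal c a n : csum (fun k => c * a k) n = c * csum a n.
Proof. induction n as [|n IH]; simpl; [|rewrite IH]; ring. Qed.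

Lemma csum_0 (a : nat -> C) n : (forall k, (k < n)%nat -> a k = 0) -> csum a n = 0.
Proof.
  induction n as [|n IH]; intros H; simpl; [reflexivity|].
  rewrite IH, H; auto with arith; ring.
Qed.

Lemma csum_swap (a : nat -> nat -> C) m n :
  csum (fun i => csum (fun j => a i j) n) m = csum (fun j => csum (fun i => a i j) m) n.
Proof.
  induction m as [|m IH]; simpl.
  - symmetry. now apply csum_0.
  - rewrite IH. symmetry. apply csum_plus.
Qed.

Lemma csum_first a n : csum a (S n) = a O + csum (fun k => a (S k)) n.
Proof.
  induction n as [|n IH]; [simpl; ring|].
  change (csum a (S (S n))) with (csum a (S n) + a (S n)). rewrite IH. simpl. ring.
Qed.

Lemma csum_Cmod a b n : (forall k, (k < n)%nat -> (Cmod (a k) <= b k)%R) ->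
  (Cmod (csum a n) <= rsum b n)%R.
Proof.
  induction n as [|n IH]; intros H; simpl.
  - rewrite Cmod_0. lra.
  - eapply Rle_trans; [apply Cmod_triangle|].
    apply Rplus_le_compat; auto with arith.
Qed.

Lemma rsum_sum_n b n : rsum b (S n) = sum_n b n.
Proof.
  induction n as [|n IH].
  - rewrite sum_O. simpl. ring.
  - rewrite sum_Sn, <- IH. reflexivity.
Qed.

Lemma rsum_le_Series b (B : R) n : (forall k, (0 <= b k)%R) -> is_series b B -> (rsum b n <= B)%R.
Proof.
  intros Hb HB.
  assert (Hl : is_lim_seq (rsum b) B).
  { apply is_lim_seq_incr_1. apply is_lim_seq_ext with (sum_n b); [|exact HB].
    intros m. symmetry. apply rsum_sum_n. }
  apply (is_lim_seq_incr_compare _ _ Hl). intros m. simpl. generalize (Hb m). lra.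
Qed.

Lemma rsum_lim b (B : R) : is_series b B -> is_lim_seq (rsum b) B.
Proof.
  intros HB. apply is_lim_seq_incr_1. apply is_lim_seq_ext with (sum_n b); [|exact HB].
  intros m. symmetry. apply rsum_sum_n.
Qed.

Lemma is_series_rsum b (B : R) : is_lim_seq (rsum b) B -> is_series b B.
Proof.
  intros H. apply is_lim_seq_incr_1 in H. change (is_lim_seq (sum_n b) B).
  eapply is_lim_seq_ext; [|exact H]. intros m. apply rsum_sum_n.
Qed.

Definition is_Cseries (a : nat -> C) (l : C) : Prop := Clim eventually (csum a) l.

Definition Cseries (a : nat -> C) : C :=
  (Series (fun n => Re (a n)), Series (fun n => Im (a n))).

Lemma Clim_re {T} (F : (T -> Prop) -> Prop) {FF : Filter F} f l :
  Clim F f l -> filterlim (fun t => Re (f t)) F (locally (Re l)).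
Proof.
  intros H P [d Hd]. unfold filtermap. generalize (H d (cond_pos d)).
  apply filter_imp. intros t Ht. apply Hd.
  eapply Rle_lt_trans; [|exact Ht].
  eapply Rle_trans; [|apply re_le_Cmod]. right. reflexivity.
Qed.

Lemma Clim_im {T} (F : (T -> Prop) -> Prop) {FF : Filter F} f l :
  Clim F f l -> filterlim (fun t => Im (f t)) F (locally (Im l)).
Proof.
  intros H P [d Hd]. unfold filtermap. generalize (H d (cond_pos d)).
  apply filter_imp. intros t Ht. apply Hd.
  eapply Rle_lt_trans; [|exact Ht].
  eapply Rle_trans; [|apply im_le_Cmod]. right. reflexivity.
Qed.

Lemma Clim_pair {T} (F : (T -> Prop) -> Prop) {FF : Filter F} (f : T -> C) (l : C) :
  filterlim (fun t => Re (f t)) F (locally (Re l)) ->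
  filterlim (fun t => Im (f t)) F (locally (Im l)) -> Clim F f l.
Proof.
  intros H1 H2 eps Heps. assert (He : (0 < eps / 2)%R) by lra.
  assert (B1 := H1 _ (locally_ball (Re l) (mkposreal _ He))).
  assert (B2 := H2 _ (locally_ball (Im l) (mkposreal _ He))).
  unfold filtermap in B1, B2.
  generalize (filter_and _ _ B1 B2). apply filter_imp. intros t [E1 E2].
  change (Rabs (Re (f t) - Re l) < eps / 2)%R in E1.
  change (Rabs (Im (f t) - Im l) < eps / 2)%R in E2.
  eapply Rle_lt_trans; [apply Cmod_le_re_im|].
  change (Rabs (Re (f t) - Re l) + Rabs (Im (f t) - Im l) < eps)%R. lra.
Qed.

Lemma re_csum a n : Re (csum a n) = rsum (fun k => Re (a k)) n.
Proof. induction n as [|n IH]; simpl; [reflexivity|]. now rewrite <- IH. Qed.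

Lemma im_csum a n : Im (csum a n) = rsum (fun k => Im (a k)) n.
Proof. induction n as [|n IH]; simpl; [reflexivity|]. now rewrite <- IH. Qed.

Lemma is_Cseries_re a l : is_Cseries a l -> is_series (fun n => Re (a n)) (Re l).
Proof.
  intros H. apply (Clim_re eventually) in H.
  assert (H' : is_lim_seq (rsum (fun n => Re (a n))) (Re l)).
  { eapply is_lim_seq_ext; [|exact H]. intros n. apply re_csum. }
  now apply is_series_rsum.
Qed.

Lemma is_Cseries_im a l : is_Cseries a l -> is_series (fun n => Im (a n)) (Im l).
Proof.
  intros H. apply (Clim_im eventually) in H.
  assert (H' : is_lim_seq (rsum (fun n => Im (a n))) (Im l)).
  { eapply is_lim_seq_ext; [|exact H]. intros n. apply im_csum. }
  now apply is_series_rsum.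
Qed.

Lemma is_Cseries_pair a (l : C) :
  is_series (fun n => Re (a n)) (Re l) -> is_series (fun n => Im (a n)) (Im l) ->
  is_Cseries a l.
Proof.
  intros H1 H2. apply rsum_lim in H1, H2. apply Clim_pair; [tc| |].
  - apply (is_lim_seq_ext _ _ _ (fun n => eq_sym (re_csum a n)) H1).
  - apply (is_lim_seq_ext _ _ _ (fun n => eq_sym (im_csum a n)) H2).
Qed.

Lemma Cseries_unique a l : is_Cseries a l -> Cseries a = l.
Proof.
  intros H. unfold Cseries.
  rewrite (is_series_unique _ _ (is_Cseries_re a l H)).
  rewrite (is_series_unique _ _ (is_Cseries_im a l H)). now destruct l.
Qed.

Lemma Cseries_correct a (b : nat -> R) : (forall n, (Cmod (a n) <= b n)%R) -> ex_series b ->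
  is_Cseries a (Cseries a).
Proof.
  intros H Hb.
  apply is_Cseries_pair; apply Series_correct; apply (ex_series_le (V := R_CompleteNormedModule) _ b); auto; intros n;
    (eapply Rle_trans; [|apply H]).
  - apply re_le_Cmod.
  - apply im_le_Cmod.
Qed.

Lemma is_Cseries_ext a b l : (forall n, a n = b n) -> is_Cseries a l -> is_Cseries b l.
Proof.
  intros E. apply Clim_ext; [tc|].
  intros n. apply csum_ext. auto.
Qed.

Lemma is_Cseries_plus a b l m :
  is_Cseries a l -> is_Cseries b m -> is_Cseries (fun n => a n + b n) (l + m).
Proof.
  intros Ha Hb. apply Clim_ext with (fun n => csum a n + csum b n);
    [tc | intros n; symmetry; apply csum_plus |].
  apply Clim_plus; auto. tc.
Qed.

Lemma is_Cseries_scal c a l :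
  is_Cseries a l -> is_Cseries (fun n => c * a n) (c * l).
Proof.
  intros Ha. apply Clim_ext with (fun n => c * csum a n);
    [tc | intros n; symmetry; apply csum_scal |].
  apply Clim_scal; auto. tc.
Qed.

Lemma is_Cseries_minus a b l m :
  is_Cseries a l -> is_Cseries b m -> is_Cseries (fun n => a n - b n) (l - m).
Proof.
  intros Ha Hb. replace (l - m) with (l + - (1) * m) by ring.
  apply is_Cseries_ext with (fun n => a n + - (1) * b n); [intros; ring|].
  apply is_Cseries_plus; [exact Ha | now apply is_Cseries_scal].
Qed.

Lemma is_Cseries_Cmod a b l (B : R) : (forall n, (Cmod (a n) <= b n)%R) ->
  is_Cseries a l -> is_series b B -> (Cmod l <= B)%R.
Proof.
  intros H Ha Hb. apply le_epsilon. intros eps Heps.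
  destruct (Ha eps Heps) as [N HN]. specialize (HN N (le_n N)).
  assert (E : (Cmod (csum a N) <= B)%R).
  { eapply Rle_trans; [apply csum_Cmod; intros; apply H|].
    apply rsum_le_Series; [|exact Hb].
    intros k. eapply Rle_trans; [apply Cmod_ge_0 | apply H]. }
  rewrite Cmod_minus_sym in HN. generalize (Cmod_triangle' l (csum a N)). lra.
Qed.

(** The first [n] terms are replaced by zeros, which reduces the tail to a comparison of full sums.
    A bound that depends on [b] alone is what makes termwise integration uniform. *)
Lemma csum_tail a b l (B : R) n : (forall n, (Cmod (a n) <= b n)%R) ->
  is_Cseries a l -> is_series b B -> (Cmod (l - csum a n) <= B - rsum b n)%R.
Proof.
  intros H Ha Hb.
  pose (a' := fun k => if Nat.ltb k n then RtoC 0 else a k).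
  pose (b' := fun k => if Nat.ltb k n then 0%R else b k).
  assert (Ea : forall m, (n <= m)%nat -> csum a' m = csum a m - csum a n).
  { intros m Hm. induction Hm as [|m Hm IH].
    - rewrite csum_0; [ring|]. intros k Hk. unfold a'.
      now apply Nat.ltb_lt in Hk as ->.
    - simpl. rewrite IH. unfold a' at 1.
      assert (E : Nat.ltb m n = false) by (apply Nat.ltb_ge; lia). rewrite E. ring. }
  assert (Eb : forall m, (n <= m)%nat -> rsum b' m = (rsum b m - rsum b n)%R).
  { intros m Hm. induction Hm as [|m Hm IH].
    - replace (rsum b n - rsum b n)%R with (rsum (fun _ => 0%R) n).
      + apply rsum_ext. intros k Hk. unfold b'. now apply Nat.ltb_lt in Hk as ->.
      + clear. induction n as [|n IH]; simpl; [lra|]. rewrite IH. lra.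
    - simpl. rewrite IH. unfold b' at 1.
      assert (E : Nat.ltb m n = false) by (apply Nat.ltb_ge; lia). rewrite E. ring. }
  apply (is_Cseries_Cmod a' b').
  - intros k. unfold a', b'. destruct Nat.ltb; [rewrite Cmod_0; lra | apply H].
  - apply Clim_ext_loc with (fun m => csum a m - csum a n); [tc| |].
    + exists n. intros m Hm. symmetry. now apply Ea.
    + apply Clim_minus; [tc | exact Ha | apply Clim_const; tc].
  - apply rsum_lim in Hb.
    assert (H' : is_lim_seq (rsum b') (B - rsum b n)%R).
    { eapply is_lim_seq_ext_loc; [|apply is_lim_seq_minus'; [exact Hb | apply is_lim_seq_const]].
      exists n. intros m Hm. symmetry. now apply Eb. }
    now apply is_series_rsum.
Qed.

(** * Cauchy products and everywhere convergent power series *)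

Definition conv (a b : nat -> C) (n : nat) : C := csum (fun k => a k * b (n - k)%nat) (S n).
Definition rconv (a b : nat -> R) (n : nat) : R :=
  rsum (fun k => (a k * b (n - k)%nat)%R) (S n).

Lemma rsum_sum_f_R0 b n : rsum b (S n) = sum_f_R0 b n.
Proof. rewrite rsum_sum_n. apply sum_n_Reals. Qed.

Lemma is_series_rconv a b (la lb : R) : is_series a la -> is_series b lb ->
  ex_series (fun n => Rabs (a n)) -> ex_series (fun n => Rabs (b n)) ->
  is_series (rconv a b) (la * lb)%R.
Proof.
  intros Ha Hb Ha' Hb'.
  eapply is_series_ext; [|apply (is_series_mult a b la lb); eassumption].
  intros n. symmetry. apply rsum_sum_f_R0.
Qed.

Lemma rsum_minus a b n : rsum (fun k => (a k - b k)%R) n = (rsum a n - rsum b n)%R.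
Proof. induction n as [|n IH]; simpl; [|rewrite IH]; ring. Qed.

Lemma rsum_plus a b n : rsum (fun k => (a k + b k)%R) n = (rsum a n + rsum b n)%R.
Proof. induction n as [|n IH]; simpl; [|rewrite IH]; ring. Qed.

Lemma rsum_scal c a n : rsum (fun k => (c * a k)%R) n = (c * rsum a n)%R.
Proof. induction n as [|n IH]; simpl; [|rewrite IH]; ring. Qed.

Lemma ex_series_Rle (a b : nat -> R) :
  (forall n, (Rabs (a n) <= b n)%R) -> ex_series b -> ex_series a.
Proof. intros H. now apply (ex_series_le (V := R_CompleteNormedModule)). Qed.

(** Real and imaginary parts give four real Cauchy products, whose absolute convergence follows from
    that of the moduli. *)
Lemma is_Cseries_conv a b la lb : is_Cseries a la -> is_Cseries b lb ->
  ex_series (fun n => Cmod (a n)) -> ex_series (fun n => Cmod (b n)) ->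
  is_Cseries (conv a b) (la * lb).
Proof.
  intros Ha Hb Aa Ab.
  assert (Ra : ex_series (fun n => Rabs (Re (a n)))).
  { apply (ex_series_Rle _ _ (fun n => eq_ind_r (fun u => (u <= _)%R) (re_le_Cmod (a n)) (Rabs_Rabsolu _)) Aa). }
  assert (Ia : ex_series (fun n => Rabs (Im (a n)))).
  { apply (ex_series_Rle _ _ (fun n => eq_ind_r (fun u => (u <= _)%R) (im_le_Cmod (a n)) (Rabs_Rabsolu _)) Aa). }
  assert (Rb : ex_series (fun n => Rabs (Re (b n)))).
  { apply (ex_series_Rle _ _ (fun n => eq_ind_r (fun u => (u <= _)%R) (re_le_Cmod (b n)) (Rabs_Rabsolu _)) Ab). }
  assert (Ib : ex_series (fun n => Rabs (Im (b n)))).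
  { apply (ex_series_Rle _ _ (fun n => eq_ind_r (fun u => (u <= _)%R) (im_le_Cmod (b n)) (Rabs_Rabsolu _)) Ab). }
  assert (Ha1 := is_Cseries_re _ _ Ha). assert (Ha2 := is_Cseries_im _ _ Ha).
  assert (Hb1 := is_Cseries_re _ _ Hb). assert (Hb2 := is_Cseries_im _ _ Hb).
  apply is_Cseries_pair.
  - rewrite re_mult.
    eapply is_series_ext;
      [|apply (is_series_minus (V := R_NormedModule)); eapply is_series_rconv;
        [exact Ha1|exact Hb1|assumption|assumption|exact Ha2|exact Hb2|assumption|assumption]].
    intros n. unfold conv, rconv. rewrite re_csum.
    etransitivity; [symmetry; apply rsum_minus|]. apply rsum_ext. intros k _.
    now rewrite re_mult.
  - rewrite im_mult.
    eapply is_series_ext;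
      [|apply (is_series_plus (V := R_NormedModule)); eapply is_series_rconv;
        [exact Ha1|exact Hb2|assumption|assumption|exact Ha2|exact Hb1|assumption|assumption]].
    intros n. unfold conv, rconv. rewrite im_csum.
    etransitivity; [symmetry; apply rsum_plus|]. apply rsum_ext. intros k _.
    now rewrite im_mult.
Qed.

(** Coefficients of power series with an infinite radius of convergence. *)
Definition rgood (b : nat -> R) : Prop :=
  (forall n, (0 <= b n)%R) /\
  forall r, (0 <= r)%R -> ex_series (fun n => (b n * r ^ n)%R).
Definition good (a : nat -> C) : Prop := rgood (fun n => Cmod (a n)).
Definition PS (a : nat -> C) (z : C) : C := Cseries (fun n => a n * z ^ n).

Lemma rgood_le (b c : nat -> R) :
  (forall n, (0 <= c n <= b n)%R) -> rgood b -> rgood c.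
Proof.
  intros H [Hb Hs]. split; [intros n; apply H|]. intros r Hr.
  apply ex_series_Rle with (2 := Hs r Hr). intros n.
  rewrite Rabs_pos_eq.
  - apply Rmult_le_compat_r; [now apply pow_le | apply H].
  - apply Rmult_le_pos; [apply H | now apply pow_le].
Qed.

Lemma rgood_geom b K M : (0 <= K)%R -> (0 <= M)%R -> rgood b ->
  rgood (fun n => (M * (b n * K ^ n))%R).
Proof.
  intros HK HM [Hb Hs]. split.
  { intros n. apply Rmult_le_pos; [exact HM|].
    apply Rmult_le_pos; [apply Hb | now apply pow_le]. }
  intros r Hr. apply ex_series_ext with (fun n => scal M (b n * (K * r) ^ n)%R).
  - intros n. change (M * (b n * (K * r) ^ n) = M * (b n * K ^ n) * r ^ n)%R.
    rewrite Rpow_mult_distr. ring.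
  - apply (ex_series_scal (V := R_NormedModule)). apply Hs. now apply Rmult_le_pos.
Qed.

Lemma INR_le_pow2 n : (INR n <= 2 ^ n)%R.
Proof.
  induction n as [|n IH]; [simpl; lra|]. rewrite S_INR. simpl.
  assert (1 <= 2 ^ n)%R by (apply pow_R1_Rle; lra). lra.
Qed.

(** Since n is at most 2^n, the factor n is absorbed by doubling the radius, which costs nothing
    when the radius of convergence is infinite. *)
Lemma rgood_INR b : rgood b -> rgood (fun n => (INR n * b n)%R).
Proof.
  intros Hb. apply rgood_le with (fun n => (1 * (b n * 2 ^ n))%R).
  - intros n. destruct Hb as [Hb _]. split.
    + apply Rmult_le_pos; [apply pos_INR | apply Hb].
    + rewrite Rmult_1_l, Rmult_comm. apply Rmult_le_compat_l; [apply Hb | apply INR_le_pow2].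
  - apply rgood_geom; [lra|lra|exact Hb].
Qed.

Lemma rgood_plus a b : rgood a -> rgood b -> rgood (fun n => (a n + b n)%R).
Proof.
  intros [Ha Sa] [Hb Sb]. split.
  { intros n. generalize (Ha n) (Hb n). lra. }
  intros r Hr. apply ex_series_ext with (fun n => plus (a n * r ^ n)%R (b n * r ^ n)%R).
  - intros n. change (a n * r ^ n + b n * r ^ n = (a n + b n) * r ^ n)%R. ring.
  - apply (ex_series_plus (V := R_NormedModule)); auto.
Qed.

Lemma rconv_pow a b r n :
  rconv (fun k => (a k * r ^ k)%R) (fun k => (b k * r ^ k)%R) n = (rconv a b n * r ^ n)%R.
Proof.
  unfold rconv. rewrite (Rmult_comm _ (r ^ n)), <- rsum_scal. apply rsum_ext.
  intros k Hk. replace (r ^ n)%R with (r ^ (k + (n - k)))%R by (f_equal; lia).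
  rewrite pow_add. ring.
Qed.

Lemma rgood_conv a b : rgood a -> rgood b -> rgood (rconv a b).
Proof.
  intros [Ha Sa] [Hb Sb]. split.
  { intros n. unfold rconv. generalize (S n). intros m.
    induction m as [|m IH]; simpl; [lra|].
    apply Rplus_le_le_0_compat; [exact IH | apply Rmult_le_pos; auto]. }
  intros r Hr.
  apply ex_series_ext with (rconv (fun k => (a k * r ^ k)%R) (fun k => (b k * r ^ k)%R)).
  { intros n. apply rconv_pow. }
  destruct (Sa r Hr) as [la Hla]. destruct (Sb r Hr) as [lb Hlb].
  exists (la * lb)%R. apply is_series_rconv; auto.
  - apply ex_series_ext with (2 := Sa r Hr). intros n.
    symmetry. apply Rabs_pos_eq. apply Rmult_le_pos; [auto | now apply pow_le].
  - apply ex_series_ext with (2 := Sb r Hr). intros n.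
    symmetry. apply Rabs_pos_eq. apply Rmult_le_pos; [auto | now apply pow_le].
Qed.

Lemma rgood_inv_fact : rgood (fun n => / INR (Factorial.fact n))%R.
Proof.
  split; [intros n; apply Rlt_le, Rinv_0_lt_compat, INR_fact_lt_0|].
  intros r _. apply ex_pseries_R. exists (exp r). apply is_exp_Reals.
Qed.

Lemma conv_Cmod a b al be n : (forall k, (Cmod (a k) <= al k)%R) ->
  (forall k, (Cmod (b k) <= be k)%R) -> (Cmod (conv a b n) <= rconv al be n)%R.
Proof.
  intros Ha Hb. apply csum_Cmod. intros k _. rewrite Cmod_mult.
  apply Rmult_le_compat; auto using Cmod_ge_0.
Qed.

Lemma good_ex_series a z : good a -> ex_series (fun n => Cmod (a n * z ^ n)).
Proof.
  intros [_ Ha]. apply ex_series_ext with (2 := Ha (Cmod z) (Cmod_ge_0 z)).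
  intros n. now rewrite Cmod_mult, Cmod_pow.
Qed.

Lemma PS_correct a z : good a -> is_Cseries (fun n => a n * z ^ n) (PS a z).
Proof.
  intros Ha. apply Cseries_correct with (2 := good_ex_series a z Ha).
  intros n. apply Rle_refl.
Qed.

Lemma conv_pow a b z n :
  conv (fun k => a k * z ^ k) (fun k => b k * z ^ k) n = conv a b n * z ^ n.
Proof.
  unfold conv. rewrite (Cmult_comm _ (z ^ n)), <- csum_scal. apply csum_ext.
  intros k Hk. replace (z ^ n) with (z ^ (k + (n - k))) by (f_equal; lia).
  rewrite Cpow_add_r. ring.
Qed.

Lemma PS_conv a b z : good a -> good b ->
  is_Cseries (fun n => conv a b n * z ^ n) (PS a z * PS b z).
Proof.
  intros Ha Hb. eapply is_Cseries_ext; [intros n; apply conv_pow|].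
  apply is_Cseries_conv; auto using PS_correct, good_ex_series.
Qed.

Lemma is_Cseries_shift (a : nat -> C) l :
  a O = RtoC 0 -> is_Cseries a l -> is_Cseries (fun n => a (S n)) l.
Proof.
  intros E H eps Heps. destruct (H eps Heps) as [N HN]. exists N. intros n Hn.
  specialize (HN (S n) ltac:(lia)). rewrite csum_first, E, Cplus_0_l in HN. exact HN.
Qed.

(** The constant only has to stay summable against everywhere convergent coefficients, so the crude
    n^2 rho^n is taken; rho >= 1 lets rho^n absorb the lower exponents of the remainder. *)
Lemma Cpow_taylor (z h : C) (rho : R) (n : nat) :
  (1 <= rho)%R -> (Cmod z <= rho)%R -> (Cmod (z + h) <= rho)%R ->
  (Cmod ((z + h) ^ n - z ^ n - INR n * z ^ pred n * h)
   <= INR n * INR n * rho ^ n * (Cmod h * Cmod h))%R.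
Proof.
  intros H1 Hz Hw. induction n as [|n IH].
  - simpl. replace (1 - 1 - 0 * 1 * h) with (RtoC 0) by ring. rewrite Cmod_0. lra.
  - assert (E : (z + h) ^ S n - z ^ S n - INR (S n) * z ^ pred (S n) * h
      = (z + h) * ((z + h) ^ n - z ^ n - INR n * z ^ pred n * h)
        + INR n * z ^ pred n * (h * h)).
    { rewrite S_INR, RtoC_plus. destruct n as [|n].
      - simpl. ring.
      - simpl pred. rewrite !(Cpow_S _ (S n)), (Cpow_S z n). ring. }
    rewrite E. eapply Rle_trans; [apply Cmod_triangle|]. rewrite !Cmod_mult.
    rewrite Cmod_R, Rabs_pos_eq by apply pos_INR. rewrite Cmod_pow.
    assert (Hh : (0 <= Cmod h * Cmod h)%R) by (apply Rmult_le_pos; apply Cmod_ge_0).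
    assert (Hn := pos_INR n).
    assert (Hp : (Cmod z ^ pred n <= rho ^ S n)%R).
    { eapply Rle_trans; [apply pow_incr; split; [apply Cmod_ge_0 | exact Hz]|].
      apply Rle_pow; [exact H1 | lia]. }
    assert (A : (Cmod (z + h) * Cmod ((z + h) ^ n - z ^ n - INR n * z ^ pred n * h)
      <= INR n * INR n * rho ^ S n * (Cmod h * Cmod h))%R).
    { eapply Rle_trans; [apply Rmult_le_compat; [apply Cmod_ge_0|apply Cmod_ge_0|exact Hw|exact IH]|].
      right. simpl. ring. }
    assert (B : (INR n * Cmod z ^ pred n * (Cmod h * Cmod h)
      <= INR n * rho ^ S n * (Cmod h * Cmod h))%R).
    { apply Rmult_le_compat_r; [exact Hh|]. now apply Rmult_le_compat_l. }
    assert (P : (0 <= rho ^ S n * (Cmod h * Cmod h))%R).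
    { apply Rmult_le_pos; [apply pow_le; lra | exact Hh]. }
    rewrite S_INR. nra.
Qed.

Definition dcoef (a : nat -> C) (n : nat) (z : C) : C := a n * (INR n * z ^ pred n).

(** Summing the remainders of the monomials over the disc of radius |z| + 1 bounds that of the
    series by B |h|^2, where B is the sum of n^2 |a_n| rho^n. *)
Lemma PS_derive a z : good a ->
  exists l, is_Cseries (fun n => dcoef a n z) l /\ Zdiff (PS a) z l.
Proof.
  intros Ha. set (rho := (Cmod z + 1)%R).
  assert (Hrho : (1 <= rho)%R) by (unfold rho; generalize (Cmod_ge_0 z); lra).
  assert (G : rgood (fun n => INR n * (INR n * Cmod (a n)))%R) by (now do 2 apply rgood_INR).
  destruct (proj2 G rho ltac:(lra)) as [B HB].
  assert (G1 : rgood (fun n => INR n * Cmod (a n))%R) by (now apply rgood_INR).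
  assert (Hd : is_Cseries (fun n => dcoef a n z) (Cseries (fun n => dcoef a n z))).
  { apply Cseries_correct with (2 := proj2 G1 rho ltac:(lra)). intros n. unfold dcoef.
    rewrite !Cmod_mult, Cmod_R, Rabs_pos_eq, Cmod_pow by apply pos_INR.
    replace (INR n * Cmod (a n) * rho ^ n)%R with (Cmod (a n) * (INR n * rho ^ n))%R by ring.
    apply Rmult_le_compat_l; [apply Cmod_ge_0|]. apply Rmult_le_compat_l; [apply pos_INR|].
    eapply Rle_trans; [apply pow_incr; split; [apply Cmod_ge_0|]|].
    - instantiate (1 := rho). unfold rho. lra.
    - apply Rle_pow; [exact Hrho | lia]. }
  eexists; split; [exact Hd|].
  set (l := Cseries (fun n => dcoef a n z)) in *.
  assert (HB0 : (0 <= B)%R).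
  { apply Rle_trans with (rsum (fun n => INR n * (INR n * Cmod (a n)) * rho ^ n)%R 0);
      [simpl; lra|].
    apply rsum_le_Series; [|exact HB]. intros k.
    apply Rmult_le_pos; [apply (proj1 G) | apply pow_le; lra]. }
  apply Cdiff_intro; [tc | auto|]. intros eps Heps.
  apply locally_Cmod_iff.
  (* At most 1 in order to stay in the disc, at most eps / (B + 1) in order to have B |h| <= eps;
     the added 1 avoids a division by zero. *)
  assert (Hd0 : (0 < Rmin 1 (eps / (B + 1)))%R).
  { apply Rmin_glb_lt; [lra|]. apply Rdiv_lt_0_compat; lra. }
  exists (Rmin 1 (eps / (B + 1))). split; [exact Hd0|].
  intros w Hw. set (h := w - z).
  assert (Ew : w = z + h) by (unfold h; ring).
  assert (Hh1 : (Cmod h <= 1)%R) by (generalize (Rmin_l 1 (eps / (B + 1))); unfold h; lra).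
  assert (Hh2 : (Cmod h <= eps / (B + 1))%R)
    by (generalize (Rmin_r 1 (eps / (B + 1))); unfold h; lra).
  assert (Hs : is_Cseries
    (fun n => a n * ((z + h) ^ n - z ^ n - INR n * z ^ pred n * h)) (PS a w - PS a z - h * l)).
  { apply is_Cseries_ext with (fun n => a n * w ^ n - a n * z ^ n - h * dcoef a n z).
    - intros n. unfold dcoef. rewrite Ew. ring.
    - apply is_Cseries_minus; [apply is_Cseries_minus; now apply PS_correct|].
      now apply is_Cseries_scal. }
  assert (HBh : is_series (fun n => (INR n * (INR n * Cmod (a n)) * rho ^ n) * (Cmod h * Cmod h))%R
    (B * (Cmod h * Cmod h))%R).
  { apply (is_series_scal_r (Cmod h * Cmod h) _ _ HB). }
  replace (l * h) with (h * l) by ring.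
  eapply Rle_trans; [apply (is_Cseries_Cmod _ _ _ _) with (2 := Hs) (3 := HBh)|].
  - intros n. rewrite Cmod_mult.
    eapply Rle_trans; [apply Rmult_le_compat_l; [apply Cmod_ge_0|]|].
    + apply (Cpow_taylor z h rho n Hrho); [unfold rho; lra|].
      eapply Rle_trans; [apply Cmod_triangle | unfold rho; lra].
    + right. ring.
  - rewrite <- Rmult_assoc. apply Rmult_le_compat_r; [apply Cmod_ge_0|].
    apply Rle_trans with (B * (eps / (B + 1)))%R.
    + now apply Rmult_le_compat_l.
    + replace (B * (eps / (B + 1)))%R with (eps * (B / (B + 1)))%R by (field; lra).
      rewrite <- (Rmult_1_r eps) at 2. apply Rmult_le_compat_l; [lra|].
      apply Rle_div_l; lra.
Qed.

Lemma re_pow_real (c : C) (x : R) n : Re (c * RtoC x ^ n) = (Re c * x ^ n)%R.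
Proof. rewrite <- RtoC_pow, re_scal_r. reflexivity. Qed.

Lemma im_pow_real (c : C) (x : R) n : Im (c * RtoC x ^ n) = (Im c * x ^ n)%R.
Proof. rewrite <- RtoC_pow, im_scal_r. reflexivity. Qed.

Lemma CV_radius_pos (a : nat -> R) (b : nat -> C) (rho : R) : (0 < rho)%R ->
  (forall n, (Rabs (a n) <= Cmod (b n))%R) ->
  ex_series (fun n => Cmod (b n) * rho ^ n)%R -> Rbar_lt 0 (CV_radius a).
Proof.
  intros Hr Hab Hs. apply Rbar_lt_le_trans with rho; [exact Hr|].
  unfold CV_radius. destruct (Lub_Rbar_correct (CV_disk a)) as [ub _]. apply ub.
  apply ex_series_Rle with (2 := Hs). intros n.
  rewrite Rabs_Rabsolu, Rabs_mult, (Rabs_pos_eq (rho ^ n)) by (apply pow_le; lra).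
  apply Rmult_le_compat_r; [apply pow_le; lra | apply Hab].
Qed.

(** Real arguments suffice: there the real and imaginary parts are real power series, for which
    coefficients are unique. *)
Lemma Cseries_pow_unique (a b : nat -> C) (rho : R) : (0 < rho)%R ->
  ex_series (fun n => Cmod (a n) * rho ^ n)%R ->
  ex_series (fun n => Cmod (b n) * rho ^ n)%R ->
  (forall z, (Cmod z < rho)%R ->
    exists l, is_Cseries (fun n => a n * z ^ n) l /\ is_Cseries (fun n => b n * z ^ n) l) ->
  forall n, a n = b n.
Proof.
  intros Hr Ha Hb H n.
  assert (E1 : Re (a n) = Re (b n)).
  { apply (PSeries_ext_recip (fun n => Re (a n)) (fun n => Re (b n))).
    - apply (CV_radius_pos _ a rho); auto. intros; apply re_le_Cmod.
    - apply (CV_radius_pos _ b rho); auto. intros; apply re_le_Cmod.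
    - exists (mkposreal rho Hr). intros x Hx.
      assert (Hx' : (Cmod (RtoC x) < rho)%R).
      { rewrite Cmod_R. change (Rabs (x - 0) < rho)%R in Hx. now rewrite Rminus_0_r in Hx. }
      destruct (H x Hx') as (l & Hla & Hlb).
      apply is_Cseries_re, is_series_unique in Hla, Hlb. unfold PSeries.
      rewrite (Series_ext _ _ (fun k => eq_sym (re_pow_real (a k) x k))), Hla.
      rewrite (Series_ext _ _ (fun k => eq_sym (re_pow_real (b k) x k))), Hlb.
      reflexivity. }
  assert (E2 : Im (a n) = Im (b n)).
  { apply (PSeries_ext_recip (fun n => Im (a n)) (fun n => Im (b n))).
    - apply (CV_radius_pos _ a rho); auto. intros; apply im_le_Cmod.
    - apply (CV_radius_pos _ b rho); auto. intros; apply im_le_Cmod.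
    - exists (mkposreal rho Hr). intros x Hx.
      assert (Hx' : (Cmod (RtoC x) < rho)%R).
      { rewrite Cmod_R. change (Rabs (x - 0) < rho)%R in Hx. now rewrite Rminus_0_r in Hx. }
      destruct (H x Hx') as (l & Hla & Hlb).
      apply is_Cseries_im, is_series_unique in Hla, Hlb. unfold PSeries.
      rewrite (Series_ext _ _ (fun k => eq_sym (im_pow_real (a k) x k))), Hla.
      rewrite (Series_ext _ _ (fun k => eq_sym (im_pow_real (b k) x k))), Hlb.
      reflexivity. }
  destruct (a n), (b n). simpl in *. now subst.
Qed.

(** * Exponential, logarithm and powers *)

Lemma C_eq (a b : C) : Re a = Re b -> Im a = Im b -> a = b.
Proof. destruct a, b. simpl. intros -> ->. reflexivity. Qed.

Lemma Cexp_plus a b : Cexp (a + b) = Cexp a * Cexp b.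
Proof.
  apply C_eq; unfold Cexp; rewrite re_plus, im_plus, exp_plus;
    [rewrite cos_plus | rewrite sin_plus]; simpl; ring.
Qed.

Lemma Cexp_0 : Cexp 0 = 1.
Proof. apply C_eq; simpl; rewrite exp_0, ?cos_0, ?sin_0; ring. Qed.

Lemma Cexp_opp_r z : Cexp z * Cexp (- z) = 1.
Proof. rewrite <- Cexp_plus, Cplus_opp_r. apply Cexp_0. Qed.

Lemma Cmod_Cexp z : Cmod (Cexp z) = exp (Re z).
Proof.
  unfold Cmod, Cexp. simpl fst. simpl snd.
  replace ((exp (Re z) * cos (Im z)) ^ 2 + (exp (Re z) * sin (Im z)) ^ 2)%R
    with (exp (Re z) ^ 2 * ((sin (Im z))² + (cos (Im z))²))%R by (unfold Rsqr; ring).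
  rewrite sin2_cos2, Rmult_1_r, sqrt_pow2; [reflexivity|]. apply Rlt_le, exp_pos.
Qed.

Lemma Cexp_nz z : Cexp z <> 0.
Proof.
  intros E. generalize (Cmod_Cexp z) (exp_pos (Re z)). rewrite E, Cmod_0. lra.
Qed.

Definition expc (n : nat) : C := RtoC (/ INR (Factorial.fact n)).

Lemma Cmod_expc n : Cmod (expc n) = (/ INR (Factorial.fact n))%R.
Proof.
  unfold expc. rewrite Cmod_R, Rabs_pos_eq; [reflexivity|].
  apply Rlt_le, Rinv_0_lt_compat, INR_fact_lt_0.
Qed.

Lemma good_expc : good expc.
Proof.
  apply rgood_le with (2 := rgood_inv_fact). intros n. rewrite Cmod_expc.
  split; [|lra]. apply Rlt_le, Rinv_0_lt_compat, INR_fact_lt_0.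
Qed.

Lemma expc_S n : expc (S n) * INR (S n) = expc n.
Proof.
  unfold expc. rewrite <- RtoC_mult. f_equal.
  replace (INR (Factorial.fact (S n))) with (INR (S n) * INR (Factorial.fact n))%R.
  - field. split; [apply INR_fact_neq_0 | apply not_0_INR; lia].
  - now rewrite <- mult_INR.
Qed.

Lemma PS_expc_derive z : Zdiff (PS expc) z (PS expc z).
Proof.
  destruct (PS_derive expc z good_expc) as (l & Hl & Hd).
  replace (PS expc z) with l; [exact Hd|].
  symmetry. apply Cseries_unique.
  apply is_Cseries_ext with (fun n => dcoef expc (S n) z).
  - intros n. unfold dcoef. rewrite Cmult_assoc, expc_S. reflexivity.
  - apply is_Cseries_shift with (2 := Hl). unfold dcoef. simpl. ring.
Qed.

Lemma Rdiff_Cexp_line (z : C) (s : R) :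
  Rdiff (fun t : R => Cexp (- (t * z))) s (- z * Cexp (- (s * z))).
Proof.
  assert (E : forall t : R, Cexp (- (t * z)) =
    (exp (- (t * Re z)) * cos (- (t * Im z)), exp (- (t * Re z)) * sin (- (t * Im z)))%R).
  { intros t. unfold Cexp. now rewrite re_opp, im_opp, re_scal_l, im_scal_l. }
  apply Cdiff_ext with (fun t => (exp (- (t * Re z)) * cos (- (t * Im z)),
    exp (- (t * Re z)) * sin (- (t * Im z)))%R); [tc | intros; symmetry; apply E |].
  rewrite E. destruct z as [u v]. apply Rdiff_pair; simpl.
  - auto_derive; [trivial | ring].
  - auto_derive; [trivial | ring].
Qed.

(** The series at t z times [Cexp] at - t z has zero derivative in the real variable t, so its value
    1 at t = 0 persists at t = 1. Complex differentiability then passes from the series to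
    [Cexp]. *)
Lemma PS_expc z : PS expc z = Cexp z.
Proof.
  set (g := fun t : R => PS expc (t * z) * Cexp (- (t * z))).
  assert (Hg : forall s : R, Rdiff g s 0).
  { intros s. unfold g.
    eapply Cdiff_eq; [|apply Cdiff_mult; [tc | apply Clim_RtoC | | apply Rdiff_Cexp_line]].
    2:{ apply (Cdiff_comp (locally s) RtoC s (fun t : R => t * z) z (PS expc)
          (PS expc (s * z))); [apply Clim_RtoC | | apply PS_expc_derive].
        apply Cdiff_ext with (fun t : R => z * t); [tc | intros; ring |].
        eapply Cdiff_eq; [|apply Cdiff_scal; [tc | apply Cdiff_id; tc]].
        ring. }
    cbv beta. ring. }
  assert (E : g 1%R = g 0%R).
  { apply Ceq_minus, Cmod_eq_0. apply Rle_antisym; [|apply Cmod_ge_0].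
    apply Rle_trans with (0 * (1 - 0))%R; [|right; ring].
    apply (Rdiff_lipschitz 0 1 g (fun _ => RtoC 0)); [lra | | intros; apply Hg |].
    - apply Ccont_on_locally. intros s _.
      eapply Cdiff_continuous; [tc | apply Clim_RtoC | apply Hg].
    - intros s _. rewrite Cmod_0. lra. }
  unfold g in E. rewrite Cmult_1_l, Cmult_0_l in E.
  assert (E0 : PS expc 0 = 1).
  { apply Cseries_unique. apply Clim_ext_loc with (fun _ => RtoC 1);
      [tc| |apply Clim_const; tc].
    exists 1%nat. intros [|n] Hn; [lia|]. rewrite csum_first, csum_0.
    - unfold expc. simpl. rewrite Rinv_1. ring.
    - intros k _. simpl. ring. }
  rewrite E0, Copp_0, Cexp_0 in E.
  replace (PS expc z) with (PS expc z * Cexp (- z) * Cexp z).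
  - rewrite E. ring.
  - rewrite <- Cmult_assoc, (Cmult_comm (Cexp (- z))), Cexp_opp_r. ring.
Qed.

Lemma is_Cseries_Cexp z : is_Cseries (fun n => expc n * z ^ n) (Cexp z).
Proof. rewrite <- PS_expc. apply PS_correct, good_expc. Qed.

Lemma Cexp_derive z : Zdiff Cexp z (Cexp z).
Proof.
  rewrite <- PS_expc. apply Cdiff_ext with (PS expc); [tc | apply PS_expc |].
  apply PS_expc_derive.
Qed.

Lemma Re_Cmod_bound (w : C) : w <> 0 -> (-1 <= Re w / Cmod w <= 1)%R.
Proof.
  intros Hw. assert (P : (0 < Cmod w)%R) by now apply Cmod_gt_0.
  generalize (re_le_Cmod w). intros H. apply Rabs_le_between in H.
  split; [apply Rle_div_r | apply Rle_div_l]; lra.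
Qed.

Lemma Carg_bound (w : C) : w <> 0 -> (- PI < Carg w <= PI)%R.
Proof.
  intros Hw. assert (P : (0 < Cmod w)%R) by now apply Cmod_gt_0.
  generalize (acos_bound (Re w / Cmod w)) PI_RGT_0. intros HB HPI.
  unfold Carg. destruct Rle_dec as [H|H]; [lra|].
  (* Argument -PI would force w to be a negative real, whereas this branch of [Carg] is taken only
     when Im w < 0. *)
  split; [|lra]. destruct (Req_dec (acos (Re w / Cmod w)) PI) as [E|N]; [|lra].
  exfalso. assert (E' : (Re w / Cmod w = -1)%R).
  { rewrite <- cos_PI, <- E. symmetry. apply cos_acos. now apply Re_Cmod_bound. }
  assert (E2 : (Re w = - Cmod w)%R).
  { replace (Re w) with (Re w / Cmod w * Cmod w)%R by (field; lra). rewrite E'. ring. }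
  generalize (Cmod2_alt w). rewrite E2. intros E3.
  assert (Im w * Im w = 0)%R by nra. nra.
Qed.

Lemma Cexp_Clog (w : C) : w <> 0 -> Cexp (Clog w) = w.
Proof.
  intros Hw. assert (P : (0 < Cmod w)%R) by now apply Cmod_gt_0.
  assert (HB := Re_Cmod_bound w Hw).
  assert (HS : sqrt (1 - (Re w / Cmod w)²) = (Rabs (Im w) / Cmod w)%R).
  { replace (1 - (Re w / Cmod w)²)%R with ((Rabs (Im w) / Cmod w)²).
    - apply sqrt_Rsqr. apply Rmult_le_pos; [apply Rabs_pos|].
      apply Rlt_le, Rinv_0_lt_compat, P.
    - rewrite !Rsqr_div'. rewrite <- Rsqr_abs.
      assert (E := Cmod2_alt w). unfold Rsqr in *.
      field_simplify_eq; [|lra]. nra. }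
  unfold Cexp, Clog. simpl Re. simpl Im. rewrite exp_ln by exact P.
  apply C_eq; unfold Carg; simpl; destruct Rle_dec as [H|H].
  - rewrite cos_acos by exact HB. field. lra.
  - rewrite cos_neg, cos_acos by exact HB. field. lra.
  - rewrite sin_acos, HS by exact HB. rewrite Rabs_pos_eq by exact H. field. lra.
  - rewrite sin_neg, sin_acos, HS by exact HB. rewrite Rabs_left by lra. field. lra.
Qed.

(** Two arguments in ]-PI, PI] differ by less than 2 PI, whence the uniqueness of the logarithm. *)
Lemma sin_zero_strip (d : R) : (- (2 * PI) < d < 2 * PI)%R -> sin d = 0%R -> cos d = 1%R -> d = 0%R.
Proof.
  intros Hd Hs Hc. generalize PI_RGT_0. intros HPI.
  destruct (Rtotal_order d 0) as [L|[E|G]]; [|exact E|]; exfalso.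
  - destruct (Rlt_le_dec d (- PI)) as [L1|L1].
    + assert (H := sin_lt_0 (- d) ltac:(lra) ltac:(lra)). rewrite sin_neg in H. lra.
    + destruct (Req_dec d (- PI)) as [->|N].
      * rewrite cos_neg, cos_PI in Hc. lra.
      * assert (H := sin_gt_0 (- d) ltac:(lra) ltac:(lra)). rewrite sin_neg in H. lra.
  - destruct (Rlt_le_dec PI d) as [L1|L1].
    + assert (H := sin_lt_0 d ltac:(lra) ltac:(lra)). lra.
    + destruct (Req_dec d PI) as [->|N].
      * rewrite cos_PI in Hc. lra.
      * assert (H := sin_gt_0 d ltac:(lra) ltac:(lra)). lra.
Qed.

Lemma Clog_unique z w : Cexp z = w -> (- PI < Im z <= PI)%R -> Clog w = z.
Proof.
  intros E Hz. assert (Hw : w <> 0) by (rewrite <- E; apply Cexp_nz).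
  assert (E2 := Cexp_Clog w Hw).
  assert (M : Re (Clog w) = Re z).
  { apply exp_inv. rewrite <- !Cmod_Cexp. now rewrite E, E2. }
  apply C_eq; [exact M|].
  assert (HB := Carg_bound w Hw). change (Carg w) with (Im (Clog w)) in HB.
  assert (E3 : Cexp (Clog w - z) = 1).
  { unfold Cminus. rewrite Cexp_plus, E2, <- E. apply Cexp_opp_r. }
  assert (Hd : (Im (Clog w - z) = 0)%R).
  { apply sin_zero_strip.
    - unfold Cminus. rewrite im_plus, im_opp. lra.
    - apply (f_equal Im) in E3. simpl in E3. apply Rmult_integral in E3.
      destruct E3 as [E3|E3]; [|exact E3].
      generalize (exp_pos (Re (Clog w - z))). simpl. lra.
    - apply (f_equal Re) in E3. simpl in E3.
      assert (E4 : Re (Clog w - z) = 0%R).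
      { unfold Cminus. rewrite re_plus, re_opp, M. ring. }
      change (exp (Re (Clog w - z)) * cos (Im (Clog w - z)) = 1)%R in E3.
      rewrite E4, exp_0 in E3. lra. }
  unfold Cminus in Hd. rewrite im_plus, im_opp in Hd. lra.
Qed.

Definition slit (w : C) : Prop := ~ (Im w = 0%R /\ (Re w <= 0)%R).

Lemma slit_nz (w : C) : slit w -> w <> RtoC 0.
Proof. intros H E. apply H. rewrite E. simpl. split; [reflexivity | lra]. Qed.

Lemma Carg_slit w : slit w -> (- PI < Carg w < PI)%R.
Proof.
  intros H. assert (Hw := slit_nz w H).
  destruct (Carg_bound w Hw) as [H1 H2]. split; [exact H1|].
  destruct (Req_dec (Carg w) PI) as [E|N]; [exfalso|lra].
  apply H. assert (E2 := Cexp_Clog w Hw). unfold Cexp, Clog in E2. simpl in E2.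
  rewrite E, sin_PI, cos_PI in E2. rewrite <- E2. simpl.
  split; [ring|]. generalize (exp_pos (ln (Cmod w))). lra.
Qed.

(* On the right half-plane the principal argument is an arctangent, which is
   visibly continuous; translations carry this to the whole slit plane. *)
Lemma Clog_right (v : C) : (0 < Re v)%R -> Clog v = (ln (Cmod v), atan (Im v / Re v)).
Proof.
  intros Hv. apply Clog_unique.
  2:{ simpl. generalize (atan_bound (Im v / Re v)) PI_RGT_0. lra. }
  assert (Hn : v <> 0) by (intros E; rewrite E in Hv; simpl in Hv; lra).
  assert (P : (0 < Cmod v)%R) by now apply Cmod_gt_0.
  assert (S0 : (0 < sqrt (1 + (Im v / Re v)²))%R).
  { apply sqrt_lt_R0. generalize (Rle_0_sqr (Im v / Re v)). lra. }
  assert (M : Cmod v = (Re v * sqrt (1 + (Im v / Re v)²))%R).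
  { rewrite <- (sqrt_Rsqr (Re v)) at 1 by lra. rewrite <- sqrt_mult.
    - unfold Cmod. f_equal. unfold Rsqr. change (fst v) with (Re v).
      change (snd v) with (Im v). field. lra.
    - apply Rle_0_sqr.
    - generalize (Rle_0_sqr (Im v / Re v)). lra. }
  unfold Cexp. simpl Re. simpl Im. rewrite exp_ln by exact P.
  apply C_eq; simpl.
  - rewrite cos_atan, M. field. lra.
  - rewrite sin_atan, M. field. split; lra.
Qed.

Lemma Clog_continuous_1 : Clim (locallyC (RtoC 1)) Clog 0.
Proof.
  apply Clim_ext_loc with (fun v => (ln (Cmod v), atan (Im v / Re v))); [tc| |].
  - apply locally_Cmod_iff. exists 1%R. split; [lra|]. intros v Hv. symmetry.
    apply Clog_right.
    assert (H := re_le_Cmod (v - 1)). unfold Cminus in *. rewrite re_plus, re_opp, re_RtoC in H.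
    apply Rabs_le_between in H. lra.
  - assert (Hid := Clim_idC 1).
    apply Clim_pair; [tc| |]; simpl.
    + rewrite <- ln_1. apply (filterlim_comp _ _ _ Cmod ln _ (locally 1%R)).
      * intros P [d Hd]. unfold filtermap. generalize (Clim_Cmod _ _ _ Hid d (cond_pos d)).
        apply filter_imp. intros v Hv. apply Hd. rewrite Cmod_1 in Hv. exact Hv.
      * apply (ex_derive_continuous ln). auto_derive. lra.
    + rewrite <- atan_0. apply (filterlim_comp _ _ _ (fun v => Im v / Re v)%R atan _ (locally 0%R)).
      * replace 0%R with (0 / 1)%R by field.
        apply (filterlim_comp_2 (F := locallyC (RtoC 1))
          (G := locally 0%R) (H := locally 1%R) Im Re Rdiv).
        -- apply (Clim_im _ _ _ Hid).
        -- apply (Clim_re _ _ _ Hid).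
        -- unfold Rdiv.
           apply (filterlim_comp_2 (G := locally 0%R) (H := locally (/ 1)%R)
             (fun p : R * R => fst p) (fun p : R * R => (/ snd p)%R) Rmult).
           ++ apply filterlim_fst.
           ++ apply (filterlim_comp _ _ _ snd Rinv _ (locally 1%R)); [apply filterlim_snd|].
              apply (ex_derive_continuous Rinv). auto_derive. lra.
           ++ apply (filterlim_mult (K := R_AbsRing) 0%R (/ 1)%R).
      * apply (ex_derive_continuous atan). auto_derive. trivial.
Qed.

Lemma Clog_mult (a b : C) : a <> 0 -> b <> 0 -> (- PI < Carg a + Carg b <= PI)%R ->
  Clog (a * b) = Clog a + Clog b.
Proof.
  intros Ha Hb H. apply Clog_unique.
  - rewrite Cexp_plus, !Cexp_Clog by assumption. reflexivity.
  - exact H.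
Qed.

Lemma Cdiv_mul_cancel (v w : C) : w <> 0 -> v / w * w = v.
Proof. intros Hw. field. exact Hw. Qed.

(** Near [w] the identity Clog v = Clog w + Clog (v / w) moves the question to the point 1. *)
Lemma Clog_continuous w : slit w -> Clim (locallyC w) Clog (Clog w).
Proof.
  intros Hw. assert (Hn := slit_nz w Hw). assert (HA := Carg_slit w Hw).
  assert (Hq : Clim (locallyC w) (fun v => v / w) 1).
  { apply Clim_eq with (w * / w); [field; exact Hn|].
    apply Clim_mult; [tc | apply Clim_idC | apply Clim_const; tc]. }
  assert (Hl : Clim (locallyC w) (fun v => Clog (v / w)) 0).
  { intros eps Heps. generalize (Clog_continuous_1 eps Heps). intros H.
    apply locally_Cmod_iff in H. destruct H as (d & Hd & H).
    generalize (Hq d Hd). apply filter_imp. intros v. apply H. }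
  apply Clim_ext_loc with (fun v => Clog w + Clog (v / w)); [tc| |].
  (* [m] is the distance from the argument of [w] to the ends of ]-PI, PI[; an argument of v / w
     smaller than [m] cannot push the sum across the cut. *)
  - set (m := Rmin (PI - Carg w) (PI + Carg w)).
    assert (Hm : (0 < m)%R) by (unfold m; apply Rmin_glb_lt; lra).
    assert (Hm1 := Rmin_l (PI - Carg w) (PI + Carg w)).
    assert (Hm2 := Rmin_r (PI - Carg w) (PI + Carg w)). fold m in Hm1, Hm2.
    assert (H1 : (0 < Cmod w)%R) by now apply Cmod_gt_0.
    generalize (filter_and _ _ (Hl m Hm) (Clim_idC w _ H1)). apply filter_imp.
    intros v [Hv Hv2].
    assert (Hvn : v <> RtoC 0).
    { intros E. rewrite E in Hv2. replace (0 - w) with (- w) in Hv2 by ring.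
      rewrite Cmod_opp in Hv2. lra. }
    rewrite <- Clog_mult.
    + f_equal. field. exact Hn.
    + exact Hn.
    + intros E. apply Hvn. rewrite <- (Cdiv_mul_cancel v w Hn), E. apply Cmult_0_l.
    + assert (H := im_le_Cmod (Clog (v / w) - 0)).
      replace (Im (Clog (v / w) - 0)) with (Carg (v / w)) in H.
      * apply Rabs_le_between in H. lra.
      * unfold Cminus. rewrite im_plus, im_opp, im_RtoC. simpl. ring.
  - apply Clim_eq with (Clog w + 0); [ring|].
    apply Clim_plus; [tc | apply Clim_const; tc | exact Hl].
Qed.

(** The slope of [Cexp] at [Clog w], composed with the logarithm, tends to w, which is nonzero; its
    inverse is a slope of the logarithm. *)
Lemma Clog_derive w : slit w -> Zdiff Clog w (/ w).
Proof.
  intros Hw. assert (Hn := slit_nz w Hw).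
  destruct (Cexp_derive (Clog w)) as (q & Hq & Lq).
  rewrite Cexp_Clog in Lq by exact Hn.
  assert (Hc := Clog_continuous w Hw).
  assert (Lq' : Clim (locallyC w) (fun v => q (Clog v)) w).
  { intros eps Heps. generalize (Lq eps Heps). intros H. apply locally_Cmod_iff in H.
    destruct H as (d & Hd & H). generalize (Hc d Hd). apply filter_imp. intros v. apply H. }
  exists (fun v => / q (Clog v)). split.
  - apply locally_Cmod_iff in Hq. destruct Hq as (d & Hd & Hq).
    assert (H1 : (0 < Cmod w)%R) by now apply Cmod_gt_0.
    generalize (filter_and _ _ (Hc d Hd) (filter_and _ _ (Lq' _ H1) (Clim_idC w _ H1))).
    apply filter_imp. intros v (H2 & H3 & H4).
    assert (Hvn : v <> RtoC 0).
    { intros E. rewrite E in H4. replace (0 - w) with (- w) in H4 by ring.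
      rewrite Cmod_opp in H4. lra. }
    assert (Hqn : q (Clog v) <> RtoC 0).
    { intros E. rewrite E in H3. replace (0 - w) with (- w) in H3 by ring.
      rewrite Cmod_opp in H3. lra. }
    specialize (Hq _ H2). rewrite !Cexp_Clog in Hq by assumption.
    assert (E : q (Clog v) * (Clog v - Clog w) = v - w).
    { symmetry. transitivity (w + q (Clog v) * (Clog v - Clog w) - w); [|ring].
      exact (f_equal (fun u => u - w) Hq). }
    rewrite <- E. field. exact Hqn.
  - apply Clim_inv; [tc | exact Hn | exact Lq'].
Qed.

Lemma Cpower_nz (w a : C) : w <> 0 -> Cpower w a = Cexp (a * Clog w).
Proof. intros Hw. unfold Cpower. destruct Ceq_dec as [E|N]; [contradiction | reflexivity]. Qed.

Lemma Cpower_0 a : Cpower 0 a = 0.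
Proof. unfold Cpower. destruct Ceq_dec as [E|N]; [reflexivity | now elim N]. Qed.

Lemma Cpower_plus w a b : Cpower w (a + b) = Cpower w a * Cpower w b.
Proof.
  destruct (Ceq_dec w 0) as [->|N]; [rewrite !Cpower_0; ring|].
  rewrite !Cpower_nz by exact N. rewrite <- Cexp_plus. f_equal. ring.
Qed.

Lemma Cpower_1_r w : Cpower w 1 = w.
Proof.
  destruct (Ceq_dec w 0) as [->|N]; [apply Cpower_0|].
  rewrite Cpower_nz, Cmult_1_l by exact N. now apply Cexp_Clog.
Qed.

Lemma Clog_1 : Clog 1 = 0.
Proof. apply Clog_unique; [apply Cexp_0|]. simpl. generalize PI_RGT_0. lra. Qed.

Lemma Cpower_1_l a : Cpower 1 a = 1.
Proof.
  rewrite Cpower_nz, Clog_1, Cmult_0_r; [apply Cexp_0|]. apply C1_nz.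
Qed.

Lemma Cpower_pow w a n : Cpower w a ^ S n = Cpower w (INR (S n) * a).
Proof.
  induction n as [|n IH].
  - simpl. rewrite Cmult_1_l. ring.
  - rewrite Cpow_S, IH, <- Cpower_plus. f_equal. rewrite (S_INR (S n)), RtoC_plus. ring.
Qed.

Lemma Cpower_derive w a : slit w -> Zdiff (fun v => Cpower v a) w (a * Cpower w (a - 1)).
Proof.
  intros Hw. assert (Hn := slit_nz w Hw).
  apply Cdiff_ext_loc with (fun v => Cexp (a * Clog v)); [tc| | |].
  - symmetry. now apply Cpower_nz.
  - assert (H1 : (0 < Cmod w)%R) by now apply Cmod_gt_0.
    generalize (Clim_idC w _ H1). apply filter_imp. intros v Hv. symmetry. apply Cpower_nz.
    intros E. rewrite E in Hv. replace (0 - w) with (- w) in Hv by ring.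
    rewrite Cmod_opp in Hv. lra.
  - eapply Cdiff_eq; [|apply (Cdiff_comp _ _ w (fun v => a * Clog v) (a * / w) Cexp
      (Cexp (a * Clog w)) (Clim_idC w))].
    + rewrite <- Cpower_nz by exact Hn.
      replace (Cpower w a) with (Cpower w (a - 1) * Cpower w 1).
      * rewrite Cpower_1_r. field. exact Hn.
      * rewrite <- Cpower_plus. f_equal. ring.
    + apply Cdiff_scal; [tc | now apply Clog_derive].
    + apply Cexp_derive.
Qed.

(** The argument is bounded by PI, so the imaginary part of the exponent costs at most a constant
    factor. *)
Lemma Cmod_Cpower_le w a W : (0 <= Re a)%R -> (1 <= W)%R -> (Cmod w <= W)%R ->
  (Cmod (Cpower w a) <= exp (Re a * ln W + Rabs (Im a) * PI))%R.
Proof.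
  intros Ha HW Hw. destruct (Ceq_dec w 0) as [->|N].
  { rewrite Cpower_0, Cmod_0. apply Rlt_le, exp_pos. }
  rewrite Cpower_nz, Cmod_Cexp, re_mult by exact N.
  assert (P : (0 < Cmod w)%R) by now apply Cmod_gt_0.
  assert (L : (ln (Cmod w) <= ln W)%R) by (apply ln_le; lra).
  assert (HB := Carg_bound w N).
  assert (HI : (- (Im a * Carg w) <= Rabs (Im a) * PI)%R).
  { eapply Rle_trans; [apply Rle_abs|]. rewrite Rabs_Ropp, Rabs_mult.
    apply Rmult_le_compat_l; [apply Rabs_pos|]. apply Rabs_le. lra. }
  assert (HR : (Re a * ln (Cmod w) <= Re a * ln W)%R) by now apply Rmult_le_compat_l.
  change (Re (Clog w)) with (ln (Cmod w)). change (Im (Clog w)) with (Carg w).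
  assert (K : (Re a * ln (Cmod w) - Im a * Carg w <= Re a * ln W + Rabs (Im a) * PI)%R) by lra.
  destruct K as [K|K]; [left; now apply exp_increasing | right; now rewrite K].
Qed.

Lemma Cpower_continuous_0 a : (0 < Re a)%R ->
  Clim (locallyC (RtoC 0)) (fun v => Cpower v a) 0.
Proof.
  intros Ha eps Heps. apply locally_Cmod_iff.
  (* This radius r solves Re a * ln r + |Im a| * PI = ln eps, the left side being a bound for ln
     |w^a| when |w| = r. *)
  exists (exp ((ln eps - Rabs (Im a) * PI) / Re a)). split; [apply exp_pos|].
  intros w Hw. replace (w - 0) with w in Hw by ring.
  replace (Cpower w a - 0) with (Cpower w a) by ring.
  destruct (Ceq_dec w 0) as [->|N].
  { rewrite Cpower_0, Cmod_0. exact Heps. }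
  rewrite Cpower_nz, Cmod_Cexp, re_mult by exact N.
  assert (P : (0 < Cmod w)%R) by now apply Cmod_gt_0.
  assert (L : (ln (Cmod w) < (ln eps - Rabs (Im a) * PI) / Re a)%R).
  { rewrite <- (ln_exp ((ln eps - Rabs (Im a) * PI) / Re a)). now apply ln_increasing. }
  assert (HB := Carg_bound w N).
  assert (HI : (- (Im a * Carg w) <= Rabs (Im a) * PI)%R).
  { eapply Rle_trans; [apply Rle_abs|]. rewrite Rabs_Ropp, Rabs_mult.
    apply Rmult_le_compat_l; [apply Rabs_pos|]. apply Rabs_le. lra. }
  rewrite <- (exp_ln eps) by exact Heps. apply exp_increasing.
  change (Re (Clog w)) with (ln (Cmod w)). change (Im (Clog w)) with (Carg w).
  apply (Rmult_lt_compat_l (Re a)) in L; [|exact Ha].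
  replace (Re a * ((ln eps - Rabs (Im a) * PI) / Re a))%R
    with (ln eps - Rabs (Im a) * PI)%R in L by (field; lra).
  lra.
Qed.

Lemma Cpower_continuous w a : (0 < Re a)%R -> slit w \/ w = 0 ->
  Clim (locallyC w) (fun v => Cpower v a) (Cpower w a).
Proof.
  intros Ha [Hw| ->].
  - apply (Cdiff_continuous _ (fun v : C => v) w (fun v => Cpower v a) (a * Cpower w (a - 1)));
      [apply Clim_idC | now apply Cpower_derive].
  - rewrite Cpower_0. now apply Cpower_continuous_0.
Qed.

Lemma Clim_comp_continuous {T} (F : (T -> Prop) -> Prop) {FF : Filter F}
    (g : T -> C) (h : C -> C) (l : C) :
  Clim F g l -> Clim (locallyC l) h (h l) ->
  Clim F (fun t => h (g t)) (h l).
Proof.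
  intros Hg Hh eps Heps. generalize (Hh eps Heps). intros H. apply locally_Cmod_iff in H.
  destruct H as (d & Hd & H). generalize (Hg d Hd). apply filter_imp. intros t. apply H.
Qed.

(** * Integrals along paths and moments of a loop *)

Notation is_CRInt := (@is_RInt C_R_NormedModule).

Lemma is_CRInt_pair (f : R -> C) a b (l : C) :
  is_RInt (fun s => Re (f s)) a b (Re l) -> is_RInt (fun s => Im (f s)) a b (Im l) ->
  is_CRInt f a b l.
Proof.
  intros H1 H2. destruct l as [u v].
  apply (is_RInt_fct_extend_pair (U := R_NormedModule) (V := R_NormedModule)); assumption.
Qed.

Lemma is_CRInt_re (f : R -> C) a b (l : C) :
  is_CRInt f a b l -> is_RInt (fun s => Re (f s)) a b (Re l).
Proof. apply (is_RInt_fct_extend_fst (U := R_NormedModule) (V := R_NormedModule)). Qed.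

Lemma is_CRInt_im (f : R -> C) a b (l : C) :
  is_CRInt f a b l -> is_RInt (fun s => Im (f s)) a b (Im l).
Proof. apply (is_RInt_fct_extend_snd (U := R_NormedModule) (V := R_NormedModule)). Qed.

Lemma is_CRInt_scal (c : C) (f : R -> C) a b (l : C) :
  is_CRInt f a b l -> is_CRInt (fun s => c * f s) a b (c * l).
Proof.
  intros H. assert (H1 := is_CRInt_re _ _ _ _ H). assert (H2 := is_CRInt_im _ _ _ _ H).
  apply is_CRInt_pair.
  - rewrite re_mult. apply (is_RInt_ext (fun s => Re c * Re (f s) - Im c * Im (f s))%R).
    { intros. now rewrite re_mult. }
    apply (is_RInt_minus (V := R_NormedModule) (fun s => Re c * Re (f s))%R
      (fun s => Im c * Im (f s))%R); now apply (is_RInt_scal (V := R_NormedModule)).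
  - rewrite im_mult. apply (is_RInt_ext (fun s => Re c * Im (f s) + Im c * Re (f s))%R).
    { intros. now rewrite im_mult. }
    apply (is_RInt_plus (V := R_NormedModule) (fun s => Re c * Im (f s))%R
      (fun s => Im c * Re (f s))%R); now apply (is_RInt_scal (V := R_NormedModule)).
Qed.

Lemma is_CRInt_plus (f g : R -> C) a b (l m : C) :
  is_CRInt f a b l -> is_CRInt g a b m -> is_CRInt (fun s => f s + g s) a b (l + m).
Proof. apply (is_RInt_plus (V := C_R_NormedModule)). Qed.

Lemma is_CRInt_minus (f g : R -> C) a b (l m : C) :
  is_CRInt f a b l -> is_CRInt g a b m -> is_CRInt (fun s => f s - g s) a b (l - m).
Proof. apply (is_RInt_minus (V := C_R_NormedModule)). Qed.

Lemma is_CRInt_csum (f : nat -> R -> C) a b (l : nat -> C) n :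
  (forall k, (k < n)%nat -> is_CRInt (f k) a b (l k)) ->
  is_CRInt (fun s => csum (fun k => f k s) n) a b (csum l n).
Proof.
  induction n as [|n IH]; intros H; simpl.
  - assert (E0 : scal (V := C_R_NormedModule) (b - a)%R (RtoC 0) = RtoC 0).
    { rewrite scal_R_Cmult. apply Cmult_0_r. }
    refine (eq_ind _ (is_CRInt (fun _ => RtoC 0) a b) _ _ E0).
    apply (is_RInt_const (V := C_R_NormedModule) a b (RtoC 0)).
  - apply is_CRInt_plus; [apply IH; auto with arith | apply H; auto with arith].
Qed.

Lemma is_CRInt_correct (f : R -> C) a b : ex_CRInt f a b -> is_CRInt f a b (CRInt f a b).
Proof. apply (RInt_correct (V := C_R_CompleteNormedModule)). Qed.

Lemma is_CRInt_Cmod_le (f : R -> C) a b (l : C) M : (a <= b)%R ->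
  (forall s, (a <= s <= b)%R -> (Cmod (f s) <= M)%R) -> is_CRInt f a b l ->
  (Cmod l <= (b - a) * M)%R.
Proof.
  intros Hab H Hl. rewrite Cmod_norm.
  apply (norm_RInt_le_const (V := C_R_NormedModule) f a b l M Hab); [|exact Hl].
  intros s Hs. apply C_R_norm_le. now apply H.
Qed.

Lemma is_CRInt_ext (f g : R -> C) a b (l : C) : (a <= b)%R ->
  (forall s, (a < s < b)%R -> f s = g s) -> is_CRInt f a b l -> is_CRInt g a b l.
Proof.
  intros Hab H. apply (is_RInt_ext (V := C_R_NormedModule)).
  rewrite Rmin_left, Rmax_right by exact Hab. exact H.
Qed.

(** Existence, bounds and values of path integrals combine over adjacent intervals, so each has to
    be proved only on the pieces where the path is C^1. *)
Lemma piecewise_C1_ind (g : R -> C) (P : R -> R -> Prop) : piecewise_C1 g ->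
  (forall a, P a a) ->
  (forall a b c, (a <= b <= c)%R -> P a b -> P b c -> P a c) ->
  (forall a b, (0 <= a < b)%R -> (b <= 1)%R -> C1_on g a b -> P a b) -> P 0%R 1%R.
Proof.
  intros (_ & n & sg & H0 & H1 & H) Pr Pt Pp.
  assert (M : forall i j, (i <= j)%nat -> (j <= n)%nat -> (sg i <= sg j)%R).
  { intros i j Hij. induction Hij as [|j Hij IH]; intros Hj; [lra|].
    generalize (IH ltac:(lia)) (proj1 (H j ltac:(lia))). lra. }
  rewrite <- H1. assert (A : forall i, (i <= n)%nat -> P 0%R (sg i)).
  { induction i as [|i IH]; intros Hi.
    - rewrite H0. apply Pr.
    - destruct (H i ltac:(lia)) as [Hs HC].
      assert (L0 := M 0%nat i ltac:(lia) ltac:(lia)).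
      assert (L1 := M (S i) n ltac:(lia) ltac:(lia)). rewrite H0 in L0. rewrite H1 in L1.
      apply Pt with (sg i); [lra | apply IH; lia |].
      apply Pp; [lra | lra | exact HC]. }
  apply A. lia.
Qed.

Lemma C1_on_path_derive g a b : C1_on g a b ->
  exists dg, Ccont_on a b dg /\ (forall s, (a < s < b)%R -> Rdiff g s (dg s)) /\
    (forall s, (a < s < b)%R -> path_derive g s = dg s).
Proof.
  intros (dg & Hc & Hd). exists dg. split; [now apply Ccont_on_iff|].
  assert (Hd' : forall s, (a < s < b)%R -> Rdiff g s (dg s)).
  { intros s Hs. apply Rdiff_is_derive. now apply Hd. }
  split; [exact Hd'|]. intros s Hs. apply C_eq.
  - exact (is_derive_unique _ _ _ (Rdiff_re _ _ _ (Hd' s Hs))).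
  - exact (is_derive_unique _ _ _ (Rdiff_im _ _ _ (Hd' s Hs))).
Qed.

Lemma piecewise_C1_cont g : piecewise_C1 g -> Ccont_on 0 1 g.
Proof. intros [H _]. now apply Ccont_on_iff. Qed.

Lemma path_derive_bounded g : piecewise_C1 g ->
  exists B : R, (0 < B)%R /\ forall s, (0 <= s <= 1)%R -> (Cmod (path_derive g s) <= B)%R.
Proof.
  intros Hg. apply (piecewise_C1_ind g (fun a b => exists B : R, (0 < B)%R /\
    forall s, (a <= s <= b)%R -> (Cmod (path_derive g s) <= B)%R) Hg).
  - intros a. exists (Cmod (path_derive g a) + 1)%R.
    split; [generalize (Cmod_ge_0 (path_derive g a)); lra|].
    intros s Hs. replace s with a by lra. lra.
  - intros a b c _ (B1 & P1 & H1) (B2 & P2 & H2). exists (B1 + B2)%R. split; [lra|].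
    intros s Hs. destruct (Rle_dec s b).
    + generalize (H1 s ltac:(lra)). lra.
    + generalize (H2 s ltac:(lra)). lra.
  - intros a b Hab _ HC. destruct (C1_on_path_derive g a b HC) as (dg & Hc & _ & E).
    destruct (Ccont_on_bounded a b dg ltac:(lra) Hc) as (B & PB & HB).
    (* At the ends of a piece [path_derive] takes uncontrolled values; their moduli are simply added
       to the bound. *)
    exists (B + Cmod (path_derive g a) + Cmod (path_derive g b))%R.
    assert (Pa := Cmod_ge_0 (path_derive g a)). assert (Pb := Cmod_ge_0 (path_derive g b)).
    split; [lra|]. intros s Hs.
    destruct (Req_dec s a) as [->|Na]; [lra|]. destruct (Req_dec s b) as [->|Nb]; [lra|].
    rewrite E by lra. generalize (HB s Hs). lra.
Qed.

Lemma path_integrand_ex h g : piecewise_C1 g -> Ccont_on 0 1 (fun s => h (g s)) ->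
  ex_CRInt (path_integrand h g) 0 1.
Proof.
  intros Hg Hh. apply (piecewise_C1_ind g (fun a b => ex_CRInt (path_integrand h g) a b) Hg).
  - intros a. apply (ex_RInt_point (V := C_R_NormedModule)).
  - intros a b c _. apply (ex_RInt_Chasles (V := C_R_NormedModule)).
  - intros a b Hab Hb HC. destruct (C1_on_path_derive g a b HC) as (dg & Hc & _ & E).
    apply (ex_RInt_ext (V := C_R_NormedModule)) with (fun s => h (g s) * dg s).
    + rewrite Rmin_left, Rmax_right by lra. intros s Hs. unfold path_integrand.
      now rewrite E.
    + apply Ccont_on_ex_RInt; [lra|]. apply Ccont_on_mult; [|exact Hc].
      apply Ccont_on_sub with (3 := Hh); lra.
Qed.

(** At the endpoints of the path, where the loops meet the branch point, continuity of the primitive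
    is enough. *)
Lemma path_FTC H h g : piecewise_C1 g ->
  Ccont_on 0 1 (fun s => H (g s)) -> Ccont_on 0 1 (fun s => h (g s)) ->
  (forall s, (0 < s < 1)%R -> Zdiff H (g s) (h (g s))) ->
  is_CRInt (path_integrand h g) 0 1 (H (g 1%R) - H (g 0%R)).
Proof.
  intros Hg HH Hh HD.
  apply (piecewise_C1_ind g (fun a b => is_CRInt (path_integrand h g) a b (H (g b) - H (g a))) Hg).
  - intros a. replace (H (g a) - H (g a)) with (RtoC 0) by ring.
    apply (is_RInt_point (V := C_R_NormedModule)).
  - intros a b c _ H1 H2.
    replace (H (g c) - H (g a)) with ((H (g b) - H (g a)) + (H (g c) - H (g b))) by ring.
    apply (is_RInt_Chasles (V := C_R_NormedModule)) with b; assumption.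
  - intros a b Hab Hb HC. destruct (C1_on_path_derive g a b HC) as (dg & Hc & Hd & E).
    apply is_CRInt_ext with (fun s => h (g s) * dg s); [lra| |].
    + intros s Hs. unfold path_integrand. now rewrite E.
    + apply (CFTC a b (fun s => H (g s)) (fun s => h (g s) * dg s)); [lra| | |].
      * apply Ccont_on_sub with (3 := HH); lra.
      * apply Ccont_on_mult; [|exact Hc]. apply Ccont_on_sub with (3 := Hh); lra.
      * intros s Hs. apply Cdiff_comp; [tc | apply Clim_RtoC | now apply Hd |].
        apply HD. lra.
Qed.

Section Loop.
Context (g : R -> C) (Hloop : loop_1_0plus g).

Let Hg : piecewise_C1 g := proj1 Hloop.

Lemma loop_start : g 0%R = 1. Proof. apply Hloop. Qed.
Lemma loop_end : g 1%R = 1. Proof. apply Hloop. Qed.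

Lemma loop_cont : Ccont_on 0 1 g.
Proof. apply piecewise_C1_cont, Hg. Qed.

Lemma loop_off (s : R) : (0 < s < 1)%R -> ~ (Im (g s) = 0%R /\ (0 <= Re (g s))%R).
Proof. apply Hloop. Qed.

Lemma loop_nz (s : R) : (0 <= s <= 1)%R -> g s <> 0.
Proof.
  intros Hs E. destruct (Req_dec s 0) as [->|N0].
  { rewrite loop_start in E. now apply C1_nz. }
  destruct (Req_dec s 1) as [->|N1].
  { rewrite loop_end in E. now apply C1_nz. }
  apply (loop_off s); [lra|]. rewrite E. simpl. split; [reflexivity | lra].
Qed.

(** If 1 - l / t were a real w <= 0, then t = l / (1 - w) would be a nonnegative real. *)
Lemma slit_of_off (t : C) (l : R) : ~ (Im t = 0%R /\ (0 <= Re t)%R) -> (0 <= l)%R ->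
  slit (1 - l * / t).
Proof.
  intros Ht Hl [HI HR].
  assert (Hn : t <> 0).
  { intros E. apply Ht. rewrite E. simpl. split; [reflexivity | lra]. }
  set (w := 1 - l * / t) in *.
  assert (Ew : w = RtoC (Re w)) by (apply C_eq; [reflexivity | exact HI]).
  assert (Et : t = RtoC (l / (1 - Re w))).
  { assert (E : t * (1 - w) = l) by (unfold w; field; exact Hn).
    rewrite Ew, <- RtoC_minus in E.
    assert (Hp : RtoC (1 - Re w) <> 0) by (intros E'; apply RtoC_inj in E'; lra).
    rewrite RtoC_div by lra. rewrite <- E. field. exact Hp. }
  apply Ht. rewrite Et, re_RtoC, im_RtoC. split; [reflexivity|].
  apply Rmult_le_pos; [exact Hl|]. apply Rlt_le, Rinv_0_lt_compat. lra.
Qed.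

Lemma loop_slit (s l : R) : (0 <= s <= 1)%R -> (0 <= l <= 1)%R ->
  ((0 < s < 1)%R \/ (l < 1)%R) -> slit (1 - l * / g s).
Proof.
  intros Hs Hl Hsl.
  destruct (Req_dec s 0) as [->|N0]; [|destruct (Req_dec s 1) as [->|N1]].
  3:{ apply slit_of_off; [apply loop_off; lra | lra]. }
  1: rewrite loop_start. 2: rewrite loop_end.
  all: intros [_ H]; replace (1 - l * / 1) with (RtoC (1 - l)) in H
    by (rewrite RtoC_minus; field); rewrite re_RtoC in H; lra.
Qed.

Lemma loop_slit_or_0 (s l : R) : (0 <= s <= 1)%R -> (0 <= l <= 1)%R ->
  slit (1 - l * / g s) \/ 1 - l * / g s = 0.
Proof.
  intros Hs Hl. destruct (Req_dec l 1) as [->|N].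
  2:{ left. apply loop_slit; lra. }
  destruct (Req_dec s 0) as [->|N0].
  { right. rewrite loop_start. field. }
  destruct (Req_dec s 1) as [->|N1].
  { right. rewrite loop_end. field. }
  left. apply loop_slit; lra.
Qed.

Lemma loop_inv_cont : Ccont_on 0 1 (fun s => / g s).
Proof. apply Ccont_on_inv; [apply loop_nz | apply loop_cont]. Qed.

Lemma loop_base_cont (l : R) : Ccont_on 0 1 (fun s => 1 - l * / g s).
Proof.
  apply Ccont_on_minus; [apply Ccont_on_const|].
  apply Ccont_on_mult; [apply Ccont_on_const | apply loop_inv_cont].
Qed.

(** Positivity of Re e gives continuity at the two ends of the loop when l = 1, where the base
    vanishes. *)
Lemma loop_Cpower_cont (l : R) (e : C) : (0 <= l <= 1)%R -> (0 < Re e)%R ->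
  Ccont_on 0 1 (fun s => Cpower (1 - l * / g s) e).
Proof.
  intros Hl He s Hs.
  apply (Clim_comp_continuous _ (fun s => 1 - l * / g s) (fun v => Cpower v e)).
  - now apply loop_base_cont.
  - apply Cpower_continuous; [exact He|]. now apply loop_slit_or_0.
Qed.

Lemma Cpower_inv_derive (t e : C) (l : R) : t <> 0 -> slit (1 - l * / t) ->
  Zdiff (fun t => Cpower (1 - l * / t) e) t
    (e * l * Cpower (1 - l * / t) (e - 1) * (/ t * / t)).
Proof.
  intros Ht Hs.
  assert (HD : Zdiff (fun t => 1 - l * / t) t (l * (/ t * / t))).
  { eapply Cdiff_eq; [|apply Cdiff_minus; [tc | apply Cdiff_const; tc|];
      apply Cdiff_scal; [tc|];
      apply (Cdiff_inv _ (fun v : C => v) t (fun v => v) 1 (Clim_idC t) Ht);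
      apply Cdiff_id; tc].
    field. exact Ht. }
  eapply Cdiff_eq; [|apply (Cdiff_comp _ (fun v : C => v) t (fun t => 1 - l * / t) _
    (fun v => Cpower v e) _ (Clim_idC t) HD (Cpower_derive _ e Hs))].
  ring.
Qed.

Definition loop_moment (q : nat) (e : C) : C :=
  path_int (fun t => (1 - t) ^ q * Cpower (1 - / t) e * / t) g.

Lemma loop_pow_cont (q : nat) : Ccont_on 0 1 (fun s => (1 - g s) ^ q).
Proof.
  apply Ccont_on_pow, Ccont_on_minus; [apply Ccont_on_const | apply loop_cont].
Qed.

Lemma loop_Cpower_cont_1 (e : C) : (0 < Re e)%R ->
  Ccont_on 0 1 (fun s => Cpower (1 - / g s) e).
Proof.
  intros He. apply Ccont_on_ext with (fun s => Cpower (1 - 1 * / g s) e).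
  - intros s _. now rewrite Cmult_1_l.
  - apply loop_Cpower_cont; [lra | exact He].
Qed.

Lemma loop_moment_correct (q : nat) (e : C) : (0 < Re e)%R ->
  is_CRInt (path_integrand (fun t => (1 - t) ^ q * Cpower (1 - / t) e * / t) g) 0 1
    (loop_moment q e).
Proof.
  intros He. apply is_CRInt_correct, path_integrand_ex; [exact Hg|].
  apply Ccont_on_mult; [apply Ccont_on_mult|].
  - apply loop_pow_cont.
  - now apply loop_Cpower_cont_1.
  - apply loop_inv_cont.
Qed.

(** The exact derivative is that of (1-t)^(q+1) (1-1/t)^e, rewritten with 1 - t = - t (1 - 1/t); the
    boundary terms cancel because the loop is closed. *)
Lemma loop_moment_S (q : nat) (e : C) : (0 < Re e)%R ->
  INR (S q) * loop_moment (S q) e = (INR (S q) + e) * loop_moment q e.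
Proof.
  intros He.
  assert (HF := path_FTC (fun t => (1 - t) ^ S q * Cpower (1 - / t) e)
    (fun t => INR (S q) * ((1 - t) ^ S q * Cpower (1 - / t) e * / t)
      - (INR (S q) + e) * ((1 - t) ^ q * Cpower (1 - / t) e * / t)) g Hg).
  assert (HL : is_CRInt (path_integrand (fun t => INR (S q) * ((1 - t) ^ S q * Cpower (1 - / t) e * / t)
      - (INR (S q) + e) * ((1 - t) ^ q * Cpower (1 - / t) e * / t)) g) 0 1
      (INR (S q) * loop_moment (S q) e - (INR (S q) + e) * loop_moment q e)).
  { eapply is_CRInt_ext; [lra| |apply is_CRInt_minus;
      apply is_CRInt_scal; apply loop_moment_correct; exact He].
    intros s _. unfold path_integrand. cbv beta. ring. }
  apply Ceq_minus. rewrite <- (RInt_to_C _ _ _ _ HL).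
  transitivity ((1 - g 1%R) ^ S q * Cpower (1 - / g 1%R) e
    - (1 - g 0%R) ^ S q * Cpower (1 - / g 0%R) e).
  2:{ rewrite loop_start, loop_end. ring. }
  apply RInt_to_C. apply HF.
  - apply Ccont_on_mult; [apply loop_pow_cont | now apply loop_Cpower_cont_1].
  - apply Ccont_on_minus; (apply Ccont_on_mult; [apply Ccont_on_const|]);
      (apply Ccont_on_mult; [apply Ccont_on_mult|]);
      auto using loop_pow_cont, loop_Cpower_cont_1, loop_inv_cont.
  - intros s Hs. assert (Hn := loop_nz s ltac:(lra)).
    assert (HS := loop_slit s 1 ltac:(lra) ltac:(lra) (or_introl Hs)).
    set (t := g s) in *.
    assert (HP := Cpower_inv_derive t e 1 Hn HS).
    rewrite Cmult_1_l in HP.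
    eapply Cdiff_eq; [|apply Cdiff_mult; [tc | apply Clim_idC | |]].
    2:{ apply Cdiff_pow; [tc | apply Clim_idC |].
        apply Cdiff_minus; [tc | apply Cdiff_const; tc
          | apply Cdiff_id; tc]. }
    2:{ apply Cdiff_ext with (fun t => Cpower (1 - 1 * / t) e); [tc| |exact HP].
        intros v. now rewrite Cmult_1_l. }
    cbv beta. simpl pred.
    assert (E : Cpower (1 - / t) e = Cpower (1 - / t) (e - 1) * (1 - / t)).
    { rewrite <- (Cpower_1_r (1 - / t)) at 3. rewrite <- Cpower_plus. f_equal. ring. }
    rewrite E, Cpow_S. field. exact Hn.
Qed.

(** The two integrands differ by - (1-1/t)^e / t^2, which is exact. Applied twice, the lemma raises
    Re e above 2, the range of the homotopy estimate. *)
Lemma loop_moment_shift (e : C) : (0 < Re e)%R -> loop_moment 0 (e + 1) = loop_moment 0 e.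
Proof.
  intros He.
  assert (He1 : (0 < Re (e + 1))%R) by (rewrite re_plus, re_RtoC; lra).
  assert (Hne : e + 1 <> 0) by (intros E; rewrite E in He1; simpl in He1; lra).
  assert (HF := path_FTC (fun t => - / (e + 1) * Cpower (1 - / t) (e + 1))
    (fun t => (1 - t) ^ 0 * Cpower (1 - / t) (e + 1) * / t
      - (1 - t) ^ 0 * Cpower (1 - / t) e * / t) g Hg).
  assert (HL : is_CRInt (path_integrand (fun t => (1 - t) ^ 0 * Cpower (1 - / t) (e + 1) * / t
      - (1 - t) ^ 0 * Cpower (1 - / t) e * / t) g) 0 1
      (loop_moment 0 (e + 1) - loop_moment 0 e)).
  { eapply is_CRInt_ext; [lra| |apply is_CRInt_minus; apply loop_moment_correct; assumption].
    intros s _. unfold path_integrand. cbv beta. ring. }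
  apply Ceq_minus. rewrite <- (RInt_to_C _ _ _ _ HL).
  transitivity (- / (e + 1) * Cpower (1 - / g 1%R) (e + 1)
    - - / (e + 1) * Cpower (1 - / g 0%R) (e + 1)).
  2:{ rewrite loop_start, loop_end. ring. }
  apply RInt_to_C. apply HF.
  - apply Ccont_on_mult; [apply Ccont_on_const | now apply loop_Cpower_cont_1].
  - apply Ccont_on_minus; (apply Ccont_on_mult; [apply Ccont_on_mult|]);
      auto using loop_pow_cont, loop_Cpower_cont_1, loop_inv_cont.
  - intros s Hs. assert (Hn := loop_nz s ltac:(lra)).
    assert (HS := loop_slit s 1 ltac:(lra) ltac:(lra) (or_introl Hs)).
    set (t := g s) in *.
    assert (HP := Cpower_inv_derive t (e + 1) 1 Hn HS).
    rewrite Cmult_1_l in HP.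
    eapply Cdiff_eq; [|apply Cdiff_scal; [tc|]].
    2:{ apply Cdiff_ext with (fun t => Cpower (1 - 1 * / t) (e + 1)); [tc| |exact HP].
        intros v. now rewrite Cmult_1_l. }
    replace (e + 1 - 1) with e by ring.
    rewrite Cpower_plus, Cpower_1_r. simpl. field. split; assumption.
Qed.

End Loop.

(* Along a ray the second derivative of [l |-> (1 - l u)^e] is bounded as soon as
   [2 < Re e], uniformly up to the branch point. *)
Lemma Rdiff_Cpower_ray (u e : C) (m : R) : slit (1 - m * u) ->
  Rdiff (fun l : R => Cpower (1 - l * u) e) m (- e * u * Cpower (1 - m * u) (e - 1)).
Proof.
  intros Hs.
  assert (HD : Rdiff (fun l : R => 1 - l * u) m (- u)).
  { apply Cdiff_ext with (fun l : R => 1 - u * l); [tc | intros; ring |].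
    eapply Cdiff_eq; [|apply Cdiff_minus; [tc | apply Cdiff_const; tc|];
      apply Cdiff_scal; [tc|]; apply Cdiff_id; tc].
    ring. }
  eapply Cdiff_eq; [|apply (Cdiff_comp _ RtoC m (fun l : R => 1 - l * u) _
    (fun v => Cpower v e) _ (Clim_RtoC m) HD (Cpower_derive _ e Hs))].
  ring.
Qed.

Lemma Cpower_ray_cont (u e : C) a b : (0 < Re e)%R ->
  (forall m, (a <= m <= b)%R -> slit (1 - m * u) \/ 1 - m * u = 0) ->
  Ccont_on a b (fun m : R => Cpower (1 - m * u) e).
Proof.
  intros He H s Hs.
  apply (Clim_comp_continuous _ (fun m : R => 1 - m * u) (fun v => Cpower v e)).
  - apply (Ccont_on_minus a b (fun _ => RtoC 1) (fun m : R => m * u)); [|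
      apply Ccont_on_mult; [apply Ccont_on_RtoC | apply Ccont_on_const]|exact Hs].
    apply Ccont_on_const.
  - apply Cpower_continuous; [exact He | now apply H].
Qed.

Lemma Cpower_ray_bound (e : C) (U : R) : (0 <= Re e)%R -> (0 <= U)%R ->
  exists K : R, (0 < K)%R /\ forall (u : C) (m : R), (0 <= m <= 1)%R -> (Cmod u <= U)%R ->
    (Cmod (Cpower (1 - m * u) e) <= K)%R.
Proof.
  intros He HU. exists (exp (Re e * ln (1 + U) + Rabs (Im e) * PI)).
  split; [apply exp_pos|]. intros u m Hm Hu. apply Cmod_Cpower_le; [exact He | lra |].
  eapply Rle_trans; [apply Cmod_triangle|].
  rewrite Cmod_1, Cmod_opp, Cmod_mult, Cmod_R, Rabs_pos_eq by lra.
  apply Rplus_le_compat_l. rewrite <- (Rmult_1_l U).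
  apply Rmult_le_compat; [lra | apply Cmod_ge_0 | lra | exact Hu].
Qed.

(** Two successive mean value inequalities, for the first derivative and then for the remainder. [K]
    depends only on [e] and on the bound [U], so one constant serves the whole loop. *)
Lemma Cpower_ray_taylor (e : C) (U : R) : (2 < Re e)%R -> (0 <= U)%R ->
  exists K : R, (0 < K)%R /\ forall (u : C) (l m : R), (0 <= l <= m)%R -> (m <= 1)%R ->
    (Cmod u <= U)%R ->
    (forall k, (0 <= k <= 1)%R -> slit (1 - k * u) \/ 1 - k * u = 0) ->
    (forall k, (0 <= k < 1)%R -> slit (1 - k * u)) ->
    (Cmod (Cpower (1 - m * u) e - Cpower (1 - l * u) e
      - (m - l)%R * (- e * u * Cpower (1 - l * u) (e - 1))) <= K * (m - l) * (m - l))%R.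
Proof.
  intros He HU.
  assert (R1 : Re (e - 1) = (Re e - 1)%R) by (unfold Cminus; now rewrite re_plus, re_opp, re_RtoC).
  assert (R2 : Re (e - 1 - 1) = (Re e - 2)%R).
  { unfold Cminus. rewrite !re_plus, re_opp, re_RtoC. lra. }
  destruct (Cpower_ray_bound (e - 1 - 1) U ltac:(lra) HU) as (K0 & PK0 & HK0).
  set (K := (Cmod e * U * (Cmod (e - 1) * U * K0))%R).
  assert (HK : (0 <= K)%R) by (unfold K; repeat apply Rmult_le_pos; auto using Cmod_ge_0; lra).
  exists (K + 1)%R. split; [lra|]. intros u l m Hl Hm Hu H1 H2.
  set (d1 := fun k : R => - e * u * Cpower (1 - k * u) (e - 1)).
  assert (L1 : forall k, (l <= k <= m)%R -> (Cmod (d1 k - d1 l) <= K * (m - l))%R).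
  { intros k Hk. apply Rle_trans with (K * (k - l))%R; [|apply Rmult_le_compat_l; lra].
    apply (Rdiff_lipschitz l k d1
      (fun s => - e * u * (- (e - 1) * u * Cpower (1 - s * u) (e - 1 - 1)))); [lra| | |].
    - apply Ccont_on_mult; [apply Ccont_on_const|].
      apply Cpower_ray_cont; [lra|]. intros s Hs. apply H1. lra.
    - intros s Hs. apply Cdiff_scal; [tc|].
      apply Rdiff_Cpower_ray. apply H2. lra.
    - intros s Hs. rewrite !Cmod_mult, !Cmod_opp. unfold K.
      assert (Hp := HK0 u s ltac:(lra) Hu).
      repeat (apply Rmult_le_compat; auto using Cmod_ge_0, Rmult_le_pos, Rle_refl). }
  set (d0 := fun k : R => Cpower (1 - k * u) e - k * d1 l).
  replace (Cpower (1 - m * u) e - Cpower (1 - l * u) e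
      - (m - l)%R * (- e * u * Cpower (1 - l * u) (e - 1))) with (d0 m - d0 l).
  2:{ unfold d0, d1. rewrite RtoC_minus. ring. }
  apply Rle_trans with (K * (m - l) * (m - l))%R.
  2:{ apply Rmult_le_compat_r; [lra|]. apply Rmult_le_compat_r; lra. }
  apply (Rdiff_lipschitz l m d0 (fun s => d1 s - d1 l)); [lra| | |].
  - apply Ccont_on_minus.
    + apply Cpower_ray_cont; [lra|]. intros s Hs. apply H1. lra.
    + apply Ccont_on_mult; [apply Ccont_on_RtoC | apply Ccont_on_const].
  - intros s Hs. apply Cdiff_minus; [tc| |].
    + apply Rdiff_Cpower_ray. apply H2. lra.
    + apply Cdiff_ext with (fun k : R => d1 l * k); [tc | intros; ring |].
      eapply Cdiff_eq; [|apply Cdiff_scal; [tc|];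
        apply Cdiff_id; tc].
      ring.
  - intros s Hs. apply L1. lra.
Qed.

Section Loop.
Context (g : R -> C) (Hloop : loop_1_0plus g).

Let Hg : piecewise_C1 g := proj1 Hloop.

(* The moments do not change when the branch point slides from [t = l] to [t = m],
   up to second order in [m - l]. *)
Lemma loop_homotopy_step (e : C) : (2 < Re e)%R ->
  exists K : R, (0 < K)%R /\ forall l m : R, (0 <= l <= m)%R -> (m <= 1)%R -> (l < 1)%R ->
    (Cmod (path_int (fun t => Cpower (1 - m * / t) e * / t) g
       - path_int (fun t => Cpower (1 - l * / t) e * / t) g)%C <= K * (m - l) * (m - l))%R.
Proof.
  intros He.
  destruct (Ccont_on_bounded 0 1 _ ltac:(lra) (loop_inv_cont g Hloop)) as (U & PU & HU).
  destruct (path_derive_bounded g Hg) as (B & PB & HB).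
  destruct (Cpower_ray_taylor e U He ltac:(lra)) as (K & PK & HK).
  exists (K * U * B)%R. split; [repeat apply Rmult_lt_0_compat; assumption|].
  intros l m Hl Hm Hl1.
  assert (R1 : Re (e - 1) = (Re e - 1)%R) by (unfold Cminus; now rewrite re_plus, re_opp, re_RtoC).
  assert (C1 : forall k : R, (0 <= k <= 1)%R -> is_CRInt
    (path_integrand (fun t => Cpower (1 - k * / t) e * / t) g) 0 1
    (path_int (fun t => Cpower (1 - k * / t) e * / t) g)).
  { intros k Hk. apply is_CRInt_correct, path_integrand_ex; [exact Hg|].
    apply Ccont_on_mult; [apply loop_Cpower_cont; auto; lra | now apply loop_inv_cont]. }
  (* The term of first order in m - l is exact: its primitive is - (1/l) (1 - l/t)^e, or e / t when
     l = 0. *)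
  assert (C2 : is_CRInt (path_integrand
    (fun t => (- e * / t * Cpower (1 - l * / t) (e - 1)) * / t) g) 0 1 (RtoC 0)).
  { assert (Cc : Ccont_on 0 1 (fun s => - e * / g s * Cpower (1 - l * / g s) (e - 1) * / g s)).
    { repeat apply Ccont_on_mult; try apply Ccont_on_const; try now apply loop_inv_cont.
      apply loop_Cpower_cont; auto; lra. }
    destruct (Req_dec l 0) as [->|Nl].
    - replace (RtoC 0) with (e * / g 1%R - e * / g 0%R) at 1.
      2:{ rewrite (loop_start g Hloop), (loop_end g Hloop). ring. }
      apply (path_FTC (fun t => e * / t)); [exact Hg | | exact Cc |].
      + apply Ccont_on_mult; [apply Ccont_on_const | now apply loop_inv_cont].
      + intros s Hs. assert (Hn := loop_nz g Hloop s ltac:(lra)).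
        eapply Cdiff_eq; [|apply Cdiff_scal; [tc|];
          apply (Cdiff_inv _ (fun v : C => v) (g s) (fun v => v) 1 (Clim_idC (g s)) Hn);
          apply Cdiff_id; tc].
        replace (1 - 0 * / g s) with (RtoC 1) by ring. rewrite Cpower_1_l. field. exact Hn.
    - assert (Hl0 : RtoC l <> 0) by (intros E; apply RtoC_inj in E; lra).
      replace (RtoC 0) with (- / l * Cpower (1 - l * / g 1%R) e - - / l * Cpower (1 - l * / g 0%R) e) at 1.
      2:{ rewrite (loop_start g Hloop), (loop_end g Hloop). ring. }
      apply (path_FTC (fun t => - / l * Cpower (1 - l * / t) e)); [exact Hg | | exact Cc |].
      + apply Ccont_on_mult; [apply Ccont_on_const | apply loop_Cpower_cont; auto; lra].
      + intros s Hs. assert (Hn := loop_nz g Hloop s ltac:(lra)).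
        eapply Cdiff_eq; [|apply Cdiff_scal; [tc|]; apply Cpower_inv_derive;
          [exact Hn | apply (loop_slit g Hloop); lra]].
        field. split; assumption. }
  assert (C3 := is_CRInt_minus _ _ _ _ _ _ (is_CRInt_minus _ _ _ _ _ _ (C1 m ltac:(lra))
    (C1 l ltac:(lra))) (is_CRInt_scal (m - l)%R _ _ _ _ C2)).
  cbv beta in C3.
  replace (path_int (fun t => Cpower (1 - m * / t) e * / t) g
     - path_int (fun t => Cpower (1 - l * / t) e * / t) g) with
    (path_int (fun t => Cpower (1 - m * / t) e * / t) g
     - path_int (fun t => Cpower (1 - l * / t) e * / t) g - (m - l)%R * 0) by ring.
  replace (K * U * B * (m - l) * (m - l))%R with ((1 - 0) * (K * U * B * (m - l) * (m - l)))%R by ring.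
  refine (is_CRInt_Cmod_le _ 0 1 _ _ _ _ C3); [lra|]. intros s Hs.
  unfold path_integrand.
  replace (Cpower (1 - m * / g s) e * / g s * path_derive g s -
      Cpower (1 - l * / g s) e * / g s * path_derive g s -
      (m - l)%R * (- e * / g s * Cpower (1 - l * / g s) (e - 1) * / g s * path_derive g s))
    with ((Cpower (1 - m * / g s) e - Cpower (1 - l * / g s) e
      - (m - l)%R * (- e * / g s * Cpower (1 - l * / g s) (e - 1))) * / g s * path_derive g s)
    by ring.
  rewrite !Cmod_mult.
  replace (K * U * B * (m - l) * (m - l))%R with (K * (m - l) * (m - l) * U * B)%R by ring.
  assert (P1 : (0 <= K * (m - l) * (m - l))%R) by (repeat apply Rmult_le_pos; lra).
  apply Rmult_le_compat; [apply Rmult_le_pos; apply Cmod_ge_0 | apply Cmod_ge_0 | | now apply HB].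
  apply Rmult_le_compat; [apply Cmod_ge_0 | apply Cmod_ge_0 | | now apply HU].
  apply HK; [exact Hl | exact Hm | now apply HU | |].
  - intros k Hk. now apply loop_slit_or_0.
  - intros k Hk. apply (loop_slit g Hloop); lra.
Qed.

(** With [0, 1] cut into N equal steps, N errors of size K / N^2 add up to K / N, so the integrals
    for l = 1 and l = 0 agree. *)
Lemma loop_moment_0_large (e : C) : (2 < Re e)%R -> loop_moment g 0 e = 2 * Ci * PI.
Proof.
  intros He. destruct (loop_homotopy_step e He) as (K & PK & HK).
  set (Phi := fun l : R => path_int (fun t => Cpower (1 - l * / t) e * / t) g).
  assert (E1 : Phi 1%R = loop_moment g 0 e).
  { unfold Phi, loop_moment. f_equal. apply functional_extensionality.
    intros t. rewrite Cmult_1_l. simpl. ring. }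
  assert (E0 : Phi 0%R = 2 * Ci * PI).
  { transitivity (path_int (fun t => / t) g).
    - unfold Phi. f_equal. apply functional_extensionality.
      intros t. rewrite Cmult_0_l. replace (1 - 0) with (RtoC 1) by ring.
      rewrite Cpower_1_l. ring.
    - assert (E := proj2 (proj2 (proj2 (proj2 Hloop)))).
      assert (Hn : 2 * Ci * PI <> 0).
      { apply Cmult_neq_0; [apply Cmult_neq_0|].
        - intros E'. apply RtoC_inj in E'. lra.
        - apply Ci_nz.
        - intros E'. apply RtoC_inj in E'. generalize PI_RGT_0. lra. }
      transitivity (path_int (fun t => / t) g / (2 * Ci * PI) * (2 * Ci * PI)).
      + symmetry. apply Cdiv_mul_cancel, Hn.
      + rewrite E. ring. }
  rewrite <- E1, <- E0. apply Ceq_minus, Cmod_eq_0.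
  apply Rle_antisym; [|apply Cmod_ge_0]. apply le_epsilon. intros eps Heps.
  destruct (nfloor_ex (K / eps)) as [n Hn].
  { apply Rlt_le, Rdiv_lt_0_compat; assumption. }
  set (N := INR (S n)).
  assert (HN : (0 < N)%R) by (apply lt_0_INR; lia).
  assert (A : forall i, (i <= S n)%nat ->
    (Cmod (Phi (INR i / N)%R - Phi 0%R) <= INR i * (K * / N * / N))%R).
  { induction i as [|i IH]; intros Hi.
    - replace (INR 0 / N)%R with 0%R by (simpl; field; lra).
      replace (Phi 0%R - Phi 0%R) with (RtoC 0) by ring. rewrite Cmod_0. simpl. lra.
    - assert (B1 : (INR (S i) <= N)%R) by (apply le_INR; exact Hi).
      assert (B2 := pos_INR i). assert (B3 := S_INR i).
      assert (S1 := HK (INR i / N)%R (INR (S i) / N)%R).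
      assert (D : (INR (S i) / N - INR i / N = / N)%R) by (rewrite B3; field; lra).
      rewrite D in S1.
      assert (Pi : (0 < / N)%R) by now apply Rinv_0_lt_compat.
      assert (Q1 : (INR (S i) / N <= 1)%R) by (apply Rle_div_l; lra).
      assert (Q0 : (0 <= INR i / N)%R) by (apply Rmult_le_pos; lra).
      specialize (S1 ltac:(lra) Q1 ltac:(lra)).
      replace (Phi (INR (S i) / N)%R - Phi 0%R) with
        ((Phi (INR (S i) / N)%R - Phi (INR i / N)%R) + (Phi (INR i / N)%R - Phi 0%R)) by ring.
      eapply Rle_trans; [apply Cmod_triangle|].
      specialize (IH ltac:(lia)).
      replace (INR (S i) * (K * / N * / N))%R
        with (K * / N * / N + INR i * (K * / N * / N))%R by (rewrite B3; ring).
      apply Rplus_le_compat; [exact S1 | exact IH]. }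
  specialize (A (S n) (le_n _)). fold N in A.
  replace (N / N)%R with 1%R in A by (field; lra).
  rewrite Rplus_0_l. eapply Rle_trans; [exact A|].
  replace (N * (K * / N * / N))%R with (K / N)%R by (field; lra).
  apply Rle_div_l; [exact HN|].
  assert (Q : (K / eps < N)%R) by (unfold N; rewrite S_INR; lra).
  apply Rlt_le. apply (Rmult_lt_compat_r eps) in Q; [|exact Heps].
  replace (K / eps * eps)%R with K in Q by (field; lra). lra.
Qed.

Lemma loop_moment_0 (e : C) : (0 < Re e)%R -> loop_moment g 0 e = 2 * Ci * PI.
Proof.
  intros He.
  rewrite <- (loop_moment_shift g Hloop e He).
  assert (R1 : Re (e + 1) = (Re e + 1)%R) by now rewrite re_plus, re_RtoC.
  rewrite <- (loop_moment_shift g Hloop (e + 1)) by lra.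
  apply loop_moment_0_large. rewrite re_plus, R1, re_RtoC. lra.
Qed.

End Loop.

(** * The unit circle as a loop, and termwise integration *)

Definition cis (s : R) : C := (cos s, sin s).

Lemma cis_derive s : Rdiff cis s (Ci * cis s).
Proof.
  apply Rdiff_pair; unfold cis; simpl; auto_derive; trivial; ring.
Qed.

Lemma Cmod_cis s : Cmod (cis s) = 1%R.
Proof.
  unfold Cmod, cis. simpl fst. simpl snd.
  replace (cos s ^ 2 + sin s ^ 2)%R with ((sin s)² + (cos s)²)%R by (unfold Rsqr; ring).
  rewrite sin2_cos2. apply sqrt_1.
Qed.

Lemma cis_nz s : cis s <> 0.
Proof. intros E. generalize (Cmod_cis s). rewrite E, Cmod_0. lra. Qed.

Lemma cis_0 : cis 0 = 1.
Proof. unfold cis. now rewrite cos_0, sin_0. Qed.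

Lemma cis_2PI : cis (2 * PI) = 1.
Proof. unfold cis. now rewrite cos_2PI, sin_2PI. Qed.

(** Bijectivity does not mention any loop, but its proof needs one. *)
Lemma loop_exists : exists g, loop_1_0plus g.
Proof.
  set (g := fun s : R => cis (2 * PI * s)).
  assert (Hd : forall s, Rdiff g s (2 * PI * Ci * g s)).
  { intros s. apply Rdiff_pair; unfold g, cis; simpl; auto_derive; trivial; ring. }
  assert (Hc : forall s, Clim (locally s) g (g s)).
  { intros s. eapply Cdiff_continuous; [tc | apply Clim_RtoC | apply Hd]. }
  assert (Hnz : 2 * PI * Ci <> 0).
  { apply Cmult_neq_0; [apply Cmult_neq_0|apply Ci_nz]; intros E; apply RtoC_inj in E;
      generalize PI_RGT_0; lra. }
  exists g. repeat split.
  - apply Ccont_on_iff, Ccont_on_locally. auto.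
  - exists 1%nat, INR. split; [reflexivity|]. split; [reflexivity|].
    intros i Hi. replace i with 0%nat by lia. split; [simpl; lra|].
    exists (fun s => 2 * PI * Ci * g s). split.
    + apply Ccont_on_iff, Ccont_on_mult; [apply Ccont_on_const|].
      apply Ccont_on_locally. auto.
    + intros s _. apply Rdiff_is_derive, Hd.
  - unfold g. rewrite Rmult_0_r. apply cis_0.
  - unfold g. rewrite Rmult_1_r. apply cis_2PI.
  - intros s Hs [H1 H2]. unfold g, cis in H1, H2. simpl in H1, H2.
    assert (HPI := PI_RGT_0).
    destruct (Rtotal_order (2 * PI * s) PI) as [L|[E|G]].
    + generalize (sin_gt_0 (2 * PI * s)). nra.
    + rewrite E, cos_PI in H2. lra.
    + generalize (sin_lt_0 (2 * PI * s)). nra.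
  - assert (E : path_int (fun t => / t) g = 2 * PI * Ci).
    { apply RInt_to_C. apply is_CRInt_ext with (fun _ => 2 * PI * Ci); [lra| |].
      - intros s _. unfold path_integrand.
        replace (path_derive g s) with (2 * PI * Ci * g s).
        + field. apply cis_nz.
        + symmetry. apply C_eq.
          * exact (is_derive_unique _ _ _ (Rdiff_re _ _ _ (Hd s))).
          * exact (is_derive_unique _ _ _ (Rdiff_im _ _ _ (Hd s))).
      - assert (E0 : scal (V := C_R_NormedModule) (1 - 0)%R (2 * PI * Ci) = 2 * PI * Ci).
        { rewrite scal_R_Cmult, Rminus_0_r. apply Cmult_1_l. }
        refine (eq_ind _ (is_CRInt (fun _ => 2 * PI * Ci) 0 1) _ _ E0).
        apply (is_RInt_const (V := C_R_NormedModule)). }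
    rewrite E. replace (2 * Ci * PI) with (2 * PI * Ci) by ring. field.
    split; [apply Ci_nz|]. intros E'. apply RtoC_inj in E'. generalize PI_RGT_0. lra.
Qed.

(** Weierstrass test. Clamping the variable turns uniform convergence on the segment into uniform
    convergence on the line, the form in which [filterlim_RInt] takes it. *)
Lemma is_CRInt_series (phi : nat -> R -> C) (F : R -> C) (mu : nat -> R) a b : (a <= b)%R ->
  (forall n, ex_CRInt (phi n) a b) ->
  (forall n s, (a <= s <= b)%R -> (Cmod (phi n s) <= mu n)%R) -> ex_series mu ->
  (forall s, (a <= s <= b)%R -> is_Cseries (fun n => phi n s) (F s)) ->
  exists l, is_CRInt F a b l /\ is_Cseries (fun n => CRInt (phi n) a b) l.
Proof.
  intros Hab Hex Hmu [B HB] HF.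
  assert (HP : forall n, is_CRInt (fun s => csum (fun k => phi k (clamp a b s)) n) a b
    (csum (fun k => CRInt (phi k) a b) n)).
  { intros n. apply is_CRInt_csum. intros k _.
    apply is_CRInt_ext with (phi k); [exact Hab| |now apply is_CRInt_correct].
    intros s Hs. rewrite clamp_id by lra. reflexivity. }
  destruct (filterlim_RInt (V := C_R_CompleteNormedModule)
    (fun n s => csum (fun k => phi k (clamp a b s)) n) a b eventually _
    (fun s => F (clamp a b s)) (fun n => csum (fun k => CRInt (phi k) a b) n) HP)
    as (l & Hl & HI).
  - apply filterlim_locally. intros eps.
    destruct (is_lim_seq_spec (rsum mu) B) as [_ L].
    destruct (L (rsum_lim mu B HB) eps) as [N HN]. exists N. intros n Hn s.
    apply (C_NormedModule_mixin_compat1 (F (clamp a b s))).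
    change (Cmod (csum (fun k => phi k (clamp a b s)) n - F (clamp a b s)) < eps)%R.
    rewrite Cmod_minus_sym. assert (Hs := clamp_in a b s Hab).
    eapply Rle_lt_trans; [apply (csum_tail _ mu _ B n (fun k => Hmu k _ Hs) (HF _ Hs) HB)|].
    specialize (HN n Hn). rewrite Rabs_minus_sym in HN.
    eapply Rle_lt_trans; [apply Rle_abs | exact HN].
  - exists l. split.
    + apply is_CRInt_ext with (fun s => F (clamp a b s)); [exact Hab| |exact HI].
      intros s Hs. rewrite clamp_id by lra. reflexivity.
    + apply Clim_filterlim; [tc | exact Hl].
Qed.

(** * Goursat's lemma in polar coordinates and Taylor expansion of entire functions *)

Lemma incr_bounded_sup (u : nat -> R) (M : R) :
  (forall n, (u n <= u (S n))%R) -> (forall n, (u n <= M)%R) ->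
  exists l : R, (forall n, (u n <= l)%R) /\ forall L, (forall n, (u n <= L)%R) -> (l <= L)%R.
Proof.
  intros Hu HM. destruct (ex_finite_lim_seq_incr u M Hu HM) as [l Hl].
  exists l. split.
  - intros n. now apply (is_lim_seq_incr_compare u l Hl Hu).
  - intros L HL. apply (is_lim_seq_le u (fun _ => L) l L HL Hl). apply is_lim_seq_const.
Qed.

Lemma pow2_small (K delta : R) : (0 <= K)%R -> (0 < delta)%R ->
  exists n : nat, (K / 2 ^ n < delta)%R.
Proof.
  intros HK Hd. destruct (nfloor_ex (K / delta)) as [n Hn].
  { apply Rmult_le_pos; [exact HK | apply Rlt_le, Rinv_0_lt_compat, Hd]. }
  exists (S n). assert (H := INR_le_pow2 (S n)). rewrite S_INR in H.
  assert (P : (0 < 2 ^ S n)%R) by (apply pow_lt; lra).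
  apply Rlt_div_l; [exact P|].
  assert (Q : (K / delta < 2 ^ S n)%R) by lra.
  apply (Rmult_lt_compat_l delta) in Q; [|exact Hd].
  replace (delta * (K / delta))%R with K in Q by (field; lra). exact Q.
Qed.

Section RectInduction.
Context (Q : R -> R -> R -> R -> Prop).

(** The first quarter, in a fixed order, on which [Q] fails; the fourth one by default. *)
Let quarter (t : R * R * R * R) : R * R * R * R :=
  let '(a, b, c, d) := t in
  let m := ((a + b) / 2)%R in let n := ((c + d) / 2)%R in
  if excluded_middle_informative (Q a m c n) then
    if excluded_middle_informative (Q m b c n) then
      if excluded_middle_informative (Q a m n d) then (m, b, n, d) else (a, m, n, d)
    else (m, b, c, n)
  else (a, m, c, n).

(** Compactness as induction by bisection: if [Q] failed, nested quarters on which it fails would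
    shrink to a point, near which it is assumed to hold. Besides Goursat's lemma this yields uniform
    continuity on circles, with a degenerate second side. *)
Lemma rect_induction (a b c d : R) :
  (forall a b c d, (a <= b)%R -> (c <= d)%R ->
    Q a ((a + b) / 2)%R c ((c + d) / 2)%R -> Q ((a + b) / 2)%R b c ((c + d) / 2)%R ->
    Q a ((a + b) / 2)%R ((c + d) / 2)%R d -> Q ((a + b) / 2)%R b ((c + d) / 2)%R d ->
    Q a b c d) ->
  (forall p q, (a <= p <= b)%R -> (c <= q <= d)%R ->
    exists delta : R, (0 < delta)%R /\ forall a' b' c' d',
      (a <= a' <= p)%R -> (p <= b' <= b)%R -> (c <= c' <= q)%R -> (q <= d' <= d)%R ->
      (b' - a' < delta)%R -> (d' - c' < delta)%R -> Q a' b' c' d') ->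
  (a <= b)%R -> (c <= d)%R -> Q a b c d.
Proof.
  intros Hsplit Hloc Hab Hcd. destruct (classic (Q a b c d)) as [H|Hneg]; [exact H|exfalso].
  set (t := fun n => Nat.iter n quarter (a, b, c, d)).
  set (A := fun n => fst (fst (fst (t n)))). set (B := fun n => snd (fst (fst (t n)))).
  set (U := fun n => snd (fst (t n))). set (V := fun n => snd (t n)).
  assert (Et : forall n, t n = (A n, B n, U n, V n)).
  { intros n. unfold A, B, U, V. destruct (t n) as [[[? ?] ?] ?]. reflexivity. }
  assert (St : forall n, (A n <= B n)%R -> (U n <= V n)%R -> ~ Q (A n) (B n) (U n) (V n) ->
    ~ Q (A (S n)) (B (S n)) (U (S n)) (V (S n)) /\
    (A n <= A (S n))%R /\ (B (S n) <= B n)%R /\ (U n <= U (S n))%R /\ (V (S n) <= V n)%R /\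
    (B (S n) - A (S n) = (B n - A n) / 2)%R /\ (V (S n) - U (S n) = (V n - U n) / 2)%R).
  { intros n H1 H2 HN. assert (E := Et (S n)).
    change (t (S n)) with (quarter (t n)) in E. rewrite Et in E. unfold quarter in E.
    repeat destruct excluded_middle_informative in E;
      injection E as E1 E2 E3 E4; rewrite <- E1, <- E2, <- E3, <- E4;
      (split; [auto | repeat split; lra]). }
  assert (I : forall n, ~ Q (A n) (B n) (U n) (V n) /\ (A n <= B n)%R /\ (U n <= V n)%R /\
    (B n - A n = (b - a) / 2 ^ n)%R /\ (V n - U n = (d - c) / 2 ^ n)%R).
  { induction n as [|n (IH1 & IH2 & IH3 & IH4 & IH5)].
    - change (~ Q a b c d /\ (a <= b)%R /\ (c <= d)%R /\ (b - a = (b - a) / 2 ^ 0)%R /\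
        (d - c = (d - c) / 2 ^ 0)%R).
      repeat split; auto; simpl; field.
    - destruct (St n IH2 IH3 IH1) as (H1 & H2 & H3 & H4 & H5 & H6 & H7).
      assert (P2 : (2 ^ n <> 0)%R) by (apply pow_nonzero; lra).
      repeat split; [exact H1 | lra | lra | |].
      + rewrite H6, IH4. simpl. field. exact P2.
      + rewrite H7, IH5. simpl. field. exact P2. }
  assert (MA : forall n, (A n <= A (S n) /\ B (S n) <= B n /\ U n <= U (S n) /\ V (S n) <= V n)%R).
  { intros n. destruct (I n) as (H1 & H2 & H3 & _). generalize (St n H2 H3 H1). tauto. }
  assert (MB : forall n m, (A n <= B m)%R /\ (U n <= V m)%R).
  { assert (M1 : forall n k, (A n <= A (k + n)%nat)%R /\ (B (k + n)%nat <= B n)%R /\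
      (U n <= U (k + n)%nat)%R /\ (V (k + n)%nat <= V n)%R).
    { intros n k. induction k as [|k IH]; [simpl; lra|].
      generalize (MA (k + n)%nat). simpl. lra. }
    intros n m. generalize (M1 n m) (M1 m n). rewrite (Nat.add_comm n m).
    generalize (I (m + n)%nat). lra. }
  assert (MA' : forall n, (a <= A n /\ B n <= b /\ c <= U n /\ V n <= d)%R).
  { induction n as [|n IH].
    - change (a <= a /\ b <= b /\ c <= c /\ d <= d)%R. lra.
    - generalize (MA n). lra. }
  (* The coordinates of the limit point are the suprema of the lower ends. *)
  destruct (incr_bounded_sup A b) as (p & Hp & Hp').
  { intros n. apply MA. } { intros n. apply (MB n 0%nat). }
  destruct (incr_bounded_sup U d) as (q & Hq & Hq').
  { intros n. apply MA. } { intros n. apply (MB n 0%nat). }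
  assert (Hp2 : forall n, (p <= B n)%R) by (intros n; apply Hp'; intros k; apply MB).
  assert (Hq2 : forall n, (q <= V n)%R) by (intros n; apply Hq'; intros k; apply MB).
  destruct (Hloc p q) as (delta & Hdelta & HQ).
  { split; [apply (Hp 0%nat) | apply (Hp2 0%nat)]. }
  { split; [apply (Hq 0%nat) | apply (Hq2 0%nat)]. }
  destruct (pow2_small ((b - a) + (d - c)) delta ltac:(lra) Hdelta) as [n Hn].
  assert (P2 : (0 < / 2 ^ n)%R) by (apply Rinv_0_lt_compat, pow_lt; lra).
  destruct (I n) as (HN & _ & _ & E1 & E2). apply HN. apply HQ.
  - split; [apply (MA' n) | apply Hp].
  - split; [apply Hp2 | apply (MA' n)].
  - split; [apply (MA' n) | apply Hq].
  - split; [apply Hq2 | apply (MA' n)].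
  - rewrite E1. unfold Rdiv in *. nra.
  - rewrite E2. unfold Rdiv in *. nra.
Qed.

End RectInduction.

Definition polar (r s : R) : C := RtoC r * cis s.

Lemma Cmod_polar r s : (0 <= r)%R -> Cmod (polar r s) = r.
Proof.
  intros Hr. unfold polar. rewrite Cmod_mult, Cmod_cis, Cmod_R, Rabs_pos_eq by exact Hr. ring.
Qed.

Lemma cis_lipschitz s t : (Cmod (cis s - cis t) <= Rabs (s - t))%R.
Proof.
  assert (H : forall s t, (s <= t)%R -> (Cmod (cis t - cis s) <= t - s)%R).
  { clear. intros s t Hst. rewrite <- (Rmult_1_l (t - s)).
    apply (Rdiff_lipschitz s t cis (fun u => Ci * cis u)); [exact Hst| | |].
    - apply Ccont_on_locally. intros u _.
      eapply Cdiff_continuous; [tc | apply Clim_RtoC | apply cis_derive].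
    - intros; apply cis_derive.
    - intros u _. rewrite Cmod_mult, Cmod_Ci, Cmod_cis. lra. }
  destruct (Rle_dec s t) as [L|L].
  - rewrite Cmod_minus_sym, Rabs_left1 by lra. generalize (H s t L). lra.
  - rewrite Rabs_pos_eq by lra. apply H. lra.
Qed.

Lemma polar_lipschitz r s p q M : (0 <= p <= M)%R ->
  (Cmod (polar r s - polar p q) <= Rabs (r - p) + M * Rabs (s - q))%R.
Proof.
  intros Hp. unfold polar.
  replace (r * cis s - p * cis q) with ((r - p)%R * cis s + p * (cis s - cis q))
    by (rewrite RtoC_minus; ring).
  eapply Rle_trans; [apply Cmod_triangle|].
  rewrite !Cmod_mult, Cmod_cis, !Cmod_R, Rmult_1_r, (Rabs_pos_eq p) by lra.
  apply Rplus_le_compat_l. apply Rmult_le_compat; [lra | apply Cmod_ge_0 | lra | apply cis_lipschitz].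
Qed.

Lemma polar_cont_r s r : Clim (locally r) (fun r => polar r s) (polar r s).
Proof.
  apply Clim_mult; [tc | apply Clim_RtoC | apply Clim_const; tc].
Qed.

Lemma cis_cont s : Clim (locally s) cis (cis s).
Proof.
  eapply Cdiff_continuous; [tc | apply Clim_RtoC | apply cis_derive].
Qed.

Lemma polar_cont_s r s : Clim (locally s) (fun s => polar r s) (polar r s).
Proof. apply Clim_scal; [tc | apply cis_cont]. Qed.

(* The integrals of [F dz] over the four sides of a polar rectangle. *)
Definition side_r (F : C -> C) (s a b : R) : C := CRInt (fun r => F (polar r s) * cis s) a b.
Definition side_s (F : C -> C) (r c d : R) : C :=
  CRInt (fun s => F (polar r s) * (Ci * polar r s)) c d.
Definition polar_boundary (F : C -> C) (a b c d : R) : C :=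
  side_r F c a b + side_s F b c d - side_r F d a b - side_s F a c d.

Section Goursat.
Context (F : C -> C) (r1 r2 : R) (Hr1 : (0 <= r1)%R)
  (HF : forall z, (r1 <= Cmod z <= r2)%R -> exists l, Zdiff F z l).

Lemma goursat_cont z : (r1 <= Cmod z <= r2)%R ->
  Clim (locallyC z) F (F z).
Proof.
  intros Hz. destruct (HF z Hz) as [l Hl].
  exact (Zdiff_continuous F z l Hl).
Qed.

Lemma side_r_correct s a b : (r1 <= a <= b)%R -> (b <= r2)%R ->
  is_CRInt (fun r => F (polar r s) * cis s) a b (side_r F s a b).
Proof.
  intros Ha Hb. apply is_CRInt_correct, Ccont_on_ex_RInt; [lra|].
  apply Ccont_on_mult; [|apply Ccont_on_const]. apply Ccont_on_locally. intros r Hr.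
  apply (Clim_comp_continuous _ (fun r => polar r s) F); [apply polar_cont_r|].
  apply goursat_cont. rewrite Cmod_polar; lra.
Qed.

Lemma side_s_correct r c d : (r1 <= r <= r2)%R -> (c <= d)%R ->
  is_CRInt (fun s => F (polar r s) * (Ci * polar r s)) c d (side_s F r c d).
Proof.
  intros Hr Hc. apply is_CRInt_correct, Ccont_on_ex_RInt; [lra|].
  apply Ccont_on_locally. intros s _.
  apply Clim_mult; [tc | |apply Clim_scal; [tc | apply polar_cont_s]].
  apply (Clim_comp_continuous _ (fun s => polar r s) F); [apply polar_cont_s|].
  apply goursat_cont. rewrite Cmod_polar; lra.
Qed.

Lemma side_r_Chasles s a m b : (r1 <= a <= m)%R -> (m <= b <= r2)%R ->
  side_r F s a b = side_r F s a m + side_r F s m b.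
Proof.
  intros H1 H2. apply RInt_to_C. apply (is_RInt_Chasles (V := C_R_NormedModule)) with m;
    apply side_r_correct; lra.
Qed.

Lemma side_s_Chasles r c m d : (r1 <= r <= r2)%R -> (c <= m <= d)%R ->
  side_s F r c d = side_s F r c m + side_s F r m d.
Proof.
  intros H1 H2. apply RInt_to_C. apply (is_RInt_Chasles (V := C_R_NormedModule)) with m;
    apply side_s_correct; lra.
Qed.

(** For an affine integrand each side is an increment of the primitive u z + v z^2 / 2, so the sum
    around a polar rectangle is zero. *)
Lemma side_r_affine (u v : C) s a b : (a <= b)%R ->
  is_CRInt (fun r => (u + v * polar r s) * cis s) a b
    ((u * polar b s + v / 2 * (polar b s * polar b s))
     - (u * polar a s + v / 2 * (polar a s * polar a s))).
Proof.
  intros Hab.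
  assert (D : forall r, Rdiff (fun r => polar r s) r (cis s)).
  { intros r. apply Cdiff_ext with (fun r : R => cis s * r);
      [tc | intros; unfold polar; ring |].
    eapply Cdiff_eq; [|apply Cdiff_scal; [tc|]; apply Cdiff_id; tc].
    ring. }
  apply (CFTC a b (fun r => u * polar r s + v / 2 * (polar r s * polar r s))
    (fun r => (u + v * polar r s) * cis s) Hab).
  - apply Ccont_on_locally. intros r _. assert (H := polar_cont_r s r).
    apply Clim_plus; [tc| |]; (apply Clim_scal; [tc|]); [exact H|].
    apply Clim_mult; [tc | exact H | exact H].
  - apply Ccont_on_locally. intros r _. assert (H := polar_cont_r s r).
    apply Clim_mult; [tc| |apply Clim_const; tc].
    apply Clim_plus; [tc | apply Clim_const; tc|].
    apply Clim_scal; [tc | exact H].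
  - intros r _. eapply Cdiff_eq; [|apply Cdiff_plus; [tc| |];
      (apply Cdiff_scal; [tc|]); [apply D|];
      apply Cdiff_mult; [tc | apply Clim_RtoC | apply D | apply D]].
    cbv beta. field.
Qed.

Lemma side_s_affine (u v : C) r c d : (c <= d)%R ->
  is_CRInt (fun s => (u + v * polar r s) * (Ci * polar r s)) c d
    ((u * polar r d + v / 2 * (polar r d * polar r d))
     - (u * polar r c + v / 2 * (polar r c * polar r c))).
Proof.
  intros Hcd.
  assert (D : forall s, Rdiff (fun s => polar r s) s (Ci * polar r s)).
  { intros s. eapply Cdiff_eq; [|apply Cdiff_scal; [tc | apply cis_derive]].
    unfold polar. ring. }
  apply (CFTC c d (fun s => u * polar r s + v / 2 * (polar r s * polar r s))
    (fun s => (u + v * polar r s) * (Ci * polar r s)) Hcd).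
  - apply Ccont_on_locally. intros s _. assert (H := polar_cont_s r s).
    apply Clim_plus; [tc| |]; (apply Clim_scal; [tc|]); [exact H|].
    apply Clim_mult; [tc | exact H | exact H].
  - apply Ccont_on_locally. intros s _. assert (H := polar_cont_s r s).
    apply Clim_mult; [tc| |apply Clim_scal; [tc | exact H]].
    apply Clim_plus; [tc | apply Clim_const; tc|].
    apply Clim_scal; [tc | exact H].
  - intros s _. eapply Cdiff_eq; [|apply Cdiff_plus; [tc| |];
      (apply Cdiff_scal; [tc|]); [apply D|];
      apply Cdiff_mult; [tc | apply Clim_RtoC | apply D | apply D]].
    cbv beta. field.
Qed.

(** Near [polar p q] the function is affine up to a small multiple of the distance. The affine part
    disappears around the rectangle; the rest is bounded by length times size, both of order [S]. *)
Lemma goursat_local p q (eps : R) : (r1 <= p <= r2)%R -> (0 < eps)%R ->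
  exists delta : R, (0 < delta)%R /\ forall a b c d,
    (r1 <= a <= p)%R -> (p <= b <= r2)%R -> (c <= q <= d)%R ->
    (b - a < delta)%R -> (d - c < delta)%R ->
    (Cmod (polar_boundary F a b c d) <= eps * ((b - a + (d - c)) * (b - a + (d - c))))%R.
Proof.
  intros Hp Heps. set (M := (r2 + 1)%R). assert (HM : (1 <= M)%R) by (unfold M; lra).
  set (z0 := polar p q).
  assert (Hz0 : (r1 <= Cmod z0 <= r2)%R) by (unfold z0; rewrite Cmod_polar; lra).
  destruct (HF z0 Hz0) as (v & phi & Hphi & Lphi).
  (* Each of the four sides contributes at most M S * e * (M S); [M] bounds the radius, which is the
     ratio of arc length to angle. *)
  set (e := (eps / (4 * M * M))%R).
  assert (HMM : (0 < M * M)%R) by (apply Rmult_lt_0_compat; lra).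
  assert (He : (0 < e)%R) by (unfold e; apply Rdiv_lt_0_compat; lra).
  assert (HL := filter_and _ _ Hphi (Lphi e He)). apply locally_Cmod_iff in HL.
  destruct HL as (d0 & Hd0 & HL).
  exists (d0 / (2 * M))%R. split; [apply Rdiv_lt_0_compat; lra|].
  intros a b c d Ha Hb Hq Hab Hcd.
  set (u := F z0 - v * z0).
  set (S := (b - a + (d - c))%R).
  assert (HS : (0 <= S)%R) by (unfold S; lra).
  assert (HE : (0 <= e * (M * S))%R).
  { apply Rmult_le_pos; [lra | apply Rmult_le_pos; lra]. }
  assert (HSd : (M * S < d0)%R).
  { replace d0 with (M * (d0 / (2 * M) + d0 / (2 * M)))%R by (field; lra).
    apply Rmult_lt_compat_l; unfold S; lra. }
  assert (HR : forall r s, (a <= r <= b)%R -> (c <= s <= d)%R ->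
    (Cmod (F (polar r s) - (u + v * polar r s)) <= e * (M * S))%R).
  { intros r s Hr Hs.
    assert (Hd : (Cmod (polar r s - z0) <= M * S)%R).
    { eapply Rle_trans; [apply (polar_lipschitz r s p q M); unfold M; lra|].
      apply Rle_trans with (M * Rabs (r - p) + M * Rabs (s - q))%R.
      - apply Rplus_le_compat_r. rewrite <- (Rmult_1_l (Rabs (r - p))) at 1.
        apply Rmult_le_compat_r; [apply Rabs_pos | exact HM].
      - rewrite <- Rmult_plus_distr_l. apply Rmult_le_compat_l; [lra|].
        unfold S. apply Rplus_le_compat; apply Rabs_le; lra. }
    destruct (HL (polar r s)) as [E L]; [eapply Rle_lt_trans; [exact Hd | exact HSd]|].
    replace (F (polar r s) - (u + v * polar r s)) with ((phi (polar r s) - v) * (polar r s - z0)).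
    2:{ unfold u. rewrite E. ring. }
    rewrite Cmod_mult. apply Rmult_le_compat; [apply Cmod_ge_0 | apply Cmod_ge_0 | lra | exact Hd]. }
  assert (A1 : forall s, (c <= s <= d)%R -> (Cmod (side_r F s a b
      - ((u * polar b s + v / 2 * (polar b s * polar b s))
         - (u * polar a s + v / 2 * (polar a s * polar a s)))) <= M * S * (e * (M * S)))%R).
  { intros s Hs. apply Rle_trans with ((b - a) * (e * (M * S)))%R.
    - refine (is_CRInt_Cmod_le _ a b _ _ _ _ (is_CRInt_minus _ _ _ _ _ _
        (side_r_correct s a b ltac:(lra) ltac:(lra)) (side_r_affine u v s a b ltac:(lra)))); [lra|].
      intros r Hr. cbv beta.
      replace (F (polar r s) * cis s - (u + v * polar r s) * cis s)
        with ((F (polar r s) - (u + v * polar r s)) * cis s) by ring.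
      rewrite Cmod_mult, Cmod_cis, Rmult_1_r. now apply HR.
    - apply Rmult_le_compat_r; [exact HE|].
      apply Rle_trans with S; [unfold S; lra|]. rewrite <- (Rmult_1_l S) at 1.
      apply Rmult_le_compat_r; lra. }
  assert (A2 : forall r, (a <= r <= b)%R -> (Cmod (side_s F r c d
      - ((u * polar r d + v / 2 * (polar r d * polar r d))
         - (u * polar r c + v / 2 * (polar r c * polar r c)))) <= M * S * (e * (M * S)))%R).
  { intros r Hr. apply Rle_trans with ((d - c) * (M * (e * (M * S))))%R.
    - refine (is_CRInt_Cmod_le _ c d _ _ _ _ (is_CRInt_minus _ _ _ _ _ _
        (side_s_correct r c d ltac:(lra) ltac:(lra)) (side_s_affine u v r c d ltac:(lra)))); [lra|].
      intros s Hs. cbv beta.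
      replace (F (polar r s) * (Ci * polar r s) - (u + v * polar r s) * (Ci * polar r s))
        with (Ci * polar r s * (F (polar r s) - (u + v * polar r s))) by ring.
      rewrite !Cmod_mult, Cmod_Ci, Cmod_polar, Rmult_1_l by lra.
      apply Rmult_le_compat; [lra | apply Cmod_ge_0 | unfold M; lra | now apply HR].
    - replace (M * S * (e * (M * S)))%R with (S * (M * (e * (M * S))))%R by ring.
      apply Rmult_le_compat_r; [apply Rmult_le_pos; [lra | exact HE] | unfold S; lra]. }
  replace (eps * (S * S))%R with (M * S * (e * (M * S)) + M * S * (e * (M * S))
    + M * S * (e * (M * S)) + M * S * (e * (M * S)))%R by (unfold e; field; lra).
  assert (B1 := A1 c ltac:(lra)). assert (B2 := A2 b ltac:(lra)).
  assert (B3 := A1 d ltac:(lra)). assert (B4 := A2 a ltac:(lra)).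
  unfold polar_boundary.
  match type of B1 with (Cmod ?x1 <= _)%R =>
  match type of B2 with (Cmod ?x2 <= _)%R =>
  match type of B3 with (Cmod ?x3 <= _)%R =>
  match type of B4 with (Cmod ?x4 <= _)%R =>
    replace (side_r F c a b + side_s F b c d - side_r F d a b - side_s F a c d)
      with (x1 + x2 + - x3 + - x4) by ring;
    assert (T1 := Cmod_triangle (x1 + x2 + - x3) (- x4));
    assert (T2 := Cmod_triangle (x1 + x2) (- x3)); assert (T3 := Cmod_triangle x1 x2)
  end end end end.
  rewrite Cmod_opp in T1, T2. lra.
Qed.

(** A bound quadratic in the sum of the two side lengths is stable under quartering: four squares of
    one half make the square of the whole. *)
Lemma goursat_polar c d : (r1 <= r2)%R -> (c <= d)%R -> polar_boundary F r1 r2 c d = 0.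
Proof.
  intros Hr Hc. apply Cmod_eq_0. apply Rle_antisym; [|apply Cmod_ge_0].
  apply le_epsilon. intros eps Heps. rewrite Rplus_0_l.
  (* The added 1 keeps the divisor [S * S] positive for degenerate rectangles. *)
  set (S := (r2 - r1 + (d - c) + 1)%R). assert (HS : (1 <= S)%R) by (unfold S; lra).
  assert (HSS : (0 < S * S)%R) by (apply Rmult_lt_0_compat; lra).
  set (e := (eps / (S * S))%R). assert (He : (0 < e)%R) by (now apply Rdiv_lt_0_compat).
  apply Rle_trans with (e * ((r2 - r1 + (d - c)) * (r2 - r1 + (d - c))))%R.
  - set (Q := fun a b c' d' => (r1 <= a)%R -> (b <= r2)%R ->
      (Cmod (polar_boundary F a b c' d') <= e * ((b - a + (d' - c')) * (b - a + (d' - c'))))%R).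
    assert (HQ : Q r1 r2 c d).
    { apply (rect_induction Q); [| |exact Hr|exact Hc].
      - intros a b c' d' Hab Hcd Q1 Q2 Q3 Q4 Ha Hb.
        set (m := ((a + b) / 2)%R) in *. set (n := ((c' + d') / 2)%R) in *.
        assert (Hm : (a <= m <= b)%R) by (unfold m; lra).
        assert (Hn : (c' <= n <= d')%R) by (unfold n; lra).
        specialize (Q1 ltac:(lra) ltac:(lra)). specialize (Q2 ltac:(lra) ltac:(lra)).
        specialize (Q3 ltac:(lra) ltac:(lra)). specialize (Q4 ltac:(lra) ltac:(lra)).
        assert (E : polar_boundary F a b c' d' = polar_boundary F a m c' n
          + polar_boundary F m b c' n + polar_boundary F a m n d' + polar_boundary F m b n d').
        { unfold polar_boundary.
          rewrite (side_r_Chasles c' a m b), (side_r_Chasles d' a m b) by lra.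
          rewrite (side_s_Chasles a c' n d'), (side_s_Chasles b c' n d') by lra. ring. }
        rewrite E.
        eapply Rle_trans; [apply Cmod_triangle|].
        eapply Rle_trans; [apply Rplus_le_compat_r, Cmod_triangle|].
        eapply Rle_trans; [apply Rplus_le_compat_r, Rplus_le_compat_r, Cmod_triangle|].
        replace (m - a)%R with ((b - a) / 2)%R in Q1, Q3 by (unfold m; field).
        replace (b - m)%R with ((b - a) / 2)%R in Q2, Q4 by (unfold m; field).
        replace (n - c')%R with ((d' - c') / 2)%R in Q1, Q2 by (unfold n; field).
        replace (d' - n)%R with ((d' - c') / 2)%R in Q3, Q4 by (unfold n; field).
        nra.
      - intros p q Hp Hq. destruct (goursat_local p q e Hp He) as (delta & Hdelta & H).
        exists delta. split; [exact Hdelta|]. intros a b c' d' Ha Hb Hc' Hd' H1 H2 _ _.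
        apply H; lra. }
    apply HQ; lra.
  - replace eps with (e * (S * S))%R by (unfold e; field; lra).
    apply Rmult_le_compat_l; [lra|]. apply Rmult_le_compat; unfold S; lra.
Qed.

End Goursat.

(** * Circular means and Cauchy's formula *)

Definition mean (g : C -> C) (r : R) : C := CRInt (fun s => g (polar r s)) 0 (2 * PI).

Lemma two_PI_pos : (0 < 2 * PI)%R.
Proof. generalize PI_RGT_0. lra. Qed.

Lemma two_PI_nz : 2 * PI <> 0.
Proof.
  rewrite <- RtoC_mult. intros E. apply RtoC_inj in E. generalize two_PI_pos. lra.
Qed.

Lemma polar_2PI r : polar r (2 * PI) = polar r 0.
Proof. unfold polar. now rewrite cis_2PI, cis_0. Qed.

Lemma polar_nz r s : (0 < r)%R -> polar r s <> 0.
Proof.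
  intros Hr E. assert (H := Cmod_polar r s ltac:(lra)). rewrite E, Cmod_0 in H. lra.
Qed.

Lemma mean_correct (g : C -> C) r :
  (forall s, Clim (locallyC (polar r s)) g (g (polar r s))) ->
  is_CRInt (fun s => g (polar r s)) 0 (2 * PI) (mean g r).
Proof.
  intros Hg. apply is_CRInt_correct, Ccont_on_ex_RInt; [generalize two_PI_pos; lra|].
  apply Ccont_on_locally. intros s _.
  apply (Clim_comp_continuous _ (fun s => polar r s) g); [apply polar_cont_s | apply Hg].
Qed.

(** Goursat's lemma for g z / z on the annulus cut along a ray: the two radial sides coincide, and
    the circular ones are i times the means. *)
Lemma mean_const (g : C -> C) a b : (0 < a <= b)%R ->
  (forall z, (a <= Cmod z <= b)%R -> exists l, Zdiff g z l) -> mean g a = mean g b.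
Proof.
  intros Hab Hg.
  assert (Hgc : forall z, (a <= Cmod z <= b)%R -> Clim (locallyC z) g (g z)).
  { intros z Hz. destruct (Hg z Hz) as [l Hl].
    exact (Zdiff_continuous g z l Hl). }
  set (F := fun z => g z * / z).
  assert (HG : polar_boundary F a b 0 (2 * PI) = 0).
  { apply goursat_polar; [lra | | lra | generalize two_PI_pos; lra].
    intros z Hz. destruct (Hg z Hz) as [l Hl].
    assert (Hn : z <> 0) by (intros E; rewrite E, Cmod_0 in Hz; lra).
    eexists. apply (Cdiff_mult _ (fun v : C => v) z g (fun v => / v)); [apply Clim_idC | exact Hl|].
    apply (Cdiff_inv _ (fun v : C => v) z (fun v => v) 1 (Clim_idC z) Hn).
    apply Cdiff_id. tc. }
  assert (ES : forall r, (a <= r <= b)%R -> side_s F r 0 (2 * PI) = Ci * mean g r).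
  { intros r Hr. apply RInt_to_C. apply is_CRInt_ext with (fun s => Ci * g (polar r s)).
    - generalize two_PI_pos; lra.
    - intros s _. unfold F. field. apply polar_nz. lra.
    - apply is_CRInt_scal, mean_correct. intros s. apply Hgc. rewrite Cmod_polar; lra. }
  assert (ER : side_r F (2 * PI) a b = side_r F 0 a b).
  { unfold side_r. rewrite cis_2PI, cis_0. apply (RInt_ext (V := C_R_CompleteNormedModule)). intros r _. now rewrite polar_2PI. }
  unfold polar_boundary in HG. rewrite ER, !ES in HG by lra.
  apply Ceq_minus. assert (E : Ci * (mean g a - mean g b) = 0).
  {
    transitivity (- (side_r F 0 a b + Ci * mean g b - side_r F 0 a b - Ci * mean g a)); [ring|].
    rewrite HG. ring. }
  destruct (Ceq_dec (mean g a - mean g b) 0) as [E'|N]; [exact E'|].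
  exfalso. revert E. apply Cmult_neq_0; [apply Ci_nz | exact N].
Qed.

(** The point is that [delta] can be chosen independent of the angle; [rect_induction] on the
    interval of angles provides this. *)
Lemma mean_cont (g : C -> C) r0 (eps : R) :
  (forall z, Clim (locallyC z) g (g z)) -> (0 < eps)%R ->
  exists delta : R, (0 < delta)%R /\ forall r, (Rabs (r - r0) < delta)%R ->
    (Cmod (mean g r - mean g r0) <= 2 * PI * eps)%R.
Proof.
  intros Hg Heps.
  set (Q := fun a b (c d : R) => exists delta : R, (0 < delta)%R /\
    forall s r, (a <= s <= b)%R -> (Rabs (r - r0) < delta)%R ->
      (Cmod (g (polar r s) - g (polar r0 s)) <= eps)%R).
  assert (HQ : Q 0%R (2 * PI)%R 0%R 0%R).
  { apply (rect_induction Q).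
    - intros a b c d Hab _ (d1 & P1 & H1) (d2 & P2 & H2) _ _.
      exists (Rmin d1 d2). split; [now apply Rmin_glb_lt|]. intros s r Hs Hr.
      destruct (Rle_dec s ((a + b) / 2)).
      + apply H1; [lra|]. generalize (Rmin_l d1 d2). lra.
      + apply H2; [lra|]. generalize (Rmin_r d1 d2). lra.
    - intros p q Hp _.
      assert (H2 : (0 < eps / 2)%R) by lra.
      assert (HL := Hg (polar r0 p) _ H2). apply locally_Cmod_iff in HL.
      destruct HL as (d & Hd & HL).
      set (M := (Rabs r0 + 1)%R). assert (HM : (1 <= M)%R) by (unfold M; generalize (Rabs_pos r0); lra).
      exists (d / (2 * M))%R. split; [apply Rdiv_lt_0_compat; lra|].
      intros a b c' d' Ha Hb _ _ Hab _. exists (d / (2 * M))%R.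
      split; [apply Rdiv_lt_0_compat; lra|]. intros s r Hs Hr.
      assert (Hsp : (Rabs (s - p) < d / (2 * M))%R) by (apply Rabs_def1; lra).
      assert (HP : forall r, (Rabs (r - r0) < d / (2 * M))%R ->
        (Cmod (polar r s - polar r0 p) < d)%R).
      { intros r' Hr'. unfold polar.
        replace (r' * cis s - r0 * cis p) with ((r' - r0)%R * cis s + r0 * (cis s - cis p))
          by (rewrite RtoC_minus; ring).
        eapply Rle_lt_trans; [apply Cmod_triangle|].
        rewrite !Cmod_mult, Cmod_cis, !Cmod_R, Rmult_1_r.
        apply Rle_lt_trans with (Rabs (r' - r0) + M * Rabs (s - p))%R.
        - apply Rplus_le_compat_l. apply Rmult_le_compat;
            [apply Rabs_pos | apply Cmod_ge_0 | unfold M; lra | apply cis_lipschitz].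
        - replace d with (M * (d / (2 * M)) + M * (d / (2 * M)))%R by (field; lra).
          apply Rplus_lt_compat.
          + apply Rlt_le_trans with (1 := Hr').
            rewrite <- (Rmult_1_l (d / (2 * M))) at 1. apply Rmult_le_compat_r; [|lra].
            apply Rlt_le, Rdiv_lt_0_compat; lra.
          + apply Rmult_lt_compat_l; lra. }
      assert (L1 := HL _ (HP r Hr)).
      assert (L2 := HL _ (HP r0 ltac:(rewrite Rminus_diag, Rabs_R0; apply Rdiv_lt_0_compat; lra))).
      replace (g (polar r s) - g (polar r0 s))
        with ((g (polar r s) - g (polar r0 p)) + - (g (polar r0 s) - g (polar r0 p))) by ring.
      eapply Rle_trans; [apply Cmod_triangle|]. rewrite Cmod_opp. lra.
    - generalize two_PI_pos. lra.
    - lra. }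
  destruct HQ as (delta & Hdelta & H). exists delta. split; [exact Hdelta|].
  intros r Hr. replace (2 * PI * eps)%R with ((2 * PI - 0) * eps)%R by ring.
  refine (is_CRInt_Cmod_le _ 0 (2 * PI) _ _ _ _ (is_CRInt_minus _ _ _ _ _ _
    (mean_correct g r _) (mean_correct g r0 _))); try (intros; apply Hg).
  - generalize two_PI_pos. lra.
  - intros s Hs. now apply H.
Qed.

(* By continuity the means of [g] cannot jump at the exceptional radius [rho]. *)
Lemma mean_zero (g : C -> C) (rho : R) : (0 <= rho)%R -> g 0 = 0 ->
  (forall z, Clim (locallyC z) g (g z)) ->
  (forall z, Cmod z <> rho -> exists l, Zdiff g z l) ->
  forall r, (rho < r)%R -> mean g r = 0.
Proof.
  intros Hrho Hg0 Hg Hd.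
  (* By continuity, a modulus taken by the mean at radii arbitrarily close to [r0] is the one at
     [r0]. Used at radius 0 from outside, then at [rho] from inside and from outside. *)
  assert (Hz : forall m r0 : R, (0 <= r0)%R -> (forall delta, (0 < delta)%R -> exists r,
      (Rabs (r - r0) < delta)%R /\ Cmod (mean g r) = m) -> Cmod (mean g r0) = m).
  { intros m r0 Hr0 H. apply cond_eq. intros eps Heps.
    destruct (mean_cont g r0 (eps / (2 * (2 * PI))) Hg) as (delta & Hdelta & HC).
    { apply Rdiv_lt_0_compat; [exact Heps | generalize two_PI_pos; lra]. }
    destruct (H delta Hdelta) as (r & Hr & <-).
    specialize (HC r Hr).
    replace (2 * PI * (eps / (2 * (2 * PI))))%R with (eps / 2)%R in HC
      by (field; generalize PI_RGT_0; lra).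
    apply Rabs_def1.
    - generalize (Cmod_triangle' (mean g r0) (mean g r)). rewrite Cmod_minus_sym. lra.
    - generalize (Cmod_triangle' (mean g r) (mean g r0)). lra. }
  assert (Z0 : mean g 0 = 0).
  { transitivity (scal (V := C_R_NormedModule) (2 * PI - 0)%R (RtoC 0)).
    - apply RInt_to_C.
      apply is_CRInt_ext with (fun _ => RtoC 0); [generalize two_PI_pos; lra| |].
      + intros s _. unfold polar. now rewrite Cmult_0_l, Hg0.
      + apply (is_RInt_const (V := C_R_NormedModule)).
    - rewrite scal_R_Cmult. apply Cmult_0_r. }
  assert (Zin : forall r, (0 < r < rho)%R -> mean g r = 0).
  { intros r Hr. apply Cmod_eq_0. rewrite <- (Hz (Cmod (mean g r)) 0%R).
    - rewrite Z0. apply Cmod_0.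
    - lra.
    - intros delta Hdelta. exists (Rmin (delta / 2) r).
      assert (P := Rmin_glb_lt (delta / 2) r 0 ltac:(lra) ltac:(lra)).
      assert (P1 := Rmin_l (delta / 2) r). assert (P2 := Rmin_r (delta / 2) r).
      split; [rewrite Rminus_0_r, Rabs_pos_eq; lra|].
      f_equal. apply mean_const; [lra|]. intros z Hz'. apply Hd. lra. }
  assert (Zrho : mean g rho = 0).
  { destruct (Req_dec rho 0) as [->|N]; [exact Z0|].
    apply Cmod_eq_0. apply Hz; [exact Hrho|]. intros delta Hdelta.
    exists (rho - Rmin (delta / 2) (rho / 2))%R.
    assert (P := Rmin_glb_lt (delta / 2) (rho / 2) 0 ltac:(lra) ltac:(lra)).
    assert (P1 := Rmin_l (delta / 2) (rho / 2)). assert (P2 := Rmin_r (delta / 2) (rho / 2)).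
    split; [apply Rabs_def1; lra|]. rewrite Zin by lra. apply Cmod_0. }
  intros r Hr. apply Cmod_eq_0. rewrite <- (Hz (Cmod (mean g r)) rho Hrho).
  - rewrite Zrho. apply Cmod_0.
  - intros delta Hdelta. exists (rho + Rmin (delta / 2) (r - rho))%R.
    assert (P := Rmin_glb_lt (delta / 2) (r - rho) 0 ltac:(lra) ltac:(lra)).
    assert (P1 := Rmin_l (delta / 2) (r - rho)). assert (P2 := Rmin_r (delta / 2) (r - rho)).
    split; [apply Rabs_def1; lra|].
    f_equal. apply mean_const; [lra|]. intros z Hz'. apply Hd. lra.
Qed.

Definition entireZ (f : C -> C) : Prop := forall z, exists l, Zdiff f z l.

Lemma entireZ_continuous (f : C -> C) : entireZ f ->
  forall z, Clim (locallyC z) f (f z).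
Proof. intros Hf z. destruct (Hf z) as [l Hl]. exact (Zdiff_continuous f z l Hl). Qed.

(** The difference quotient [q] of [f] at [a] is continuous everywhere and differentiable off [a],
    so z q(z) has mean zero on radii above |a|; then substitute f z = f a + (z - a) q z. *)
Lemma cauchy_mean (f : C -> C) (a : C) (r : R) : entireZ f -> (Cmod a < r)%R ->
  mean (fun z => f z * (z / (z - a))) r = f a * mean (fun z => z / (z - a)) r.
Proof.
  intros Hf Hr. assert (Ha := Cmod_ge_0 a). assert (Hr0 : (0 <= r)%R) by lra.
  assert (Hfc := entireZ_continuous f Hf).
  destruct (Hf a) as (l & phi & Hphi & Lphi).
  set (q := fun z => if Ceq_dec z a then l else (f z - f a) / (z - a)).
  assert (Hq : forall z, z <> a -> exists m, Zdiff q z m).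
  { intros z Hz. destruct (Hf z) as [m Hm].
    eexists. apply Cdiff_ext_loc with (fun z => (f z - f a) * / (z - a)); [tc| | |].
    - unfold q. destruct Ceq_dec; [contradiction | reflexivity].
    - assert (P : (0 < Cmod (z - a))%R) by (apply Cmod_gt_0; now apply Cminus_eq_contra).
      generalize (Clim_idC z _ P). apply filter_imp. intros w Hw. unfold q.
      destruct Ceq_dec as [->|N]; [|reflexivity].
      rewrite Cmod_minus_sym in Hw. lra.
    - apply Cdiff_mult; [tc | apply Clim_idC | |].
      + apply Cdiff_minus; [tc | exact Hm | apply Cdiff_const; tc].
      + apply (Cdiff_inv _ (fun v : C => v) z (fun v => v - a) (1 - 0) (Clim_idC z)).
        * now apply Cminus_eq_contra.
        * apply Cdiff_minus; [tc | apply Cdiff_id; tc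
            | apply Cdiff_const; tc]. }
  assert (Hqc : forall z, Clim (locallyC z) q (q z)).
  { intros z. destruct (Ceq_dec z a) as [->|N].
    - assert (Eq : q a = l) by (unfold q; destruct Ceq_dec; [reflexivity | now elim n]).
      rewrite Eq. intros eps Heps. generalize (filter_and _ _ Hphi (Lphi eps Heps)).
      apply filter_imp. intros w [E L]. unfold q. destruct Ceq_dec as [_|N].
      + replace (l - l) with (RtoC 0) by ring. now rewrite Cmod_0.
      + replace ((f w - f a) / (w - a)) with (phi w); [exact L|].
        rewrite E. field. now apply Cminus_eq_contra.
    - destruct (Hq z N) as [m Hm].
      exact (Zdiff_continuous q z m Hm). }
  assert (M0 : mean (fun z => z * q z) r = 0).
  { apply mean_zero with (Cmod a); [exact Ha | ring | | | exact Hr].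
    - intros z. apply Clim_mult; [tc | apply Clim_idC | apply Hqc].
    - intros z Hz. assert (N : z <> a) by (intros ->; now apply Hz).
      destruct (Hq z N) as [m Hm]. eexists.
      apply Cdiff_mult; [tc | apply Clim_idC | apply Cdiff_id; tc|].
      exact Hm. }
  assert (Hna : forall s, polar r s - a <> 0).
  { intros s. apply Cminus_eq_contra. intros E. rewrite <- E, Cmod_polar in Hr by exact Hr0. lra. }
  assert (I1 : is_CRInt (fun s => polar r s / (polar r s - a)) 0 (2 * PI)
    (mean (fun z => z / (z - a)) r)).
  { apply (mean_correct (fun z => z / (z - a)) r). intros s. apply Clim_mult;
      [tc | apply Clim_idC |]. apply Clim_inv; [tc | apply Hna|].
    apply Clim_minus; [tc | apply Clim_idC | apply Clim_const; tc]. }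
  apply RInt_to_C.
  apply is_CRInt_ext with (fun s => polar r s * q (polar r s)
    + f a * (polar r s / (polar r s - a))); [generalize two_PI_pos; lra| |].
  - intros s _. unfold q. destruct Ceq_dec as [E|N].
    + exfalso. apply (Hna s). rewrite E. ring.
    + field. apply Hna.
  - replace (f a * mean (fun z => z / (z - a)) r)
      with (mean (fun z => z * q z) r + f a * mean (fun z => z / (z - a)) r) by (rewrite M0; ring).
    apply is_CRInt_plus.
    + apply (mean_correct (fun z => z * q z) r). intros s.
      apply Clim_mult; [tc | apply Clim_idC | apply Hqc].
    + now apply is_CRInt_scal.
Qed.

Lemma Cseries_geom (q : C) : (Cmod q < 1)%R -> is_Cseries (fun n => q ^ n) (/ (1 - q)).
Proof.
  intros Hq. assert (Hn : 1 - q <> 0).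
  { apply Cminus_eq_contra. intros E. rewrite <- E, Cmod_1 in Hq. lra. }
  apply Clim_ext with (fun n => (1 - q ^ n) * / (1 - q)); [tc| |].
  - intros n. induction n as [|n IH]; [simpl; ring|].
    change (csum (fun n => q ^ n) (S n)) with (csum (fun n => q ^ n) n + q ^ n).
    rewrite <- IH, Cpow_S. field. exact Hn.
  - apply Clim_eq with ((1 - 0) * / (1 - q)); [ring|].
    apply Clim_mult; [tc| |apply Clim_const; tc].
    apply Clim_minus; [tc | apply Clim_const; tc|].
    intros eps Heps.
    assert (HL := is_lim_seq_geom (Cmod q)). rewrite Rabs_pos_eq in HL by apply Cmod_ge_0.
    specialize (HL Hq). apply is_lim_seq_spec in HL.
    destruct (HL (mkposreal eps Heps)) as [N HN]. exists N. intros n Hn'.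
    specialize (HN n Hn'). replace (q ^ n - 0) with (q ^ n) by ring. rewrite Cmod_pow.
    rewrite Rminus_0_r in HN. eapply Rle_lt_trans; [apply Rle_abs | exact HN].
Qed.

Definition circle_coef (h : C -> C) (r : R) (n : nat) : C := mean (fun z => h z * / z ^ n) r.

Lemma circle_coef_correct (h : C -> C) r n : (0 < r)%R ->
  (forall z, Clim (locallyC z) h (h z)) ->
  is_CRInt (fun s => h (polar r s) * / polar r s ^ n) 0 (2 * PI) (circle_coef h r n).
Proof.
  intros Hr Hh. apply (mean_correct (fun z => h z * / z ^ n) r). intros s.
  apply Clim_mult; [tc | apply Hh|]. apply Clim_inv; [tc| |].
  - apply Cpow_nz. now apply polar_nz.
  - apply Clim_pow; [tc | apply Clim_idC].
Qed.

Lemma circle_bound (h : C -> C) r :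
  (forall z, Clim (locallyC z) h (h z)) ->
  exists M, (0 < M)%R /\ forall s, (0 <= s <= 2 * PI)%R -> (Cmod (h (polar r s)) <= M)%R.
Proof.
  intros Hh. apply (Ccont_on_bounded 0 (2 * PI) (fun s => h (polar r s))).
  - generalize two_PI_pos; lra.
  - apply Ccont_on_locally. intros s _.
    apply (Clim_comp_continuous _ (fun s => polar r s) h); [apply polar_cont_s | apply Hh].
Qed.

(** Geometric expansion of z / (z - a) in powers of a / z, uniformly convergent on the circle
    because |a| < r. *)
Lemma circle_series (h : C -> C) (a : C) (r : R) : (Cmod a < r)%R ->
  (forall z, Clim (locallyC z) h (h z)) ->
  is_Cseries (fun n => circle_coef h r n * a ^ n) (mean (fun z => h z * (z / (z - a))) r).
Proof.
  intros Hr Hh. assert (Ha := Cmod_ge_0 a). assert (Hr0 : (0 < r)%R) by lra.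
  destruct (circle_bound h r Hh) as (M & PM & HM).
  assert (H2 := two_PI_pos).
  set (phi := fun (n : nat) s => h (polar r s) * (a / polar r s) ^ n).
  assert (HI : forall n, is_CRInt (phi n) 0 (2 * PI) (circle_coef h r n * a ^ n)).
  { intros n. rewrite Cmult_comm.
    apply is_CRInt_ext with (fun s => a ^ n * (h (polar r s) * / polar r s ^ n)); [lra| |].
    - intros s _. unfold phi, Cdiv.
      rewrite Cpow_mult_l, Cpow_inv by now apply polar_nz. ring.
    - now apply is_CRInt_scal, circle_coef_correct. }
  destruct (is_CRInt_series phi (fun s => h (polar r s) * (polar r s / (polar r s - a)))
    (fun n => M * (Cmod a / r) ^ n)%R 0 (2 * PI)) as (l & Hl & HS).
  - lra.
  - intros n. eexists. apply HI.
  - intros n s Hs. unfold phi. rewrite Cmod_mult, Cmod_pow, Cmod_div by now apply polar_nz.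
    rewrite Cmod_polar by lra. apply Rmult_le_compat_r; [|now apply HM].
    apply pow_le. apply Rmult_le_pos; [exact Ha | apply Rlt_le, Rinv_0_lt_compat, Hr0].
  - apply (ex_series_scal (V := R_NormedModule) M). apply ex_series_geom.
    rewrite Rabs_pos_eq.
    + apply Rlt_div_l; lra.
    + apply Rmult_le_pos; [exact Ha | apply Rlt_le, Rinv_0_lt_compat, Hr0].
  - intros s _. assert (Hn := polar_nz r s Hr0).
    replace (polar r s / (polar r s - a)) with (/ (1 - a / polar r s)).
    + apply is_Cseries_scal. apply Cseries_geom. rewrite Cmod_div by exact Hn.
      rewrite Cmod_polar by lra. apply Rlt_div_l; lra.
    + field. split; [|exact Hn].
      apply Cminus_eq_contra. intros E. rewrite <- E, Cmod_polar in Hr by lra. lra.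
  - replace (mean (fun z => h z * (z / (z - a))) r) with l.
    2:{ symmetry. now apply RInt_to_C. }
    apply is_Cseries_ext with (2 := HS). intros n. apply RInt_to_C, HI.
Qed.

(** On the circle z^(-n-1) is periodic in the angle and a constant multiple of its own
    derivative. *)
Lemma circle_coef_1 r n : (0 < r)%R -> circle_coef (fun _ => 1) r (S n) = 0.
Proof.
  intros Hr. apply RInt_to_C.
  assert (H2 := two_PI_pos).
  set (k := / (INR (S n) * Ci)).
  assert (Hk : INR (S n) * Ci <> 0).
  { apply Cmult_neq_0; [|apply Ci_nz]. intros E. apply RtoC_inj in E.
    revert E. apply not_0_INR. lia. }
  assert (D : forall s, Rdiff (fun s => polar r s) s (Ci * polar r s)).
  { intros s. eapply Cdiff_eq; [|apply Cdiff_scal; [tc | apply cis_derive]].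
    unfold polar. ring. }
  replace (RtoC 0) with (- k * (/ polar r (2 * PI)) ^ S n - - k * (/ polar r 0) ^ S n)
    by (rewrite polar_2PI; ring).
  apply (CFTC 0 (2 * PI) (fun s => - k * (/ polar r s) ^ S n)); [lra| | |].
  - apply Ccont_on_mult; [apply Ccont_on_const|]. apply Ccont_on_pow, Ccont_on_inv.
    + intros s _. now apply polar_nz.
    + apply Ccont_on_locally. intros. apply polar_cont_s.
  - apply Ccont_on_mult; [apply Ccont_on_const|]. apply Ccont_on_inv.
    + intros s _. apply Cpow_nz. now apply polar_nz.
    + apply Ccont_on_pow, Ccont_on_locally. intros. apply polar_cont_s.
  - intros s _. assert (Hn := polar_nz r s Hr).
    eapply Cdiff_eq; [|apply Cdiff_scal; [tc|];
      apply Cdiff_pow; [tc | apply Clim_RtoC |];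
      apply Cdiff_inv; [tc | apply Clim_RtoC | exact Hn | apply D]].
    cbv beta. simpl pred. rewrite Cpow_inv by exact Hn. rewrite (Cpow_S _ n). unfold k.
    field. repeat split; first [exact Hn | apply Ci_nz | now apply Cpow_nz
      | intros E; apply Hk; rewrite E; ring].
Qed.

(** In the expansion for the constant function 1 only the term of index 0 survives. *)
Lemma mean_kernel (a : C) r : (Cmod a < r)%R -> mean (fun z => z / (z - a)) r = 2 * PI.
Proof.
  intros Hr. assert (Ha := Cmod_ge_0 a). assert (Hr0 : (0 < r)%R) by lra.
  assert (HS := circle_series (fun _ => RtoC 1) a r Hr
    (fun z => Clim_const _ _)).
  replace (mean (fun z => z / (z - a)) r) with (mean (fun z => 1 * (z / (z - a))) r).
  2:{ apply (RInt_ext (V := C_R_CompleteNormedModule)). intros s _. apply Cmult_1_l. }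
  assert (E0 : circle_coef (fun _ => 1) r 0 = 2 * PI).
  { transitivity (scal (V := C_R_NormedModule) (2 * PI - 0)%R (RtoC 1)).
    - apply RInt_to_C.
      apply is_CRInt_ext with (fun _ => RtoC 1); [generalize two_PI_pos; lra| |].
      + intros s _. simpl. field.
      + apply (is_RInt_const (V := C_R_NormedModule)).
    - rewrite scal_R_Cmult, Rminus_0_r, RtoC_mult. apply Cmult_1_r. }
  refine (Clim_unique eventually _ _ _ HS _).
  apply Clim_ext_loc with (fun _ => 2 * PI); [tc| |apply Clim_const; tc].
  exists 1%nat. intros [|n] Hn; [lia|]. rewrite csum_first, csum_0.
  - rewrite E0. simpl. ring.
  - intros k _. rewrite circle_coef_1 by exact Hr0. ring.
Qed.

Lemma cauchy_series (f : C -> C) (a : C) r : entireZ f -> (Cmod a < r)%R ->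
  is_Cseries (fun n => / (2 * PI) * circle_coef f r n * a ^ n) (f a).
Proof.
  intros Hf Hr.
  assert (Hfc := entireZ_continuous f Hf).
  assert (HS := circle_series f a r Hr Hfc).
  rewrite (cauchy_mean f a r Hf Hr), (mean_kernel a r Hr) in HS.
  apply (is_Cseries_scal (/ (2 * PI))) in HS.
  replace (/ (2 * PI) * (f a * (2 * PI))) with (f a) in HS.
  2:{ rewrite (Cmult_comm (f a)), Cmult_assoc, Cinv_l, Cmult_1_l; [reflexivity | apply two_PI_nz]. }
  apply is_Cseries_ext with (2 := HS). intros n. ring.
Qed.

Lemma circle_coef_ex (f : C -> C) r rho :
  (forall z, Clim (locallyC z) f (f z)) -> (0 <= rho < r)%R ->
  ex_series (fun n => Cmod (/ (2 * PI) * circle_coef f r n) * rho ^ n)%R.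
Proof.
  intros Hf Hr. destruct (circle_bound f r Hf) as (M & PM & HM).
  assert (H2 := two_PI_pos). assert (Hr0 : (0 < r)%R) by lra.
  apply (ex_series_Rle _ (fun n => M * (rho / r) ^ n)%R).
  - intros n. rewrite Rabs_pos_eq.
    2:{ apply Rmult_le_pos; [apply Cmod_ge_0 | apply pow_le; lra]. }
    assert (B : (Cmod (circle_coef f r n) <= (2 * PI - 0) * (M * / r ^ n))%R).
    { refine (is_CRInt_Cmod_le _ 0 (2 * PI) _ _ _ _ (circle_coef_correct f r n Hr0 Hf)); [lra|].
      intros s Hs. rewrite Cmod_mult, Cmod_inv, Cmod_pow, Cmod_polar
        by (try (apply Cpow_nz; now apply polar_nz); lra).
      apply Rmult_le_compat_r; [|now apply HM].
      apply Rlt_le, Rinv_0_lt_compat, pow_lt, Hr0. }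
    rewrite Cmod_mult, Cmod_inv by apply two_PI_nz.
    rewrite <- RtoC_mult, Cmod_R, Rabs_pos_eq by lra.
    unfold Rdiv. rewrite Rpow_mult_distr, pow_inv.
    replace (M * (rho ^ n * / r ^ n))%R
      with (/ (2 * PI) * ((2 * PI - 0) * (M * / r ^ n)) * rho ^ n)%R.
    2:{ field. split; [apply pow_nonzero; lra | generalize PI_RGT_0; lra]. }
    apply Rmult_le_compat_r; [apply pow_le; lra|].
    apply Rmult_le_compat_l; [apply Rlt_le, Rinv_0_lt_compat, H2 | exact B].
  - apply (ex_series_scal (V := R_NormedModule) M). apply ex_series_geom.
    rewrite Rabs_pos_eq.
    + apply Rlt_div_l; lra.
    + apply Rmult_le_pos; [lra | apply Rlt_le, Rinv_0_lt_compat, Hr0].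
Qed.

(** The expansion obtained from a circle is valid only inside it. Uniqueness on a small common disc
    shows that the coefficients agree for all radii r >= 1, so those of radius 1 serve for every
    z. *)
Lemma entire_PS (f : C -> C) : entireZ f ->
  exists a, good a /\ forall z, is_Cseries (fun n => a n * z ^ n) (f z).
Proof.
  intros Hf.
  assert (Hfc := entireZ_continuous f Hf).
  set (c := fun r n => / (2 * PI) * circle_coef f r n).
  assert (E : forall r, (1 <= r)%R -> forall n, c r n = c 1%R n).
  { intros r Hr. apply (Cseries_pow_unique (c r) (c 1%R) (1 / 2)); [lra| | |].
    - apply circle_coef_ex; [exact Hfc | lra].
    - apply circle_coef_ex; [exact Hfc | lra].
    - intros z Hz. exists (f z). split; apply cauchy_series; auto; lra. }
  exists (c 1%R). split.
  - split; [intros; apply Cmod_ge_0|]. intros r Hr.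
    apply ex_series_ext with (fun n => Cmod (c (r + 1)%R n) * r ^ n)%R.
    + intros n. rewrite E by lra. reflexivity.
    + apply circle_coef_ex; [exact Hfc | lra].
  - intros z. assert (Hz := Cmod_ge_0 z).
    apply is_Cseries_ext with (fun n => c (Cmod z + 1)%R n * z ^ n).
    + intros n. rewrite E by lra. reflexivity.
    + apply cauchy_series; [exact Hf | lra].
Qed.

(** * The operator on power series *)

Lemma PS_good_unique (a : nat -> C) z l :
  is_Cseries (fun n => a n * z ^ n) l -> PS a z = l.
Proof. apply Cseries_unique. Qed.

Lemma Zdiff_C_derive (f : C -> C) (z l : C) : Zdiff f z l -> C_derive f z = l.
Proof. intros H. apply is_C_derive_unique. now apply Zdiff_is_derive. Qed.

(** Coefficients of exp(-w); [altexp1] gives those of (1 + w) exp(-w). They are used with w = R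
    z. *)
Definition altexp (n : nat) : C := expc n * (- (1)) ^ n.
Definition altexp1 (n : nat) : C := (1 - INR n) * altexp n.

Lemma Cmod_m1_pow n : Cmod ((- (1)) ^ n) = 1%R.
Proof. rewrite Cmod_pow, Cmod_m1. apply pow1. Qed.

Lemma Cmod_altexp n : Cmod (altexp n) = (/ INR (Factorial.fact n))%R.
Proof. unfold altexp. rewrite Cmod_mult, Cmod_expc, Cmod_m1_pow. ring. Qed.

Definition altexp1_bound (n : nat) : R :=
  (/ INR (Factorial.fact n) + INR n * / INR (Factorial.fact n))%R.

Lemma Cmod_altexp1 n : (Cmod (altexp1 n) <= altexp1_bound n)%R.
Proof.
  unfold altexp1, altexp1_bound. rewrite Cmod_mult, Cmod_altexp.
  assert (P := Rinv_0_lt_compat _ (INR_fact_lt_0 n)).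
  assert (Q : (Cmod (1 - INR n) <= 1 + INR n)%R).
  { eapply Rle_trans; [apply Cmod_triangle|].
    rewrite Cmod_1, Cmod_opp, Cmod_R, Rabs_pos_eq by apply pos_INR. lra. }
  apply (Rmult_le_compat_r (/ INR (Factorial.fact n))) in Q; lra.
Qed.

Lemma rgood_altexp1_bound : rgood altexp1_bound.
Proof.
  apply rgood_plus; [apply rgood_inv_fact | apply rgood_INR, rgood_inv_fact].
Qed.

Lemma good_altexp : good altexp.
Proof.
  apply rgood_le with (2 := rgood_inv_fact). intros n. rewrite Cmod_altexp.
  split; [|lra]. apply Rlt_le, Rinv_0_lt_compat, INR_fact_lt_0.
Qed.

Lemma good_altexp1 : good altexp1.
Proof.
  apply rgood_le with (2 := rgood_altexp1_bound). intros n.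
  split; [apply Cmod_ge_0 | apply Cmod_altexp1].
Qed.

Lemma opp_pow (w : C) n : (- w) ^ n = (- (1)) ^ n * w ^ n.
Proof. rewrite <- Cpow_mult_l. f_equal. ring. Qed.

Lemma PS_altexp w : PS altexp w = Cexp (- w).
Proof.
  apply PS_good_unique. apply is_Cseries_ext with (2 := is_Cseries_Cexp (- w)).
  intros n. unfold altexp. rewrite opp_pow. ring.
Qed.

Lemma PS_altexp1 w : PS altexp1 w = (1 + w) * Cexp (- w).
Proof.
  apply PS_good_unique.
  destruct (PS_derive expc (- w) good_expc) as (l & Hl & Hd).
  assert (El : l = Cexp (- w)).
  { rewrite <- (Zdiff_C_derive _ _ _ Hd). apply Zdiff_C_derive.
    apply Cdiff_ext with Cexp; [tc | intros; symmetry; apply PS_expc |].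
    apply Cexp_derive. }
  rewrite El in Hl.
  replace ((1 + w) * Cexp (- w)) with (Cexp (- w) - - w * Cexp (- w)) by ring.
  apply is_Cseries_ext with (fun n => altexp n * w ^ n - - w * dcoef expc n (- w)).
  - intros n. unfold altexp1, dcoef, altexp. destruct n as [|n].
    + simpl. ring.
    + simpl pred. rewrite (opp_pow w), !Cpow_S. ring.
  - apply is_Cseries_minus.
    + apply is_Cseries_ext with (2 := is_Cseries_Cexp (- w)).
      intros n. unfold altexp. rewrite opp_pow. ring.
    + now apply is_Cseries_scal.
Qed.

Section Kernel.
Context (x nu : C) (hx : slit x) (hx1 : x <> 1) (hnu : (Re nu < 0)%R).

Definition dker (s : R) : C := 1 - (1 - x) * s.

(** [dker] runs along the segment from 1 to x, and the slit plane is star-shaped with respect to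
    1. *)
Lemma dker_slit s : (0 <= s <= 1)%R -> slit (dker s).
Proof.
  intros Hs [H1 H2].
  assert (E : dker s = RtoC (1 - s) + RtoC s * x) by (unfold dker; rewrite RtoC_minus; ring).
  rewrite E, im_plus, im_RtoC, im_scal_l in H1. rewrite E, re_plus, re_RtoC, re_scal_l in H2.
  destruct (Req_dec s 0) as [->|N]; [lra|].
  apply hx. split; [nra | nra].
Qed.

Lemma dker_nz s : (0 <= s <= 1)%R -> dker s <> 0.
Proof. intros Hs. apply slit_nz. now apply dker_slit. Qed.

Lemma dker_cont : Ccont_on 0 1 dker.
Proof.
  apply Ccont_on_minus; [apply Ccont_on_const|].
  apply Ccont_on_mult; [apply Ccont_on_const | apply Ccont_on_RtoC].
Qed.

Lemma dker_derive s : Rdiff dker s (- (1 - x)).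
Proof.
  eapply Cdiff_eq; [|apply Cdiff_minus; [tc | apply Cdiff_const; tc|];
    apply Cdiff_scal; [tc|]; apply Cdiff_id; tc].
  ring.
Qed.

Lemma one_minus_slit (s : R) : (s < 1)%R -> slit (1 - s).
Proof. intros Hs [_ H]. rewrite <- RtoC_minus, re_RtoC in H. lra. Qed.

Lemma one_minus_cont : Ccont_on 0 1 (fun s => 1 - s).
Proof. apply Ccont_on_minus; [apply Ccont_on_const | apply Ccont_on_RtoC]. Qed.

Lemma kerR_cont : Ccont_on 0 1 (kerR x nu).
Proof.
  apply Ccont_on_mult.
  - intros s Hs. apply (Clim_comp_continuous _ (fun s : R => 1 - s) (fun v => Cpower v (- nu))).
    + now apply one_minus_cont.
    + apply Cpower_continuous; [rewrite re_opp; lra|].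
      destruct (Req_dec s 1) as [->|N]; [right; ring | left; apply one_minus_slit; lra].
  - intros s Hs. apply (Clim_comp_continuous _ dker (fun v => Cpower v (nu - 1))).
    + now apply dker_cont.
    + apply (Cdiff_continuous _ (fun v : C => v) (dker s) (fun v => Cpower v (nu - 1))
        ((nu - 1) * Cpower (dker s) (nu - 1 - 1)) (Clim_idC _)).
      apply Cpower_derive. now apply dker_slit.
Qed.

(** The logarithmic derivative is nu / (1 - s) + (1 - nu) (1 - x) / D, simplified with (1 - x) (1 -
    s) = D - x. *)
Lemma kerR_derive s : (0 < s < 1)%R ->
  Rdiff (kerR x nu) s (kerR x nu s * (dker s - x + nu * x) / ((1 - s) * dker s)).
Proof.
  intros Hs. assert (H1 := one_minus_slit s ltac:(lra)).
  assert (H2 := dker_slit s ltac:(lra)).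
  assert (N1 := slit_nz _ H1). assert (N2 := slit_nz _ H2).
  assert (D1 : Rdiff (fun s : R => 1 - s) s (0 - 1)).
  { apply Cdiff_minus; [tc | apply Cdiff_const; tc
      | apply Cdiff_id; tc]. }
  assert (P1 := Cdiff_comp _ RtoC s (fun s : R => 1 - s) _ (fun v => Cpower v (- nu)) _
    (Clim_RtoC s) D1 (Cpower_derive _ _ H1)).
  assert (P2 := Cdiff_comp _ RtoC s dker _ (fun v => Cpower v (nu - 1)) _
    (Clim_RtoC s) (dker_derive s) (Cpower_derive _ _ H2)).
  eapply Cdiff_eq; [|exact (Cdiff_mult _ RtoC s _ _ _ _ (Clim_RtoC s) P1 P2)].
  cbv beta.
  assert (E1 : Cpower (1 - s) (- nu) = Cpower (1 - s) (- nu - 1) * (1 - s)).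
  { rewrite <- (Cpower_1_r (1 - s)) at 3. rewrite <- Cpower_plus. f_equal. ring. }
  assert (E2 : Cpower (dker s) (nu - 1) = Cpower (dker s) (nu - 1 - 1) * dker s).
  { rewrite <- (Cpower_1_r (dker s)) at 3. rewrite <- Cpower_plus. f_equal. ring. }
  unfold kerR. fold (dker s). rewrite E1, E2.
  unfold dker in *. field. split; assumption.
Qed.

Lemma kerR_0 : kerR x nu 0 = 1.
Proof.
  unfold kerR. replace (1 - 0) with (RtoC 1) by ring.
  replace (1 - (1 - x) * 0) with (RtoC 1) by ring. rewrite !Cpower_1_l. ring.
Qed.

Definition cpar : C := (1 - nu * x) / (1 - x).

(** Contribution of the monomial of degree [l] to the coefficient of (R z)^b in the integrand. For l
    <= b it is altexp (b - l) times the operator (1 - b) + (s - c) d/ds applied to s^l. *)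
Definition opL_poly (b l : nat) (s : R) : C :=
  s ^ l * altexp1 (b - l)%nat - cpar * (INR l * s ^ pred l) * altexp (b - l)%nat.

Definition matL (b l : nat) : C := CRInt (fun s => kerR x nu s ^ b * opL_poly b l s) 0 1.

Lemma opL_poly_cont b l : Ccont_on 0 1 (opL_poly b l).
Proof.
  apply Ccont_on_minus; repeat apply Ccont_on_mult; try apply Ccont_on_const;
    apply Ccont_on_pow, Ccont_on_RtoC.
Qed.

Lemma matL_correct b l :
  is_CRInt (fun s => kerR x nu s ^ b * opL_poly b l s) 0 1 (matL b l).
Proof.
  apply is_CRInt_correct, Ccont_on_ex_RInt; [lra|].
  apply Ccont_on_mult; [apply Ccont_on_pow, kerR_cont | apply opL_poly_cont].
Qed.

Definition opL_coef (a : nat -> C) (b : nat) : C := csum (fun l => a l * matL b l) (S b).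

Lemma opL_coef_correct a b : is_CRInt
  (fun s => kerR x nu s ^ b * csum (fun l => a l * opL_poly b l s) (S b)) 0 1 (opL_coef a b).
Proof.
  apply is_CRInt_ext with (fun s => csum (fun l => a l * (kerR x nu s ^ b * opL_poly b l s)) (S b));
    [lra| |].
  - intros s _. rewrite <- csum_scal. apply csum_ext. intros l _. ring.
  - apply is_CRInt_csum. intros l _. apply is_CRInt_scal, matL_correct.
Qed.

(** In the variable w = R z the integrand is f(s w) (1 + w) e^(-w) - c w f'(s w) e^(-w), a
    combination of two Cauchy products. *)
Lemma opL_integrand_series a f (z : C) (s : R) : good a ->
  (forall z, is_Cseries (fun n => a n * z ^ n) (f z)) ->
  is_Cseries (fun b => kerR x nu s ^ b * csum (fun l => a l * opL_poly b l s) (S b) * z ^ b)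
    (opL_integrand x nu f z s).
Proof.
  intros Ha Hf. set (w := kerR x nu s * z).
  set (A1 := fun n => a n * s ^ n). set (A2 := fun n => a n * (INR n * s ^ pred n)).
  set (K := (Rabs s + 1)%R). assert (HK : (1 <= K)%R) by (unfold K; generalize (Rabs_pos s); lra).
  assert (GA1 : good A1).
  { apply rgood_le with (2 := rgood_geom _ K 1 ltac:(lra) ltac:(lra) Ha). intros n.
    split; [apply Cmod_ge_0|]. unfold A1. rewrite Cmod_mult, Cmod_pow, Cmod_R, Rmult_1_l.
    apply Rmult_le_compat_l; [apply Cmod_ge_0|]. apply pow_incr.
    split; [apply Rabs_pos | unfold K; lra]. }
  assert (GA2 : good A2).
  { apply rgood_le with (2 := rgood_geom _ K 1 ltac:(lra) ltac:(lra) (rgood_INR _ Ha)). intros n.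
    split; [apply Cmod_ge_0|].
    unfold A2. rewrite !Cmod_mult, Cmod_pow, !Cmod_R, (Rabs_pos_eq (INR n)), Rmult_1_l by apply pos_INR.
    replace (INR n * Cmod (a n) * K ^ n)%R with (Cmod (a n) * (INR n * K ^ n))%R by ring.
    apply Rmult_le_compat_l; [apply Cmod_ge_0|]. apply Rmult_le_compat_l; [apply pos_INR|].
    eapply Rle_trans; [apply pow_incr; split; [apply Rabs_pos|]|].
    - instantiate (1 := K). unfold K. lra.
    - apply Rle_pow; [exact HK | lia]. }
  assert (E1 : PS A1 w = f (s * w)).
  { apply PS_good_unique. apply is_Cseries_ext with (2 := Hf (s * w)). intros n.
    unfold A1. rewrite Cpow_mult_l. ring. }
  assert (E2 : PS A2 w = w * C_derive f (s * w)).
  { apply PS_good_unique. destruct (PS_derive a (s * w) Ha) as (l & Hl & Hd).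
    assert (El : C_derive f (s * w) = l).
    { apply Zdiff_C_derive. apply Cdiff_ext with (PS a); [tc | |exact Hd].
      intros v. apply PS_good_unique, Hf. }
    rewrite El. apply is_Cseries_ext with (fun n => w * dcoef a n (s * w)).
    - intros n. unfold dcoef, A2. destruct n as [|n]; [simpl; ring|].
      simpl pred. rewrite Cpow_mult_l, (Cpow_S w). ring.
    - now apply is_Cseries_scal. }
  assert (S1 := PS_conv A1 altexp1 w GA1 good_altexp1).
  assert (S2 := PS_conv A2 altexp w GA2 good_altexp).
  rewrite E1, PS_altexp1 in S1. rewrite E2, PS_altexp in S2.
  assert (S3 := is_Cseries_minus _ _ _ _ S1 (is_Cseries_scal cpar _ _ S2)).
  replace (opL_integrand x nu f z s) with
    (f (s * w) * ((1 + w) * Cexp (- w)) - cpar * (w * C_derive f (s * w) * Cexp (- w))).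
  - apply is_Cseries_ext with (2 := S3). intros b. unfold conv.
    transitivity (csum (fun l => a l * opL_poly b l s) (S b) * w ^ b).
    + replace (csum (fun l => a l * opL_poly b l s) (S b)) with
        (csum (fun l => A1 l * altexp1 (b - l)%nat) (S b)
          + - cpar * csum (fun l => A2 l * altexp (b - l)%nat) (S b)); [ring|].
      rewrite <- csum_scal, <- csum_plus. apply csum_ext. intros l _.
      unfold A1, A2, opL_poly. ring.
    + unfold w. rewrite Cpow_mult_l. ring.
  - unfold opL_integrand, cpar, w.
    replace (s * kerR x nu s * z) with (s * (kerR x nu s * z)) by ring.
    set (Y := f (s * (kerR x nu s * z))). set (Y' := C_derive f (s * (kerR x nu s * z))).
    ring.
Qed.

Lemma opL_poly_csum_bound (a : nat -> C) b s : (0 <= s <= 1)%R ->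
  (Cmod (csum (fun l => a l * opL_poly b l s)%C (S b)) <=
    rconv (fun l => Cmod (a l)) altexp1_bound b
    + Cmod cpar * rconv (fun l => INR l * Cmod (a l)) (fun j => / INR (Factorial.fact j)) b)%R.
Proof.
  intros Hs. unfold rconv. rewrite <- rsum_scal, <- rsum_plus.
  assert (HP : forall n, (Cmod (s ^ n) <= 1)%R).
  { intros n. rewrite Cmod_pow, Cmod_R, Rabs_pos_eq by lra.
    rewrite <- (pow1 n). apply pow_incr. lra. }
  apply csum_Cmod. intros l _. rewrite Cmod_mult. unfold opL_poly.
  replace (Cmod (a l) * altexp1_bound (b - l)
     + Cmod cpar * (INR l * Cmod (a l) * / INR (Factorial.fact (b - l))))%R
    with (Cmod (a l) * (1 * altexp1_bound (b - l)
      + Cmod cpar * (INR l * 1) * / INR (Factorial.fact (b - l))))%R by ring.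
  apply Rmult_le_compat_l; [apply Cmod_ge_0|].
  eapply Rle_trans; [apply Cmod_triangle|]. rewrite Cmod_opp, !Cmod_mult, Cmod_altexp.
  rewrite (Cmod_R (INR l)), Rabs_pos_eq by apply pos_INR.
  assert (P := Rinv_0_lt_compat _ (INR_fact_lt_0 (b - l))).
  apply Rplus_le_compat.
  - apply Rmult_le_compat; try apply Cmod_ge_0; [apply HP | apply Cmod_altexp1].
  - apply Rmult_le_compat_r; [lra|]. apply Rmult_le_compat_l; [apply Cmod_ge_0|].
    apply Rmult_le_compat_l; [apply pos_INR | apply HP].
Qed.

(** The majorant [mu] does not involve s, and R, continuous on [0, 1] because Re nu < 0, is bounded
    by [rho]; this justifies termwise integration. *)
Lemma opL_PS a f : good a -> (forall z, is_Cseries (fun n => a n * z ^ n) (f z)) ->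
  good (opL_coef a) /\ forall z, ex_CRInt (opL_integrand x nu f z) 0 1 /\
    is_Cseries (fun n => opL_coef a n * z ^ n) (opL x nu f z).
Proof.
  intros Ha Hf.
  destruct (Ccont_on_bounded 0 1 _ ltac:(lra) kerR_cont) as (rho & Prho & Hrho).
  set (mu := fun b => (rconv (fun l => Cmod (a l)) altexp1_bound b
    + Cmod cpar * rconv (fun l => INR l * Cmod (a l)) (fun j => / INR (Factorial.fact j)) b)%R).
  assert (Gmu : rgood mu).
  { apply rgood_plus.
    - apply rgood_conv; [exact Ha | apply rgood_altexp1_bound].
    - eapply rgood_le; [|apply (rgood_geom (rconv (fun l => INR l * Cmod (a l))%R
        (fun j => / INR (Factorial.fact j))%R) 1 (Cmod cpar)); [lra | apply Cmod_ge_0 |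
        apply rgood_conv; [apply rgood_INR, Ha | apply rgood_inv_fact]]].
      intros n. cbv beta. rewrite pow1, Rmult_1_r. split; [|lra].
      apply Rmult_le_pos; [apply Cmod_ge_0|].
      apply (proj1 (rgood_conv _ _ (rgood_INR _ Ha) rgood_inv_fact)). }
  assert (HB : forall b s, (0 <= s <= 1)%R ->
    (Cmod (kerR x nu s ^ b * csum (fun l => a l * opL_poly b l s) (S b))%C <= mu b * rho ^ b)%R).
  { intros b s Hs. rewrite Cmod_mult, Cmod_pow, Rmult_comm.
    apply Rmult_le_compat; [apply Cmod_ge_0 | apply pow_le, Cmod_ge_0 | now apply opL_poly_csum_bound |].
    apply pow_incr. split; [apply Cmod_ge_0 | now apply Hrho]. }
  split.
  - apply rgood_le with (2 := rgood_geom mu rho 1 ltac:(lra) ltac:(lra) Gmu). intros b.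
    split; [apply Cmod_ge_0|].
    replace (1 * (mu b * rho ^ b))%R with ((1 - 0) * (mu b * rho ^ b))%R by ring.
    refine (is_CRInt_Cmod_le _ 0 1 _ _ _ _ (opL_coef_correct a b)); [lra | apply HB].
  - intros z.
    assert (HI : forall b, is_CRInt (fun s => kerR x nu s ^ b
        * csum (fun l => a l * opL_poly b l s) (S b) * z ^ b) 0 1 (opL_coef a b * z ^ b)).
    { intros b. rewrite Cmult_comm.
      apply is_CRInt_ext with (fun s => z ^ b * (kerR x nu s ^ b
        * csum (fun l => a l * opL_poly b l s) (S b))); [lra | intros; ring |].
      apply is_CRInt_scal, opL_coef_correct. }
    destruct (is_CRInt_series (fun b s => kerR x nu s ^ b
        * csum (fun l => a l * opL_poly b l s) (S b) * z ^ b) (opL_integrand x nu f z)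
      (fun b => mu b * (rho * Cmod z) ^ b)%R 0 1) as (l & Hl & HS).
    + lra.
    + intros b. eexists. apply HI.
    + intros b s Hs. rewrite Cmod_mult, Cmod_pow, Rpow_mult_distr, <- Rmult_assoc.
      apply Rmult_le_compat_r; [apply pow_le, Cmod_ge_0 | now apply HB].
    + apply Gmu. apply Rmult_le_pos; [lra | apply Cmod_ge_0].
    + intros s _. now apply opL_integrand_series.
    + split; [eexists; exact Hl|].
      replace (opL x nu f z) with l by (symmetry; now apply RInt_to_C).
      apply is_Cseries_ext with (2 := HS). intros b. apply RInt_to_C, HI.
Qed.

End Kernel.

(** * The loop integral on power series *)

Lemma Carg_nonneg (w : C) : (0 <= Im w)%R -> (0 <= Carg w)%R.
Proof. intros H. unfold Carg. destruct Rle_dec; [apply acos_bound | lra]. Qed.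

Lemma Carg_nonpos (w : C) : (Im w < 0)%R -> (Carg w <= 0)%R.
Proof.
  intros H. unfold Carg. destruct Rle_dec; [lra|].
  generalize (acos_bound (Re w / Cmod w)). lra.
Qed.

Lemma Carg_pos_real (w : C) : Im w = 0%R -> (0 < Re w)%R -> Carg w = 0%R.
Proof.
  intros H1 H2. change (Carg w) with (Im (Clog w)). rewrite Clog_right by exact H2.
  simpl. rewrite H1. unfold Rdiv. rewrite Rmult_0_l. apply atan_0.
Qed.

Lemma im_inv (t : C) : t <> 0 -> Im (/ t) = (- Im t / (Cmod t * Cmod t))%R.
Proof.
  intros Ht. assert (P : (0 < Cmod t)%R) by now apply Cmod_gt_0.
  assert (E : (Cmod t * Cmod t = Re t ^ 2 + Im t ^ 2)%R) by (rewrite <- Cmod2_alt; ring).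
  rewrite E. reflexivity.
Qed.

(** 1 - t is the product of - t and 1 - 1/t, whose imaginary parts have opposite signs when t is not
    real, so the sum of the principal arguments stays between -PI and PI. For t < 0 both factors are
    positive. *)
Lemma Clog_one_minus (t : C) : ~ (Im t = 0%R /\ (0 <= Re t)%R) ->
  Clog (1 - t) = Clog (- t) + Clog (1 - / t).
Proof.
  intros Ht. assert (Hn : t <> 0).
  { intros E. apply Ht. rewrite E. simpl. split; [reflexivity | lra]. }
  assert (S1 : slit (- t)).
  { intros [H1 H2]. rewrite im_opp in H1. rewrite re_opp in H2. apply Ht. split; lra. }
  assert (S2 : slit (1 - / t)).
  { assert (H := slit_of_off t 1 Ht ltac:(lra)). now rewrite Cmult_1_l in H. }
  assert (P : (0 < Cmod t * Cmod t)%R) by (apply Rmult_lt_0_compat; now apply Cmod_gt_0).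
  assert (I2 : Im (1 - / t) = (Im t / (Cmod t * Cmod t))%R).
  { unfold Cminus. rewrite im_plus, im_opp, im_RtoC, im_inv by exact Hn. field. intros E. rewrite E in P. lra. }
  assert (Pi : (0 < / (Cmod t * Cmod t))%R) by now apply Rinv_0_lt_compat.
  assert (B1 := Carg_slit _ S1). assert (B2 := Carg_slit _ S2).
  rewrite <- Clog_mult.
  - f_equal. field. exact Hn.
  - now apply slit_nz.
  - now apply slit_nz.
  - destruct (Rtotal_order (Im t) 0) as [L|[E|G]].
    + assert (A1 : (0 <= Carg (- t))%R) by (apply Carg_nonneg; rewrite im_opp; lra).
      assert (A2 : (Carg (1 - / t) <= 0)%R) by (apply Carg_nonpos; rewrite I2; unfold Rdiv; nra).
      lra.
    + rewrite (Carg_pos_real (- t)).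
      * rewrite Rplus_0_l. lra.
      * rewrite im_opp. lra.
      * rewrite re_opp. apply Rnot_le_lt. intros H. apply Ht. split; lra.
    + assert (A1 : (Carg (- t) <= 0)%R) by (apply Carg_nonpos; rewrite im_opp; lra).
      assert (A2 : (0 <= Carg (1 - / t))%R) by (apply Carg_nonneg; rewrite I2; unfold Rdiv; nra).
      lra.
Qed.

(** The two powers merge into a single one of exponent - nu, whose real part is positive in the
    application; this removes the difficulty at t = 1. *)
Lemma Cpower_off (t nu : C) : ~ (Im t = 0%R /\ (0 <= Re t)%R) ->
  Cpower (- t) nu * Cpower (1 - t) (1 - nu) = (1 - t) * Cpower (1 - / t) (- nu).
Proof.
  intros Ht. assert (Hn : t <> 0).
  { intros E. apply Ht. rewrite E. simpl. split; [reflexivity | lra]. }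
  assert (N1 : - t <> 0) by (intros E; apply Hn;
    replace t with (- - t) by ring; rewrite E; ring).
  assert (N2 : 1 - / t <> 0).
  { apply slit_nz. assert (H := slit_of_off t 1 Ht ltac:(lra)). now rewrite Cmult_1_l in H. }
  assert (N3 : 1 - t <> 0).
  { intros E. apply Ht. replace t with (RtoC 1).
    - simpl. split; [reflexivity | lra].
    - symmetry. apply Ceq_minus. replace (t - 1) with (- (1 - t)) by ring. rewrite E. ring. }
  unfold Cminus at 2. rewrite Cpower_plus, Cpower_1_r.
  replace (Cpower (- t) nu * ((1 - t) * Cpower (1 - t) (- nu)))
    with ((1 - t) * (Cpower (- t) nu * Cpower (1 - t) (- nu))) by ring.
  f_equal. rewrite !Cpower_nz by assumption. rewrite <- Cexp_plus. f_equal.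
  rewrite Clog_one_minus by exact Ht. ring.
Qed.

Section LoopSeries.
Context (g : R -> C) (Hloop : loop_1_0plus g) (x nu : C) (hnu : (Re nu < 0)%R).

Definition ypow (t : C) : C := Cpower (- t) nu * Cpower (1 - t) (1 - nu).

Lemma nu_opp_pos : (0 < Re (- nu))%R.
Proof. rewrite re_opp. lra. Qed.

Lemma ypow_loop s : (0 <= s <= 1)%R -> ypow (g s) = (1 - g s) * Cpower (1 - / g s) (- nu).
Proof.
  (* At the endpoints the left side vanishes by the convention 0^a = 0, the right side by its factor
     1 - g s. *)
  intros Hs. unfold ypow. destruct (Req_dec s 0) as [->|N0]; [|destruct (Req_dec s 1) as [->|N1]].
  - rewrite (loop_start g Hloop). replace (1 - 1) with (RtoC 0) by ring.
    rewrite (Cpower_0 (1 - nu)). ring.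
  - rewrite (loop_end g Hloop). replace (1 - 1) with (RtoC 0) by ring.
    rewrite (Cpower_0 (1 - nu)). ring.
  - apply Cpower_off. apply (loop_off g Hloop). lra.
Qed.

Lemma re_scal_opp q : (0 < Re (INR (S q) * - nu))%R.
Proof.
  rewrite re_scal_l. apply Rmult_lt_0_compat; [apply lt_0_INR; lia | apply nu_opp_pos].
Qed.

Definition ykernel (k : nat) (t : C) : C := ypow t ^ k / (t * (t - 1)).

(** The factor (1 - t)^(q+1) cancels the pole 1 / (t - 1); the sign comes from 1 - t against t -
    1. *)
Lemma ykernel_loop q s : (0 <= s <= 1)%R ->
  ykernel (S q) (g s) = - ((1 - g s) ^ q * Cpower (1 - / g s) (INR (S q) * - nu) * / g s).
Proof.
  intros Hs. unfold ykernel. rewrite (ypow_loop s Hs).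
  (* At t = 1 the quotient is a division by zero; both sides are still 0, the left one through its
     numerator, the right one through [Cpower_0]. *)
  destruct (Ceq_dec (g s) 1) as [->|N].
  - replace (1 - / 1) with (RtoC 0) by field. rewrite !Cpower_0, Cmult_0_r, Cpow_S. unfold Cdiv. ring.
  - rewrite Cpow_mult_l, Cpower_pow, Cpow_S.
    assert (Hn := loop_nz g Hloop s Hs).
    assert (N' : g s - 1 <> 0) by now apply Cminus_eq_contra.
    field. split; assumption.
Qed.

Lemma ykernel_cont q : Ccont_on 0 1 (fun s => ykernel (S q) (g s)).
Proof.
  apply Ccont_on_ext with (fun s => 0 -
    ((1 - g s) ^ q * Cpower (1 - / g s) (INR (S q) * - nu) * / g s)).
  - intros s Hs. rewrite ykernel_loop by exact Hs. ring.
  - apply Ccont_on_minus; [apply Ccont_on_const|].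
    apply Ccont_on_mult; [apply Ccont_on_mult|].
    + now apply loop_pow_cont.
    + apply loop_Cpower_cont_1; [exact Hloop | apply re_scal_opp].
    + now apply loop_inv_cont.
Qed.

(** What the coefficient of index [k] of [K] contributes to that of z^l in e^z times the integrand,
    with e^z e^(-xtz) expanded as e^((1-xt)z). *)
Definition matM_fun (l k : nat) (t : C) : C :=
  x ^ k * (expc (l - k) * (1 - x * t) ^ (l - k)) * ykernel k t.

Definition matM (l k : nat) : C := path_int (matM_fun l k) g.

Lemma matM_fun_cont l q : Ccont_on 0 1 (fun s => matM_fun l (S q) (g s)).
Proof.
  apply Ccont_on_mult; [|apply ykernel_cont].
  apply Ccont_on_mult; [apply Ccont_on_const|].
  apply Ccont_on_mult; [apply Ccont_on_const|].
  apply Ccont_on_pow, Ccont_on_minus; [apply Ccont_on_const|].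
  apply Ccont_on_mult; [apply Ccont_on_const | now apply loop_cont].
Qed.

Lemma matM_correct l q : is_CRInt (path_integrand (matM_fun l (S q)) g) 0 1 (matM l (S q)).
Proof.
  apply is_CRInt_correct, path_integrand_ex; [apply Hloop | apply matM_fun_cont].
Qed.

(** The index k = 0 is left out because [ykernel] has a pole at t = 1 there; this is harmless since
    [K] vanishes at 0. *)
Definition opM_csum (kc : nat -> C) (l : nat) (t : C) : C :=
  csum (fun q => kc (S q) * matM_fun l (S q) t) l.

Lemma opM_csum_full (kc : nat -> C) l t : kc O = 0 ->
  opM_csum kc l t = csum (fun k => kc k * matM_fun l k t) (S l).
Proof. intros H. rewrite csum_first, H. unfold opM_csum. ring. Qed.

(** For fixed t the factor 1 / (t (t - 1)) is a mere constant, so the expansion holds for every t,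
    including t = 1 with the conventional value of the inverse. *)
Lemma inv_integrand_series kc K z t : good kc -> kc O = 0 ->
  (forall z, is_Cseries (fun n => kc n * z ^ n) (K z)) ->
  is_Cseries (fun l => opM_csum kc l t * z ^ l) (Cexp z * inv_integrand x nu K z t).
Proof.
  intros Hk Hk0 HK.
  set (B1 := fun b => kc b * (x ^ b * ykernel b t)).
  set (B2 := fun j => expc j * (1 - x * t) ^ j).
  assert (G1 : good B1).
  { apply rgood_le with (2 := rgood_geom _ (Cmod (x * ypow t)) (Cmod (/ (t * (t - 1))))
      (Cmod_ge_0 _) (Cmod_ge_0 _) Hk).
    intros n. split; [apply Cmod_ge_0|]. right. unfold B1, ykernel, Cdiv.
    rewrite !Cmod_mult, !Cmod_pow, Rpow_mult_distr. ring. }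
  assert (G2 : good B2).
  { apply rgood_le with (2 := rgood_geom _ (Cmod (1 - x * t)) 1
      (Cmod_ge_0 _) ltac:(lra) good_expc).
    intros n. split; [apply Cmod_ge_0|]. right. unfold B2.
    rewrite Cmod_mult, Cmod_pow. ring. }
  assert (S := PS_conv B1 B2 z G1 G2).
  assert (E1 : PS B1 z = / (t * (t - 1)) * K (x * z * ypow t)).
  { apply PS_good_unique.
    apply is_Cseries_ext with (2 := is_Cseries_scal (/ (t * (t - 1))) _ _ (HK (x * z * ypow t))).
    intros n. unfold B1, ykernel, Cdiv. rewrite !Cpow_mult_l. ring. }
  assert (E2 : PS B2 z = Cexp z * Cexp (- (x * t * z))).
  { apply PS_good_unique. rewrite <- Cexp_plus.
    apply is_Cseries_ext with (2 := is_Cseries_Cexp (z + - (x * t * z))).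
    intros n. unfold B2. replace (z + - (x * t * z)) with ((1 - x * t) * z) by ring.
    rewrite Cpow_mult_l. ring. }
  rewrite E1, E2 in S.
  replace (Cexp z * inv_integrand x nu K z t)
    with (/ (t * (t - 1)) * K (x * z * ypow t) * (Cexp z * Cexp (- (x * t * z)))).
  - apply is_Cseries_ext with (2 := S). intros n. f_equal.
    rewrite opM_csum_full by exact Hk0. apply csum_ext. intros k _.
    unfold B1, B2, matM_fun. ring.
  - unfold inv_integrand, ypow, Cdiv. rewrite !Cmult_assoc. ring.
Qed.

Definition opM_coef (kc : nat -> C) (l : nat) : C :=
  (1 - x) / (2 * Ci * PI * x) * csum (fun q => kc (S q) * matM l (S q)) l.

Lemma opM_csum_correct kc l : is_CRInt (path_integrand (opM_csum kc l) g) 0 1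
  (csum (fun q => kc (S q) * matM l (S q)) l).
Proof.
  apply is_CRInt_ext with (fun s => csum (fun q => kc (S q) * path_integrand (matM_fun l (S q)) g s) l);
    [lra| |].
  - intros s _. unfold path_integrand, opM_csum.
    rewrite Cmult_comm, <- csum_scal. apply csum_ext. intros q _. ring.
  - apply is_CRInt_csum. intros q _. apply is_CRInt_scal, matM_correct.
Qed.

Lemma opM_csum_bound kc : good kc -> kc O = 0 -> exists mu, rgood mu /\
  forall l s, (0 <= s <= 1)%R -> (Cmod (opM_csum kc l (g s) * path_derive g s)%C <= mu l)%R.
Proof.
  intros Hk Hk0.
  destruct (path_derive_bounded g (proj1 Hloop)) as (B & PB & HB).
  destruct (Ccont_on_bounded 0 1 _ ltac:(lra) (loop_inv_cont g Hloop)) as (T & PT & HT).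
  destruct (Ccont_on_bounded 0 1 _ ltac:(lra) (loop_pow_cont g Hloop 1)) as (W & PW & HW).
  destruct (Ccont_on_bounded 0 1 _ ltac:(lra)
    (loop_Cpower_cont_1 g Hloop (- nu) nu_opp_pos)) as (P & PP & HP).
  assert (HV : Ccont_on 0 1 (fun s => 1 - x * g s)).
  { apply Ccont_on_minus; [apply Ccont_on_const|].
    apply Ccont_on_mult; [apply Ccont_on_const | now apply loop_cont]. }
  destruct (Ccont_on_bounded 0 1 _ ltac:(lra) HV) as (V & PV & HVb).
  (* Enlarging [W] to W + 1 >= 1 allows the power q of 1 - t to be bounded by a power q + 1,
     matching the other factors. *)
  set (X := (Cmod x * ((W + 1) * P))%R).
  assert (HX : (0 <= X)%R).
  { unfold X. apply Rmult_le_pos; [apply Cmod_ge_0 | apply Rmult_le_pos; lra]. }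
  set (al := fun k => (T * (Cmod (kc k) * X ^ k))%R).
  set (be := fun j => (1 * (Cmod (expc j) * V ^ j))%R).
  assert (Gal : rgood al) by (apply rgood_geom; [exact HX | lra | exact Hk]).
  assert (Gbe : rgood be) by (apply rgood_geom; [lra | lra | apply good_expc]).
  exists (fun l => (B * (rconv al be l * 1 ^ l))%R). split.
  { apply rgood_geom; [lra | lra | now apply rgood_conv]. }
  intros l s Hs. rewrite Cmod_mult, pow1, Rmult_1_r, Rmult_comm.
  apply Rmult_le_compat; [apply Cmod_ge_0 | apply Cmod_ge_0 | now apply HB |].
  rewrite opM_csum_full by exact Hk0. apply csum_Cmod. intros k _.
  assert (Hbe : (Cmod (expc (l - k) * (1 - x * g s) ^ (l - k))%C <= be (l - k)%nat)%R).
  { unfold be. rewrite Cmod_mult, Cmod_pow, Rmult_1_l.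
    apply Rmult_le_compat_l; [apply Cmod_ge_0|]. apply pow_incr.
    split; [apply Cmod_ge_0 | now apply HVb]. }
  assert (Pbe := proj1 Gbe (l - k)%nat). assert (Pal := proj1 Gal k).
  destruct k as [|q].
  { rewrite Hk0, Cmult_0_l, Cmod_0. now apply Rmult_le_pos. }
  unfold matM_fun.
  replace (kc (S q) * (x ^ S q * (expc (l - S q) * (1 - x * g s) ^ (l - S q)) * ykernel (S q) (g s)))
    with (kc (S q) * (x ^ S q * ykernel (S q) (g s)) * (expc (l - S q) * (1 - x * g s) ^ (l - S q)))
    by ring.
  rewrite Cmod_mult. apply Rmult_le_compat; [apply Cmod_ge_0 | apply Cmod_ge_0 | | exact Hbe].
  unfold al. rewrite ykernel_loop, <- Cpower_pow by exact Hs.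
  rewrite !Cmod_mult, Cmod_opp, !Cmod_mult, !Cmod_pow.
  replace (T * (Cmod (kc (S q)) * X ^ S q))%R
    with (Cmod (kc (S q)) * (Cmod x ^ S q * ((W + 1) ^ S q * P ^ S q * T)))%R
    by (unfold X; rewrite !Rpow_mult_distr; ring).
  apply Rmult_le_compat_l; [apply Cmod_ge_0|].
  apply Rmult_le_compat_l; [apply pow_le, Cmod_ge_0|].
  specialize (HW s Hs). rewrite Cpow_1_r in HW.
  apply Rmult_le_compat; [|apply Cmod_ge_0| |now apply HT].
  { apply Rmult_le_pos; apply pow_le, Cmod_ge_0. }
  apply Rmult_le_compat; [apply pow_le, Cmod_ge_0 | apply pow_le, Cmod_ge_0 | |].
  - apply Rle_trans with ((W + 1) ^ q)%R.
    + apply pow_incr. split; [apply Cmod_ge_0 | lra].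
    + apply Rle_pow; [lra | lia].
  - apply pow_incr. split; [apply Cmod_ge_0 | now apply HP].
Qed.

Lemma opM_PS kc K : good kc -> kc O = 0 ->
  (forall z, is_Cseries (fun n => kc n * z ^ n) (K z)) ->
  good (opM_coef kc) /\ forall z,
    ex_CRInt (path_integrand (inv_integrand x nu K z) g) 0 1 /\
    is_Cseries (fun n => opM_coef kc n * z ^ n)
      ((1 - x) / (2 * Ci * PI * x) * Cexp z * path_int (inv_integrand x nu K z) g).
Proof.
  intros Hk Hk0 HK. destruct (opM_csum_bound kc Hk Hk0) as (mu & Gmu & Hmu).
  set (kappa := (1 - x) / (2 * Ci * PI * x)). split.
  - apply rgood_le with (2 := rgood_geom mu 1 (Cmod kappa) ltac:(lra) (Cmod_ge_0 _) Gmu).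
    intros l. split; [apply Cmod_ge_0|]. unfold opM_coef. fold kappa.
    rewrite Cmod_mult, pow1, Rmult_1_r. apply Rmult_le_compat_l; [apply Cmod_ge_0|].
    rewrite <- (Rmult_1_l (mu l)). rewrite <- (Rminus_0_r 1) at 1.
    refine (is_CRInt_Cmod_le _ 0 1 _ _ _ _ (opM_csum_correct kc l)); [lra|].
    intros s Hs. now apply Hmu.
  - intros z.
    assert (HI : forall l, is_CRInt (fun s => path_integrand (opM_csum kc l) g s * z ^ l) 0 1
      (csum (fun q => kc (S q) * matM l (S q)) l * z ^ l)).
    { intros l. rewrite Cmult_comm.
      apply is_CRInt_ext with (fun s => z ^ l * path_integrand (opM_csum kc l) g s);
        [lra | intros; ring |]. apply is_CRInt_scal, opM_csum_correct. }
    destruct (is_CRInt_series (fun l s => path_integrand (opM_csum kc l) g s * z ^ l)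
      (fun s => Cexp z * path_integrand (inv_integrand x nu K z) g s)
      (fun l => mu l * Cmod z ^ l)%R 0 1) as (L & HL & HS).
    + lra.
    + intros l. eexists. apply HI.
    + intros l s Hs. rewrite Cmod_mult, Cmod_pow.
      apply Rmult_le_compat_r; [apply pow_le, Cmod_ge_0 | now apply Hmu].
    + apply Gmu. apply Cmod_ge_0.
    + intros s _. unfold path_integrand.
      replace (Cexp z * (inv_integrand x nu K z (g s) * path_derive g s))
        with (path_derive g s * (Cexp z * inv_integrand x nu K z (g s))) by ring.
      apply is_Cseries_ext with (fun l => path_derive g s * (opM_csum kc l (g s) * z ^ l));
        [intros; ring|]. apply is_Cseries_scal. now apply inv_integrand_series.
    (* The expansion was made for e^z times the integrand; the factor is taken out again after
       integration. *)
    + assert (HP : is_CRInt (path_integrand (inv_integrand x nu K z) g) 0 1 (Cexp (- z) * L)).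
      { apply is_CRInt_ext with (fun s => Cexp (- z) *
          (Cexp z * path_integrand (inv_integrand x nu K z) g s)); [lra| |now apply is_CRInt_scal].
        intros s _. rewrite Cmult_assoc, (Cmult_comm (Cexp (- z))), Cexp_opp_r. ring. }
      split; [eexists; exact HP|].
      replace (kappa * Cexp z * path_int (inv_integrand x nu K z) g) with (kappa * L).
      * apply is_Cseries_ext with (2 := is_Cseries_scal kappa _ _ HS). intros l.
        rewrite (RInt_to_C _ _ _ _ (HI l)). unfold opM_coef. fold kappa. ring.
      * unfold path_int. rewrite (RInt_to_C _ _ _ _ HP).
        transitivity (kappa * (Cexp z * Cexp (- z)) * L); [rewrite Cexp_opp_r|]; ring.
Qed.

End LoopSeries.

(** * The two triangular matrices are inverse to each other *)

Lemma INR_S_nz n : RtoC (INR (S n)) <> 0.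
Proof. intros E. apply RtoC_inj in E. revert E. apply not_0_INR. lia. Qed.

Lemma expc_0 : expc 0 = 1.
Proof. unfold expc. simpl. now rewrite Rinv_1. Qed.

(* Both sides are the coefficients of [exp (u z) * exp (v z) = exp ((u + v) z)]. *)
Lemma expc_binomial (u v : C) n :
  csum (fun j => expc j * u ^ j * (expc (n - j) * v ^ (n - j))) (S n) = expc n * (u + v) ^ n.
Proof.
  assert (G : forall w, good (fun j => expc j * w ^ j)).
  { intros w. apply rgood_le with (2 := rgood_geom _ (Cmod w) 1 (Cmod_ge_0 _) ltac:(lra) good_expc).
    intros j. split; [apply Cmod_ge_0|]. right. rewrite Cmod_mult, Cmod_pow. ring. }
  assert (P : forall w z, PS (fun j => expc j * w ^ j) z = Cexp (w * z)).
  { intros w z. apply PS_good_unique. apply is_Cseries_ext with (2 := is_Cseries_Cexp (w * z)).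
    intros j. rewrite Cpow_mult_l. ring. }
  change (conv (fun j => expc j * u ^ j) (fun j => expc j * v ^ j) n = expc n * (u + v) ^ n).
  apply (Cseries_pow_unique (conv (fun j => expc j * u ^ j) (fun j => expc j * v ^ j))
    (fun j => expc j * (u + v) ^ j) 1); [lra| | |].
  - assert (GC := rgood_conv _ _ (G u) (G v)).
    apply (ex_series_Rle _ _) with (2 := proj2 GC 1%R ltac:(lra)). intros j.
    rewrite Rabs_pos_eq.
    + apply Rmult_le_compat_r; [apply pow_le; lra|]. apply conv_Cmod; intros; lra.
    + apply Rmult_le_pos; [apply Cmod_ge_0 | apply pow_le; lra].
  - apply (proj2 (G (u + v)) 1%R). lra.
  - intros z _. exists (Cexp ((u + v) * z)). split.
    + replace (Cexp ((u + v) * z)) with (Cexp (u * z) * Cexp (v * z)).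
      * rewrite <- !P. apply PS_conv; apply G.
      * rewrite <- Cexp_plus. f_equal. ring.
    + rewrite <- P. apply PS_correct, G.
Qed.

Lemma Rdiff_csum (f df : nat -> R -> C) (s : R) n :
  (forall k, (k < n)%nat -> Rdiff (f k) s (df k s)) ->
  Rdiff (fun s => csum (fun k => f k s) n) s (csum (fun k => df k s) n).
Proof.
  induction n as [|n IH]; intros H; simpl.
  - apply Cdiff_const. tc.
  - apply Cdiff_plus; [tc | apply IH; auto with arith | apply H; auto with arith].
Qed.

Lemma csum_add (f : nat -> C) m n : csum f (m + n) = csum f m + csum (fun i => f (m + i)%nat) n.
Proof.
  induction n as [|n IH].
  - rewrite Nat.add_0_r. simpl. ring.
  - rewrite Nat.add_succ_r. simpl. rewrite IH. ring.
Qed.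

Section Algebra.
Context (x nu : C) (hx : slit x) (hx1 : x <> 1) (hnu : (Re nu < 0)%R)
  (g : R -> C) (Hloop : loop_1_0plus g).

Let D := dker x.
Let Rk := kerR x nu.

Lemma one_minus_x_nz : 1 - x <> 0.
Proof. apply Cminus_eq_contra. intros E. now apply hx1. Qed.

Lemma one_minus_nu_nz : 1 - nu <> 0.
Proof.
  intros E. apply (f_equal Re) in E. unfold Cminus in E.
  rewrite re_plus, re_opp, !re_RtoC in E. lra.
Qed.

(** * Beta integrals on the s side *)

Definition monoker (b p m : nat) (s : R) : C := Rk s ^ b * (s ^ p * D s ^ m).

Lemma monoker_cont b p m : Ccont_on 0 1 (monoker b p m).
Proof.
  apply Ccont_on_mult; [apply Ccont_on_pow; now apply kerR_cont|].
  apply Ccont_on_mult; apply Ccont_on_pow; [apply Ccont_on_RtoC | apply dker_cont].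
Qed.

Lemma D_inv_cont : Ccont_on 0 1 (fun s => / D s).
Proof. apply Ccont_on_inv; [intros s; now apply dker_nz | apply dker_cont]. Qed.

(* [x^p] times this is the Beta integral of [(1-u)^(-b nu) u^(p-1)] in the variable
   [u = x s / D s]; here [b = p + m] and [p - 1] is [q]. *)
Definition betaI (b q m : nat) : C := CRInt (fun s => monoker b q m s * / D s) 0 1.

Lemma betaI_correct b q m : is_CRInt (fun s => monoker b q m s * / D s) 0 1 (betaI b q m).
Proof.
  apply is_CRInt_correct, Ccont_on_ex_RInt; [lra|].
  apply Ccont_on_mult; [apply monoker_cont | apply D_inv_cont].
Qed.

(** The primitive is taken with a factor 1 - s, which cancels the pole of R' / R at s = 1 and leaves
    D as the only denominator. *)
Definition monoker_derive_num (b p m : nat) (s : R) : C :=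
  monoker b p m s * (INR b * (D s - x + nu * x) - (1 - s) * (1 - x) * INR m - D s)
  + (1 - s) * D s * (INR p * monoker b (pred p) m s).

Lemma monoker_primitive b p m s : (0 < s < 1)%R ->
  Rdiff (fun s => (1 - s) * monoker b p m s) s (monoker_derive_num b p m s * / D s).
Proof.
  intros Hs. assert (ND := dker_nz x hx s ltac:(lra)). fold (D s) in ND.
  assert (N1 : 1 - s <> 0) by (apply slit_nz, one_minus_slit; lra).
  assert (D1 : Rdiff (fun s : R => 1 - s) s (0 - 1)).
  { apply Cdiff_minus; [tc | apply Cdiff_const; tc
      | apply Cdiff_id; tc]. }
  assert (DR := Cdiff_pow _ RtoC s Rk _ b (Clim_RtoC s) (kerR_derive x nu hx s Hs)).
  assert (Dp := Cdiff_pow _ RtoC s RtoC _ p (Clim_RtoC s) (Cdiff_id _ RtoC s)).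
  assert (DD := Cdiff_pow _ RtoC s D _ m (Clim_RtoC s) (dker_derive x s)).
  eapply Cdiff_eq; [|exact (Cdiff_mult _ RtoC s _ _ _ _ (Clim_RtoC s) D1
    (Cdiff_mult _ RtoC s _ _ _ _ (Clim_RtoC s) DR
      (Cdiff_mult _ RtoC s _ _ _ _ (Clim_RtoC s) Dp DD)))].
  cbv beta. unfold monoker_derive_num, monoker. fold (Rk s). fold (D s).
  destruct b as [|b], m as [|m]; cbn [pred]; rewrite ?Cpow_S.
  all: change (INR 0) with 0%R; unfold D, dker in *; field; split; assumption.
Qed.

Lemma monoker_S b q m s : monoker b (S q) m s = s * monoker b q m s.
Proof. unfold monoker. rewrite Cpow_S. ring. Qed.

Lemma monoker_S_D b q m s : monoker b q (S m) s = D s * monoker b q m s.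
Proof. unfold monoker. rewrite (Cpow_S (D s)). ring. Qed.

(** At s = 1 the factor 1 - s vanishes; at s = 0 both R and D equal 1 and 0^p remains, which is
    nonzero for p = 0 only. *)
Lemma monoker_FTC b p m (h : R -> C) : Ccont_on 0 1 h ->
  (forall s, (0 < s < 1)%R -> monoker_derive_num b p m s * / D s = h s) ->
  is_CRInt h 0 1 (- 0 ^ p).
Proof.
  intros Hc H.
  replace (- 0 ^ p) with ((1 - 1%R) * monoker b p m 1 - (1 - 0%R) * monoker b p m 0).
  - apply (CFTC 0 1 (fun s => (1 - s) * monoker b p m s)); [lra | | exact Hc |].
    + apply Ccont_on_mult; [apply one_minus_cont | apply monoker_cont].
    + intros s Hs. rewrite <- H by exact Hs. now apply monoker_primitive.
  - unfold monoker, Rk. rewrite kerR_0.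
    assert (E : D 0 = 1) by (unfold D, dker; ring). rewrite E, !Cpow_1_l. ring.
Qed.

(** In the variable u this is the elementary integral of (1 - u)^(-b nu). *)
Lemma betaI_0 m : x * (1 - INR (S m) * nu) * betaI (S m) 0 m = 1.
Proof.
  assert (HI := is_CRInt_scal (- (x * (1 - INR (S m) * nu))) _ _ _ _ (betaI_correct (S m) 0 m)).
  assert (HF := monoker_FTC (S m) 0 m
    (fun s => - (x * (1 - INR (S m) * nu)) * (monoker (S m) 0 m s * / D s))).
  assert (E : - (x * (1 - INR (S m) * nu)) * betaI (S m) 0 m = - 0 ^ 0).
  { rewrite <- (RInt_to_C _ _ _ _ HI). apply RInt_to_C. apply HF.
    - apply Ccont_on_mult; [apply Ccont_on_const|].
      apply Ccont_on_mult; [apply monoker_cont | apply D_inv_cont].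
    - intros s Hs. assert (ND := dker_nz x hx s ltac:(lra)). unfold monoker_derive_num.
      change (INR 0) with 0%R. rewrite S_INR, RtoC_plus. fold (D s) in ND.
      unfold D, dker in *. field. exact ND. }
  replace (x * (1 - INR (S m) * nu) * betaI (S m) 0 m)
    with (- (- (x * (1 - INR (S m) * nu)) * betaI (S m) 0 m)) by ring.
  rewrite E. simpl. ring.
Qed.

(** In the variable u the exact derivative is, up to a constant, that of (1 - u)^(1 - b nu) u^(q+1).
    As b is fixed, raising p lowers m. *)
Lemma betaI_rec b q m : b = (m + S (S q))%nat ->
  (INR (S (S q)) - INR b * nu) * x * betaI b (S q) m = INR (S q) * betaI b q (S m).
Proof.
  intros Eb.
  assert (Eb' : RtoC (INR b) = INR m + INR (S q) + 1).
  { rewrite Eb, plus_INR, (S_INR (S q)), !RtoC_plus. ring. }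
  set (h := fun s => INR (S q) * (monoker b q (S m) s * / D s)
    - (INR (S (S q)) - INR b * nu) * x * (monoker b (S q) m s * / D s)).
  assert (HI : is_CRInt h 0 1 (INR (S q) * betaI b q (S m)
    - (INR (S (S q)) - INR b * nu) * x * betaI b (S q) m)).
  { apply is_CRInt_minus; apply is_CRInt_scal; apply betaI_correct. }
  symmetry. apply Ceq_minus. rewrite <- (RInt_to_C _ _ _ _ HI).
  transitivity (- 0 ^ S q); [|rewrite Cpow_S; ring].
  apply RInt_to_C. apply (monoker_FTC b (S q) m).
  - apply Ccont_on_minus; (apply Ccont_on_mult; [apply Ccont_on_const|];
      apply Ccont_on_mult; [apply monoker_cont | apply D_inv_cont]).
  - intros s Hs. assert (ND := dker_nz x hx s ltac:(lra)). unfold monoker_derive_num, h.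
    rewrite monoker_S_D, monoker_S. cbn [pred]. rewrite (S_INR (S q)), RtoC_plus, Eb'.
    set (M := monoker b q m s). fold (D s) in ND. unfold D, dker in *. field. exact ND.
Qed.

(** The operator (1 - b) + (s - c) d/ds applied to s^p D^m. *)
Definition sfun (b p m : nat) (s : R) : C :=
  (1 - INR b) * (s ^ p * D s ^ m) + (s - cpar x nu)
    * (INR p * s ^ pred p * D s ^ m + s ^ p * (INR m * D s ^ pred m * - (1 - x))).

Lemma sfun_cont b p m : Ccont_on 0 1 (sfun b p m).
Proof.
  assert (C1 : forall n, Ccont_on 0 1 (fun s : R => s ^ n)).
  { intros n. apply Ccont_on_pow, Ccont_on_RtoC. }
  assert (C2 : forall n, Ccont_on 0 1 (fun s : R => D s ^ n)).
  { intros n. apply Ccont_on_pow, dker_cont. }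
  apply Ccont_on_plus; [repeat apply Ccont_on_mult; auto using Ccont_on_const|].
  apply Ccont_on_mult; [apply Ccont_on_minus; auto using Ccont_on_const, Ccont_on_RtoC|].
  apply Ccont_on_plus; repeat apply Ccont_on_mult; auto using Ccont_on_const.
Qed.

(** With p = q + 1 and modulo the derivative of (1 - s) R^b s^p D^m, the integrand is -(c - 1) p R^b
    s^(p-1) D^m / D. This uses b = p + m, D + (1 - x) s = 1 and c - 1 = (1 - nu) x / (1 - x), the
    last being the reason for the value of c. *)
Lemma sfun_RInt q m : is_CRInt (fun s => Rk s ^ (S q + m) * sfun (S q + m) (S q) m s) 0 1
  (- ((1 - nu) * x / (1 - x)) * (INR (S q) * betaI (S q + m) q m)).
Proof.
  set (b := (S q + m)%nat). set (kap := (1 - nu) * x / (1 - x)).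
  assert (Eb : RtoC (INR b) = INR (S q) + INR m).
  { unfold b. now rewrite plus_INR, RtoC_plus. }
  set (h := fun s => - (Rk s ^ b * sfun b (S q) m s)
    - kap * (INR (S q) * (monoker b q m s * / D s))).
  assert (HF : is_CRInt h 0 1 (- 0 ^ S q)).
  { apply (monoker_FTC b (S q) m).
    - apply Ccont_on_minus.
      + apply Ccont_on_ext with (fun s => - (1) * (Rk s ^ b * sfun b (S q) m s)); [intros; ring|].
        apply Ccont_on_mult; [apply Ccont_on_const|].
        apply Ccont_on_mult; [apply Ccont_on_pow; now apply kerR_cont | apply sfun_cont].
      + apply Ccont_on_mult; [apply Ccont_on_const|].
        apply Ccont_on_mult; [apply Ccont_on_const|].
        apply Ccont_on_mult; [apply monoker_cont | apply D_inv_cont].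
    - intros s Hs. assert (ND := dker_nz x hx s ltac:(lra)). fold (D s) in ND.
      assert (N1 := one_minus_x_nz).
      unfold monoker_derive_num, h, sfun. cbn [pred]. rewrite monoker_S.
      unfold monoker. rewrite Eb, Cpow_S. unfold kap, cpar.
      destruct m as [|m]; cbn [pred]; rewrite ?(Cpow_S (D s)).
      + change (INR 0) with 0%R. unfold D, dker in *. field. split; assumption.
      + unfold D, dker in *. field. split; assumption. }
  apply is_CRInt_ext with (fun s => - (1) * (h s + kap * (INR (S q) * (monoker b q m s * / D s))));
    [lra | intros; unfold h; ring |].
  replace (- kap * (INR (S q) * betaI b q m))
    with (- (1) * (- 0 ^ S q + kap * (INR (S q) * betaI b q m))) by (rewrite Cpow_S; ring).
  apply is_CRInt_scal, is_CRInt_plus; [exact HF|].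
  apply is_CRInt_scal, is_CRInt_scal, betaI_correct.
Qed.

(** * Products of Beta integrals and loop moments, and their telescoping sum *)

Lemma loop_tau_moment k0 j : is_CRInt (path_integrand
    (fun t => (1 - t) ^ j * ykernel nu (S k0) t) g) 0 1
  (- loop_moment g (k0 + j) (INR (S k0) * - nu)).
Proof.
  apply is_CRInt_ext with (fun s => - (1) * path_integrand
    (fun t => (1 - t) ^ (k0 + j) * Cpower (1 - / t) (INR (S k0) * - nu) * / t) g s); [lra| |].
  - intros s Hs. unfold path_integrand.
    rewrite (ykernel_loop g Hloop nu k0 s) by lra. rewrite Cpow_add_r. ring.
  - replace (- loop_moment g (k0 + j) (INR (S k0) * - nu))
      with (- (1) * loop_moment g (k0 + j) (INR (S k0) * - nu)) by ring.
    apply is_CRInt_scal. apply loop_moment_correct; [exact Hloop | now apply re_scal_opp].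
Qed.

(** Here p = k0 + 1 + j; the power x^p turns [betaI] into the Beta integral in the variable u. *)
Definition hval (k0 n j : nat) : C :=
  x ^ S (k0 + j) * (INR (S (k0 + j)) * betaI (S k0 + n) (k0 + j) (n - j))
    * loop_moment g (k0 + j) (INR (S k0) * - nu).

(** With p = k0 + 1 + j, k = k0 + 1 and b = k + n, the ratio of consecutive terms is (p + 1) (p - k
    nu) / (p (p + 1 - b nu)); it is stated without division. *)
Lemma hval_S k0 n j : (j < n)%nat ->
  hval k0 n (S j) * (INR (S (k0 + j)) * (INR (S (S (k0 + j))) - INR (S k0 + n) * nu))
  = hval k0 n j * (INR (S (S (k0 + j))) * (INR (S (k0 + j)) - INR (S k0) * nu)).
Proof.
  intros Hj. unfold hval. rewrite Nat.add_succ_r.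
  replace (n - j)%nat with (S (n - S j)) by lia.
  assert (E1 := betaI_rec (S k0 + n) (k0 + j) (n - S j) ltac:(lia)).
  assert (E2 := loop_moment_S g Hloop (k0 + j) (INR (S k0) * - nu) (re_scal_opp nu hnu k0)).
  set (B' := betaI (S k0 + n) (S (k0 + j)) (n - S j)) in *.
  set (B := betaI (S k0 + n) (k0 + j) (S (n - S j))) in *.
  set (X' := loop_moment g (S (k0 + j)) (INR (S k0) * - nu)) in *.
  set (X := loop_moment g (k0 + j) (INR (S k0) * - nu)) in *.
  rewrite (Cpow_S x (S (k0 + j))).
  transitivity (x ^ S (k0 + j) * INR (S (S (k0 + j)))
    * ((INR (S (S (k0 + j))) - INR (S k0 + n) * nu) * x * B') * (INR (S (k0 + j)) * X')); [ring|].
  rewrite E1, E2. ring.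
Qed.

(** For n = 0 both factors have the same exponent - b nu. The index is raised from 1 to b with b
    fixed, the factors from the two recurrences cancel, and the starting value is 2 i pi times an
    elementary integral. *)
Lemma hval_diag k0 : hval k0 0 0 * (1 - nu) = 2 * Ci * PI.
Proof.
  set (b := S k0). set (X := fun q => loop_moment g q (INR b * - nu)).
  assert (A : forall q m, b = (S q + m)%nat ->
    x ^ S q * (INR (S q) * betaI b q m) * X q * (INR (S q) - INR b * nu) = 2 * Ci * PI * INR (S q)).
  { induction q as [|q IH]; intros m Hm.
    - assert (E := betaI_0 m). assert (E0 := loop_moment_0 g Hloop (INR b * - nu) (re_scal_opp nu hnu k0)).
      unfold X. rewrite E0. rewrite Hm. change (S 0 + m)%nat with (S m).
      change (INR 1) with 1%R.
      transitivity (x * (1 - INR (S m) * nu) * betaI (S m) 0 m * (2 * Ci * PI)); [simpl; ring|].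
      rewrite E. ring.
    - assert (E1 := betaI_rec b q m ltac:(lia)).
      assert (E2 := loop_moment_S g Hloop q (INR b * - nu) (re_scal_opp nu hnu k0)).
      specialize (IH (S m) ltac:(lia)).
      unfold X in *. rewrite (Cpow_S x (S q)).
      assert (Hq := INR_S_nz q).
      assert (C1 : forall u v : C, INR (S q) * u = INR (S q) * v -> u = v).
      { intros u v E. transitivity (/ INR (S q) * (INR (S q) * u)); [field; exact Hq|].
        rewrite E. field. exact Hq. }
      apply C1.
      transitivity (x ^ S q * INR (S (S q)) * ((INR (S (S q)) - INR b * nu) * x * betaI b (S q) m)
        * (INR (S q) * loop_moment g (S q) (INR b * - nu))); [ring|].
      rewrite E1, E2.
      transitivity (INR (S (S q)) * (x ^ S q * (INR (S q) * betaI b q (S m))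
        * loop_moment g q (INR b * - nu) * (INR (S q) - INR b * nu))); [ring|].
      rewrite IH. ring. }
  specialize (A k0 0%nat ltac:(unfold b; lia)).
  unfold hval. rewrite !Nat.add_0_r. fold b.
  assert (Hb : RtoC (INR b) <> 0) by apply INR_S_nz.
  transitivity (/ INR b * (x ^ S k0 * (INR (S k0) * betaI b k0 0) * X k0 * (INR (S k0) - INR b * nu))).
  - unfold X. fold b. simpl (0 - 0)%nat. field. exact Hb.
  - rewrite A. fold b. field. exact Hb.
Qed.

(** The sum is hypergeometric, and its partial sum up to J is the rational multiple (n - J) (p - k
    nu) / (n p (1 - nu)) of its last term, where p = k0 + 1 + J and k = k0 + 1. This vanishes at J =
    n. *)
Lemma telescoping k0 n : (0 < n)%nat ->
  csum (fun j => (- (1)) ^ j * (expc j * expc (n - j)) * hval k0 n j) (S n) = 0.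
Proof.
  intros Hn. destruct n as [|n']; [lia|]. clear Hn. set (n := S n').
  set (f := fun j => (- (1)) ^ j * (expc j * expc (n - j)) * hval k0 n j).
  assert (Hnu := one_minus_nu_nz).
  assert (Cc : forall c u v : C, c <> 0 -> c * u = c * v -> u = v).
  { intros c u v Hc E. transitivity (/ c * (c * u)); [field; exact Hc|].
    rewrite E. field. exact Hc. }
  assert (Eb : RtoC (INR (S k0 + n)) = INR (S k0) + INR n).
  { now rewrite plus_INR, RtoC_plus. }
  assert (Ep : forall j, RtoC (INR (S (k0 + j))) = INR (S k0) + INR j).
  { intros j. change (S (k0 + j)) with (S k0 + j)%nat. now rewrite plus_INR, RtoC_plus. }
  (* The quotient (n - J) / (n - J)! is written as the inverse factorial of n - 1 - J; hence the
     bound J <= n - 1 and the separate treatment of the last term. *)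
  assert (A : forall J, (J <= n')%nat -> csum f (S J) * (INR n * INR (S (k0 + J)) * (1 - nu))
    = (- (1)) ^ J * (expc J * expc (n' - J)) * (INR (S (k0 + J)) - INR (S k0) * nu) * hval k0 n J).
  { induction J as [|J IH]; intros HJ.
    - simpl csum. unfold f. rewrite !Nat.sub_0_r, Nat.add_0_r. unfold n.
      rewrite <- (expc_S n'). simpl Cpow. ring.
    - specialize (IH ltac:(lia)).
      change (csum f (S (S J))) with (csum f (S J) + f (S J)). set (SJ := csum f (S J)) in *.
      assert (HS := hval_S k0 n J ltac:(unfold n; lia)).
      unfold f. replace (n - S J)%nat with (S (n' - S J)) by (unfold n; lia).
      replace (n' - J)%nat with (S (n' - S J)) in IH by lia.
      rewrite <- (expc_S (n' - S J)). rewrite <- (expc_S J) in IH.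
      rewrite Nat.add_succ_r.
      assert (Em : RtoC (INR (S (n' - S J))) = INR n - INR (S J)).
      { rewrite <- RtoC_minus, <- minus_INR by (unfold n; lia). do 2 f_equal. unfold n; lia. }
      rewrite Em. rewrite Cpow_S.
      set (EJ := expc (S J)) in *. set (EM := expc (S (n' - S J))) in *.
      set (h' := hval k0 n (S J)) in *. set (h := hval k0 n J) in *.
      apply (Cc (INR (S (k0 + J)))); [apply INR_S_nz|].
      transitivity (INR (S (S (k0 + J))) * (SJ * (INR n * INR (S (k0 + J)) * (1 - nu)))
        + INR (S (k0 + J)) * (- (1) * (- (1)) ^ J * (EJ * EM) * h' *
          (INR n * INR (S (S (k0 + J))) * (1 - nu)))); [ring|].
      rewrite IH.
      transitivity ((- (1)) ^ J * (EJ * INR (S J) * EM)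
          * (h * (INR (S (S (k0 + J))) * (INR (S (k0 + J)) - INR (S k0) * nu)))
        + INR (S (k0 + J)) * (- (1) * (- (1)) ^ J * (EJ * EM) * h' *
          (INR n * INR (S (S (k0 + J))) * (1 - nu)))); [ring|].
      rewrite <- HS, Eb.
      rewrite <- (Nat.add_succ_r k0 J), !Ep, (S_INR J), RtoC_plus. ring. }
  specialize (A n' (le_n _)). change (csum f (S n')) with (csum f n) in A.
  change (csum f (S n) = 0). change (csum f (S n)) with (csum f n + f n).
  assert (HS := hval_S k0 n n' ltac:(unfold n; lia)).
  set (SJ := csum f n) in *. unfold f.
  rewrite Nat.sub_diag in A. rewrite Nat.sub_diag, expc_0. fold n in HS.
  rewrite expc_0, <- (expc_S n') in A. fold n in A.
  replace (S (S (k0 + n'))) with (S k0 + n)%nat in HS by (unfold n; lia).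
  assert (Hb : RtoC (INR (S k0 + n)) <> 0) by (change (S k0 + n)%nat with (S (k0 + n)); apply INR_S_nz).
  assert (Hp := INR_S_nz (k0 + n')). assert (Hn := INR_S_nz n'). fold n in Hn.
  apply (Cc (INR (S k0 + n) * (INR n * INR (S (k0 + n')) * (1 - nu)))).
  { repeat apply Cmult_neq_0; assumption. }
  transitivity (INR (S k0 + n) * (SJ * (INR n * INR (S (k0 + n')) * (1 - nu)))
    + (- (1)) ^ n * (expc n * 1) * INR n * (hval k0 n n *
      (INR (S (k0 + n')) * (INR (S k0 + n) - INR (S k0 + n) * nu)))); [ring|].
  rewrite A, HS. unfold n at 3. rewrite (Cpow_S _ n').
  change (INR (S n')) with (INR n). ring.
Qed.

(** * Binomial change of basis and the product of the two matrices *)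

Definition bcoef (n j : nat) : C := expc j * expc (n - j) * x ^ j * (- (1)) ^ (n - j).

(** Both sides expand s^k / n! times the n-th power of s (1 - x t) - 1 = x s (1 - t) - D; the second
    form separates 1 - t, integrated along the loop, from s and D. *)
Lemma binomial_change k n (s : R) (t : C) :
  csum (fun i => altexp (n - i) * (expc i * (1 - x * t) ^ i) * s ^ (k + i)) (S n)
  = csum (fun j => bcoef n j * (1 - t) ^ j * (s ^ (k + j) * D s ^ (n - j))) (S n).
Proof.
  transitivity (s ^ k * (expc n * (s * (1 - x * t) + - (1)) ^ n)).
  - rewrite <- expc_binomial, <- csum_scal. apply csum_ext. intros i _.
    unfold altexp. rewrite Cpow_mult_l, Cpow_add_r. ring.
  - replace (s * (1 - x * t) + - (1)) with (x * s * (1 - t) + - D s) by (unfold D, dker; ring).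
    rewrite <- expc_binomial, <- csum_scal. apply csum_ext. intros j _.
    unfold bcoef. rewrite (opp_pow (D s)), !Cpow_mult_l, Cpow_add_r. ring.
Qed.

(** The preceding identity differentiated in s, through uniqueness of the derivative. *)
Lemma binomial_change_derive k n (s : R) (t : C) :
  csum (fun i => altexp (n - i) * (expc i * (1 - x * t) ^ i) * (INR (k + i) * s ^ pred (k + i))) (S n)
  = csum (fun j => bcoef n j * (1 - t) ^ j * (INR (k + j) * s ^ pred (k + j) * D s ^ (n - j)
      + s ^ (k + j) * (INR (n - j) * D s ^ pred (n - j) * - (1 - x)))) (S n).
Proof.
  assert (Dp : forall p, Rdiff (fun s : R => s ^ p) s (INR p * s ^ pred p)).
  { intros p. eapply Cdiff_eq; [|exact (Cdiff_pow _ RtoC s RtoC _ p (Clim_RtoC s) (Cdiff_id _ RtoC s))].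
    ring. }
  eapply Rdiff_unique.
  - apply (Rdiff_csum (fun i (s : R) => altexp (n - i) * (expc i * (1 - x * t) ^ i) * s ^ (k + i))
      (fun i (s : R) => altexp (n - i) * (expc i * (1 - x * t) ^ i) * (INR (k + i) * s ^ pred (k + i)))).
    intros i _. apply Cdiff_scal; [tc | apply Dp].
  - apply Cdiff_ext with (fun s : R => csum (fun j => bcoef n j * (1 - t) ^ j
      * (s ^ (k + j) * D s ^ (n - j))) (S n)); [tc| |].
    + intros u. symmetry. apply binomial_change.
    + apply (Rdiff_csum (fun j (s : R) => bcoef n j * (1 - t) ^ j * (s ^ (k + j) * D s ^ (n - j)))
        (fun j (s : R) => bcoef n j * (1 - t) ^ j * (INR (k + j) * s ^ pred (k + j) * D s ^ (n - j)
          + s ^ (k + j) * (INR (n - j) * D s ^ pred (n - j) * - (1 - x))))).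
      intros j _. apply Cdiff_scal; [tc|].
      exact (Cdiff_mult _ RtoC s _ _ _ _ (Clim_RtoC s) (Dp (k + j)%nat)
        (Cdiff_pow _ RtoC s D _ (n - j) (Clim_RtoC s) (dker_derive x s))).
Qed.

(** The operator (1 - b) + (s - c) d/ds is applied to the two forms of the binomial identity. *)
Lemma opL_poly_change k0 n (s : R) (t : C) :
  csum (fun i => opL_poly x nu (S k0 + n) (S k0 + i) s * (expc i * (1 - x * t) ^ i)) (S n)
  = csum (fun j => bcoef n j * (1 - t) ^ j * sfun (S k0 + n) (S k0 + j) (n - j) s) (S n).
Proof.
  set (k := S k0). set (b := (k + n)%nat).
  assert (E1 := binomial_change k n s t). assert (E2 := binomial_change_derive k n s t).
  transitivity ((1 - INR b) * csum (fun i => altexp (n - i) * (expc i * (1 - x * t) ^ i) * s ^ (k + i)) (S n)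
    + (s - cpar x nu) * csum (fun i => altexp (n - i) * (expc i * (1 - x * t) ^ i)
        * (INR (k + i) * s ^ pred (k + i))) (S n)).
  - rewrite <- !csum_scal, <- csum_plus. apply csum_ext. intros i Hi.
    unfold opL_poly, altexp1.
    replace (b - (k + i))%nat with (n - i)%nat by (unfold b; lia).
    assert (EI : RtoC (INR (n - i)) = INR b - INR (k + i)).
    { rewrite <- RtoC_minus, <- minus_INR by (unfold b; lia). do 2 f_equal. unfold b; lia. }
    rewrite EI. change (k + i)%nat with (S (k0 + i)). cbn [pred]. rewrite (Cpow_S s). ring.
  - rewrite E1, E2. rewrite <- !csum_scal, <- csum_plus. apply csum_ext. intros j _.
    unfold sfun. ring.
Qed.

(** The loop integral is done first, for each fixed s, and the integral in s afterwards. After the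
    change of basis every term splits into a function of s times a function of t, so linearity
    replaces any exchange of integrals. *)
Lemma mat_product k0 n :
  csum (fun i => matL x nu (S k0 + n) (S k0 + i) * matM g x nu (S k0 + i) (S k0)) (S n)
  = (1 - nu) * x / (1 - x) * (- (1)) ^ n
    * csum (fun j => (- (1)) ^ j * (expc j * expc (n - j)) * hval k0 n j) (S n).
Proof.
  set (k := S k0). set (b := (k + n)%nat).
  set (X := fun j => loop_moment g (k0 + j) (INR k * - nu)).
  assert (P : forall s : R, csum (fun i => opL_poly x nu b (k + i) s * matM g x nu (k + i) k) (S n)
    = x ^ k * csum (fun j => bcoef n j * sfun b (k + j) (n - j) s * - X j) (S n)).
  { intros s.
    assert (I1 : is_CRInt (fun u => csum (fun i => opL_poly x nu b (k + i) s
      * path_integrand (matM_fun x nu (k + i) k) g u) (S n)) 0 1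
      (csum (fun i => opL_poly x nu b (k + i) s * matM g x nu (k + i) k) (S n))).
    { apply is_CRInt_csum. intros i _. apply is_CRInt_scal. now apply matM_correct. }
    assert (I2 : is_CRInt (fun u => x ^ k * csum (fun j => bcoef n j * sfun b (k + j) (n - j) s
        * path_integrand (fun t => (1 - t) ^ j * ykernel nu k t) g u) (S n)) 0 1
      (x ^ k * csum (fun j => bcoef n j * sfun b (k + j) (n - j) s * - X j) (S n))).
    { apply is_CRInt_scal, is_CRInt_csum. intros j _. apply is_CRInt_scal, loop_tau_moment. }
    rewrite <- (RInt_to_C _ _ _ _ I1). apply RInt_to_C.
    apply is_CRInt_ext with (fun u => x ^ k * csum (fun j => bcoef n j * sfun b (k + j) (n - j) s
        * path_integrand (fun t => (1 - t) ^ j * ykernel nu k t) g u) (S n)); [lra| |exact I2].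
    intros u _. unfold path_integrand, matM_fun.
    transitivity (x ^ k * (ykernel nu k (g u) * path_derive g u) *
      csum (fun j => bcoef n j * (1 - g u) ^ j * sfun b (k + j) (n - j) s) (S n)).
    - rewrite <- !csum_scal. apply csum_ext. intros j _. ring.
    - unfold b, k. rewrite <- opL_poly_change. rewrite <- csum_scal. apply csum_ext. intros i _.
      replace (S k0 + i - S k0)%nat with i by lia. ring. }
  assert (I1 : is_CRInt (fun s => csum (fun i => matM g x nu (k + i) k
      * (Rk s ^ b * opL_poly x nu b (k + i) s)) (S n)) 0 1
    (csum (fun i => matM g x nu (k + i) k * matL x nu b (k + i)) (S n))).
  { apply is_CRInt_csum. intros i _. apply is_CRInt_scal. now apply matL_correct. }
  assert (I2 : is_CRInt (fun s => x ^ k * csum (fun j => bcoef n j * - X j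
      * (Rk s ^ b * sfun b (k + j) (n - j) s)) (S n)) 0 1
    (x ^ k * csum (fun j => bcoef n j * - X j
      * (- ((1 - nu) * x / (1 - x)) * (INR (S (k0 + j)) * betaI b (k0 + j) (n - j)))) (S n))).
  { apply is_CRInt_scal, is_CRInt_csum. intros j Hj. apply is_CRInt_scal.
    assert (H := sfun_RInt (k0 + j) (n - j)).
    replace (S (k0 + j) + (n - j))%nat with b in H by (unfold b, k; lia). exact H. }
  transitivity (csum (fun i => matM g x nu (k + i) k * matL x nu b (k + i)) (S n)).
  { apply csum_ext. intros i _. ring. }
  rewrite <- (RInt_to_C _ _ _ _ I1).
  transitivity (x ^ k * csum (fun j => bcoef n j * - X j
      * (- ((1 - nu) * x / (1 - x)) * (INR (S (k0 + j)) * betaI b (k0 + j) (n - j)))) (S n)).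
  - apply RInt_to_C.
    apply is_CRInt_ext with (fun s => x ^ k * csum (fun j => bcoef n j * - X j
      * (Rk s ^ b * sfun b (k + j) (n - j) s)) (S n)); [lra| |exact I2].
    intros s _.
    transitivity (Rk s ^ b * (x ^ k * csum (fun j => bcoef n j * sfun b (k + j) (n - j) s * - X j) (S n))).
    + rewrite <- !csum_scal. apply csum_ext. intros j _. ring.
    + rewrite <- P, <- csum_scal. apply csum_ext. intros i _. ring.
  - rewrite <- !csum_scal. apply csum_ext. intros j Hj. unfold hval, bcoef. fold k. fold b.
    fold (X j).
    replace (S (k0 + j)) with (k + j)%nat by (unfold k; lia). rewrite (Cpow_add_r x).
    (* The sign of [bcoef] is split into the prefactor and the alternating sign of the telescoping
       sum. *)
    assert (Es : (- (1)) ^ n * (- (1)) ^ j = (- (1)) ^ (n - j)).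
    { replace ((- (1)) ^ n) with ((- (1)) ^ ((n - j) + j)) by (f_equal; lia).
      rewrite Cpow_add_r, <- Cmult_assoc, <- Cpow_mult_l.
      replace (- (1) * - (1)) with (RtoC 1) by ring. rewrite Cpow_1_l. ring. }
    rewrite <- Es. unfold Cdiv. ring.
Qed.

End Algebra.

(** * Inversion on coefficient sequences *)

Section Inversion.
Context (x nu : C) (hx : slit x) (hx1 : x <> 1) (hnu : (Re nu < 0)%R)
  (g : R -> C) (Hloop : loop_1_0plus g).

Let kappa : C := (1 - x) / (2 * Ci * PI * x).

(** Off the diagonal the sum telescopes to zero; on it the constants 2 i pi and x / (1 - x) are
    those that [kappa] compensates, 1 - nu being consumed by [hval_diag]. *)
Lemma mat_inverse k0 n :
  kappa * csum (fun i => matL x nu (S k0 + n) (S k0 + i) * matM g x nu (S k0 + i) (S k0)) (S n)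
  = match n with O => 1 | S _ => 0 end.
Proof.
  rewrite (mat_product x nu hx hx1 hnu g Hloop). destruct n as [|n].
  - assert (E := hval_diag x nu hx hnu g Hloop k0).
    cbn [csum Nat.sub]. rewrite expc_0.
    assert (N1 := one_minus_nu_nz nu hnu). assert (N2 := one_minus_x_nz x hx1).
    assert (N3 := slit_nz x hx).
    assert (NP : 2 * Ci * PI <> 0).
    { apply Cmult_neq_0; [apply Cmult_neq_0; [|apply Ci_nz]|]; intros E'; apply RtoC_inj in E';
        generalize PI_RGT_0; lra. }
    transitivity ((hval x nu g k0 0 0 * (1 - nu)) * (kappa * (x / (1 - x)))).
    + unfold Cdiv. simpl Cpow. ring.
    + rewrite E. unfold kappa.
      transitivity (2 * Ci * PI * / (2 * Ci * PI)); [|apply Cinv_r, NP].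
      field. repeat split; try assumption; try apply Ci_nz.
      intros E'. apply NP. rewrite E'. ring.
  - rewrite (telescoping x nu hx hnu g Hloop) by lia. ring.
Qed.

Lemma opL_opM (kc : nat -> C) b : kc O = 0 -> opL_coef x nu (opM_coef g x nu kc) b = kc b.
Proof.
  intros H0. unfold opL_coef, opM_coef. fold kappa.
  (* The triangular double sum is padded with zeros to a rectangle, so that the order of summation
     can be exchanged. *)
  transitivity (csum (fun l => csum (fun q => if Nat.ltb q l then
      kappa * (kc (S q) * (matL x nu b l * matM g x nu l (S q))) else 0) b) (S b)).
  { apply csum_ext. intros l Hl. replace b with (l + (b - l))%nat at 2 by lia.
    rewrite csum_add, (csum_0 (fun i => if Nat.ltb (l + i) l then _ else _)).
    - rewrite Cplus_0_r.
      transitivity (kappa * matL x nu b l * csum (fun q => kc (S q) * matM g x nu l (S q)) l);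
        [ring|].
      rewrite <- csum_scal. apply csum_ext. intros q Hq.
      apply Nat.ltb_lt in Hq as ->. ring.
    - intros i _. replace (Nat.ltb (l + i) l) with false; [reflexivity|].
      symmetry. apply Nat.ltb_ge. lia. }
  rewrite csum_swap.
  transitivity (csum (fun q => kc (S q) * (match (b - S q)%nat with O => 1 | S _ => 0 end)) b).
  { apply csum_ext. intros q Hq. rewrite <- (mat_inverse q (b - S q)).
    (* For fixed q only the indices l >= q + 1 contribute; the shift brings the sum to the form of
       [mat_inverse]. *)
    replace (S b) with (S q + S (b - S q))%nat by lia.
    rewrite csum_add, csum_0, Cplus_0_l.
    - rewrite <- !csum_scal. apply csum_ext. intros i _.
      replace (Nat.ltb q (S q + i)) with true by (symmetry; apply Nat.ltb_lt; lia).
      replace (S q + (b - S q))%nat with b by lia. ring.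
    - intros i Hi. replace (Nat.ltb q i) with false; [reflexivity|].
      symmetry. apply Nat.ltb_ge. lia. }
  destruct b as [|b]; [now rewrite H0|]. cbn [csum].
  rewrite csum_0, Nat.sub_diag; [ring|].
  intros q Hq. replace (S b - S q)%nat with (S (b - S q)) by lia. ring.
Qed.

(** A zero entry here would make the corresponding diagonal entry of the product 0 instead of 1. *)
Lemma matL_diag_nz k0 : matL x nu (S k0) (S k0) <> 0.
Proof.
  intros E. assert (H := mat_inverse k0 0). cbn [csum] in H. rewrite !Nat.add_0_r, E in H.
  apply C1_nz. rewrite <- H. ring.
Qed.

(** Forward substitution in a lower triangular system. The diagonal is controlled from index 1 on,
    so the constant terms have to agree beforehand. *)
Lemma opL_coef_inj (a a' : nat -> C) : a O = a' O ->
  (forall b, opL_coef x nu a b = opL_coef x nu a' b) -> forall b, a b = a' b.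
Proof.
  intros H0 H b. induction b as [b IH] using (well_founded_induction Wf_nat.lt_wf).
  destruct b as [|b]; [exact H0|].
  specialize (H (S b)). unfold opL_coef in H.
  change (csum (fun l => a l * matL x nu (S b) l) (S b) + a (S b) * matL x nu (S b) (S b)
    = csum (fun l => a' l * matL x nu (S b) l) (S b) + a' (S b) * matL x nu (S b) (S b)) in H.
  rewrite (csum_ext _ (fun l => a' l * matL x nu (S b) l)) in H.
  2:{ intros l Hl. now rewrite IH. }
  set (c := csum _ _) in H. set (d := matL x nu (S b) (S b)) in *.
  assert (Nd : d <> 0) by apply matL_diag_nz.
  apply Ceq_minus.
  transitivity ((c + a (S b) * d - (c + a' (S b) * d)) * / d); [field; exact Nd|].
  rewrite H. ring.
Qed.

End Inversion.

(** * Passage between entire functions and coefficient sequences, and conclusion *)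

Lemma entire_Zdiff f : entire f -> entireZ f.
Proof.
  intros H z. destruct (H z) as [l Hl]. exists l. now apply Zdiff_is_derive.
Qed.

Lemma entire0_series f : entire0 f ->
  exists a, good a /\ a O = 0 /\ forall z, is_Cseries (fun n => a n * z ^ n) (f z).
Proof.
  intros [He H0]. destruct (entire_PS f (entire_Zdiff f He)) as (a & Ga & Ha).
  exists a. split; [exact Ga|]. split; [|exact Ha].
  rewrite <- H0. refine (Clim_unique eventually _ _ _ _ (Ha 0)).
  apply Clim_ext_loc with (fun _ => a O); [tc| |apply Clim_const; tc].
  exists 1%nat. intros [|n] Hn; [lia|]. rewrite csum_first, csum_0.
  - simpl. ring.
  - intros k _. simpl. ring.
Qed.

Lemma series_entire0 a f : good a -> a O = 0 ->
  (forall z, is_Cseries (fun n => a n * z ^ n) (f z)) -> entire0 f.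
Proof.
  intros Ga H0 Hf.
  assert (E : forall z, PS a z = f z) by (intros z; apply PS_good_unique, Hf).
  split.
  - intros z. destruct (PS_derive a z Ga) as (l & _ & Hd). exists l.
    apply Zdiff_is_derive. apply Cdiff_ext with (PS a); [tc | exact E | exact Hd].
  - refine (Clim_unique eventually _ _ _ (Hf 0) _).
    apply Clim_ext_loc with (fun _ => a O); [tc| |].
    + exists 1%nat. intros [|n] Hn; [lia|]. rewrite csum_first, csum_0.
      * simpl. ring.
      * intros k _. simpl. ring.
    + rewrite H0. apply Clim_const. tc.
Qed.

Lemma series_unique a b (f : C -> C) : good a -> good b ->
  (forall z, is_Cseries (fun n => a n * z ^ n) (f z)) ->
  (forall z, is_Cseries (fun n => b n * z ^ n) (f z)) -> forall n, a n = b n.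
Proof.
  intros [_ Ga] [_ Gb] Ha Hb. apply (Cseries_pow_unique a b 1); [lra | apply Ga; lra | apply Gb; lra |].
  intros z _. exists (f z). auto.
Qed.

Lemma opL_coef_0 x nu (a : nat -> C) : a O = 0 -> opL_coef x nu a 0 = 0.
Proof. intros H. unfold opL_coef. cbn [csum]. rewrite H. ring. Qed.

Theorem corollary4p3 :
  forall x nu : C,
    ~ (Im x = 0%R /\ (Re x <= 0)%R) -> x <> 1 ->
    (Re nu < 0)%R ->
    (* the integrals defining the operator exist, and (a) *)
    ((forall (f : C -> C) (z : C), entire0 f -> ex_CRInt (opL_integrand x nu f z) 0 1)
     /\ bijective_on entire0 (opL x nu))
    /\
    (* (b) *)
    (forall K E : C -> C, entire0 K -> entire0 E ->
       (forall z : C, opL x nu E z = K z) ->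
       forall gamma : R -> C, loop_1_0plus gamma ->
       forall z : C,
         ex_CRInt (path_integrand (inv_integrand x nu K z) gamma) 0 1 /\
         E z = (1 - x) / (2 * Ci * PI * x) * Cexp z
                 * path_int (inv_integrand x nu K z) gamma).
Proof.
  intros x nu hx hx1 hnu. destruct loop_exists as [g Hg].
  assert (Hinj : forall f h, entire0 f -> entire0 h ->
    (forall z, opL x nu f z = opL x nu h z) -> forall z, f z = h z).
  { intros f h Hf Hh E z.
    destruct (entire0_series f Hf) as (a & Ga & A0 & Ha).
    destruct (entire0_series h Hh) as (b & Gb & B0 & Hb).
    destruct (opL_PS x nu hx hnu a f Ga Ha) as [Ga' Sa].
    destruct (opL_PS x nu hx hnu b h Gb Hb) as [Gb' Sb].
    assert (Eab : forall n, a n = b n).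
    { apply (opL_coef_inj x nu hx hx1 hnu g Hg); [now rewrite A0, B0|].
      apply (series_unique _ _ (opL x nu f) Ga' Gb'); intros w; [apply Sa|].
      rewrite E. apply Sb. }
    refine (Clim_unique eventually _ _ _ (Ha z) _).
    apply (is_Cseries_ext (fun n => b n * z ^ n)); [|apply Hb].
    intros n. now rewrite Eab. }
  (* The loop integral solves the equation for every loop: the fixed loop [g] gives surjectivity,
     and an arbitrary one gives (b) by injectivity. *)
  assert (Hsol : forall gamma K, loop_1_0plus gamma -> entire0 K ->
    (forall z, ex_CRInt (path_integrand (inv_integrand x nu K z) gamma) 0 1) /\
    let E := fun z => (1 - x) / (2 * Ci * PI * x) * Cexp z
               * path_int (inv_integrand x nu K z) gamma in
    entire0 E /\ forall z, opL x nu E z = K z).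
  { intros gamma K Hgam HK. destruct (entire0_series K HK) as (kc & Gk & K0 & Hk).
    destruct (opM_PS gamma Hgam x nu hnu kc K Gk K0 Hk) as [GM SM].
    split; [apply SM|]. intros E.
    assert (HE : forall z, is_Cseries (fun n => opM_coef gamma x nu kc n * z ^ n) (E z))
      by (intros z; apply SM).
    split.
    - apply (series_entire0 _ _ GM); [|exact HE]. unfold opM_coef. cbn [csum]. ring.
    - intros z. destruct (opL_PS x nu hx hnu _ E GM HE) as [_ SL].
      refine (Clim_unique eventually _ _ _ (proj2 (SL z)) _).
      apply is_Cseries_ext with (2 := Hk z). intros n.
      now rewrite (opL_opM x nu hx hx1 hnu gamma Hgam). }
  split; [split; [|split; [|split]]|].
  - intros f z Hf. destruct (entire0_series f Hf) as (a & Ga & _ & Ha).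
    apply (opL_PS x nu hx hnu a f Ga Ha).
  - intros f Hf. destruct (entire0_series f Hf) as (a & Ga & A0 & Ha).
    destruct (opL_PS x nu hx hnu a f Ga Ha) as [Ga' Sa].
    apply (series_entire0 _ _ Ga'); [now apply opL_coef_0 | apply Sa].
  - exact Hinj.
  - intros K HK. destruct (Hsol g K Hg HK) as [_ [HE HL]]. eexists. split; [exact HE | exact HL].
  - intros K E HK HE HL gamma Hgam z. destruct (Hsol gamma K Hgam HK) as [Hex [HE' HL']].
    split; [apply Hex|]. apply (Hinj E _ HE HE'). intros w. now rewrite HL, HL'.
Qed.
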